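(* Let $p=1$ and let $k\ge1$ be the level (so $\epsilon_1=1$, $\epsilon_2=k+1$). Under the isomorphism $\mathcal H_N\cong\mathbb C[p_1,\dots,p_N]$ the operators $t_{m,n}$ are represented as differential operators, and as $N\to\infty$ they have the following asymptotic expansions (for any fixed, sufficiently large energy truncation): for all $m,n\ge 0$, $$t_{m,n}=\sqrt N^{\,m+n}(k+1)^m\,p_{n-m}+O(\sqrt N^{\,m+n-2})\quad\text{if }m<n,$$ $$t_{n,n}=\frac1{n+1}(k+1)^n\sqrt N^{\,2n+2}+O(\sqrt N^{\,2n}),$$ $$t_{n,m}=\sqrt N^{\,n+m}(k+1)^{n-1}(n-m)\frac\partial{\partial p_{n-m}}+O(\sqrt N^{\,m+n-2})\quad\text{if }m<n,$$ $$[t_{2,1},t_{m,n}]=(2n-m)t_{m+1,n}+\begin{cases}O(\sqrt N^{\,m+n-1}),&m+1\ne n,\\O(\sqrt N^{\,m+n+1}),&m+1=n,\end{cases}$$ $$[t_{1,2},t_{m,n}]=(n-2m)t_{m,n+1}+\begin{cases}O(\sqrt N^{\,m+n-1}),&m\ne n+1,\\O(\sqrt N^{\,m+n+1}),&m=n+1.\end{cases}$$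
   Context: Operators. For $N\ge1$ consider operators $Z^i_j,Z^{\dagger i}_j,\lambda^i,\lambda^\dagger_i$ ($1\le i,j\le N$) with $[Z^i_j,Z^{\dagger k}_l]=\delta^i_l\delta^k_j$, $[\lambda^j,\lambda^\dagger_i]=\delta^j_i$ and all other commutators zero, acting on the Fock space generated by applying $Z^\dagger,\lambda^\dagger$ to a vacuum $|0\rangle$ with $Z^i_j|0\rangle=\lambda^i|0\rangle=0$. $t_{m,n}=\mathrm{Tr}\,\mathrm{Sym}(Z^mZ^{\dagger n})$, where Sym is the average over all orderings of the matrix product of $m$ copies of $Z$ and $n$ copies of $Z^\dagger$ (matrix product $(AB)^i_j=\sum_kA^i_kB^k_j$). Physical states are Fock states annihilated by all $\sum_k(Z^i_kZ^{\dagger k}_j-Z^{\dagger i}_kZ^k_j)-N\delta^i_j+\lambda^i\lambda^\dagger_j-(k+1)\delta^i_j$. The ground state is $$|\mathrm{ground}\rangle=\left[\epsilon^{i_1\cdots i_N}(\lambda^\dagger Z^{\dagger0})_{i_1}(\lambda^\dagger Z^{\dagger1})_{i_2}\cdots(\lambda^\dagger Z^{\dagger N-1})_{i_N}\right]^k|0\rangle .$$ The vectors $|c_1,\dots,c_N\rangle=\prod_{i=1}^N\left(N^{-i/2}\,\mathrm{Tr}(Z^{\dagger i})\right)^{c_i}|\mathrm{ground}\rangle$, $c_i\ge0$, are linearly independent; their span $\mathcal H_N$ is preserved by all $t_{m,n}$. The isomorphism $\mathcal H_N\cong\mathbb C[p_1,\dots,p_N]$ sends $|c_1,\dots,c_N\rangle$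 to $p_1^{c_1}\cdots p_N^{c_N}$; $p_i$ also denotes multiplication by $p_i$. Energy truncation. The energy of $p_1^{c_1}\cdots p_N^{c_N}$ (relative to the ground state) is $\sum_iic_i$, and $\mathcal H_N^{(\le E)}$ is the span of monomials of energy $\le E$; it is independent of $N$ for $N\ge E$. $t_{m,n}$ maps $\mathcal H_N^{(\le E)}$ to $\mathcal H_N^{(\le E+n-m)}$. Meaning of the asymptotics. For each fixed $E>m+n$, the stated expansion holds for the restricted operator on $\mathcal H_N^{(\le E)}$ (e.g. $t_{m,n}:\mathcal H_N^{(\le E)}\to\mathcal H_N^{(\le E+n-m)}$) for $N$ sufficiently large, where $O(\sqrt N^{\,q})$ denotes an operator whose matrix entries in the monomial bases are bounded by a constant, independent of $N$, times $N^{q/2}$. *)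

(* Defs.v *)
From HB Require Import structures.
From mathcomp Require Import all_boot all_order all_algebra.
From mathcomp Require Import reals complex mpoly.

Set Implicit Arguments.
Unset Strict Implicit.
Unset Printing Implicit Defensive.

Import Order.TTheory GRing.Theory Num.Theory.
Local Open Scope ring_scope.
Local Open Scope complex_scope.

Section FockSpace.
Variables (R : realType) (N : nat).

(** The Fock space in its polynomial (Bargmann) realization: the creation
    operators [Z^dagger^i_j] and [lambda^dagger_i] are multiplications by
    independent variables, the vacuum is the constant [1], and the annihilation
    operators are derivations.  The first [N * N] variables are the
    [Z^dagger^i_j], the last [N] ones are the [lambda^dagger_i]. *)
Local Notation F := {mpoly R[i][N * N + N]}.

Definition vacuum : F := 1.

Definition zvar (i j : 'I_N) : 'I_(N * N + N) := lshift N (mxvec_index i j).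
Definition lvar (i : 'I_N) : 'I_(N * N + N) := rshift (N * N) i.

Definition creZ (i j : 'I_N) (v : F) : F := 'X_(zvar i j) * v.
(** The indices are swapped because
    [[Z^i_j, Z^dagger^k_l] = delta^i_l delta^k_j]; see [annZ_creZ]. *)
Definition annZ (i j : 'I_N) (v : F) : F := v^`M(zvar j i).
Definition creL (i : 'I_N) (v : F) : F := 'X_(lvar i) * v.
Definition annL (i : 'I_N) (v : F) : F := v^`M(lvar i).

Lemma zvar_eq i j k l : (zvar i j == zvar k l) = (i == k) && (j == l).
Proof.
rewrite (inj_eq (@lshift_inj _ _)).
apply/eqP/andP => [e|[/eqP-> /eqP->]//].
by have [-> ->] : (i, j) = (k, l) by exact: enum_rank_inj (cast_ord_inj e).
Qed.

Let derX (a b : 'I_(N * N + N)) (v : F) :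
  ('X_b * v)^`M(a) - 'X_b * v^`M(a) = if a == b then v else 0.
Proof.
rewrite mderivM addrK mderivX mnm1E eq_sym.
case: eqP => [->|_]; last by rewrite scale0r mul0r.
have -> : (U_(b) - U_(b) = 0 :> 'X_{1..N * N + N})%MM.
  by apply/mnmP => i; rewrite mnmBE subnn mnm0E.
by rewrite mpolyX0 scale1r mul1r.
Qed.

Lemma annZ_creZ i j k l (v : F) :
  annZ i j (creZ k l v) - creZ k l (annZ i j v)
  = if (i == l) && (k == j) then v else 0.
Proof. by rewrite /annZ /creZ derX zvar_eq andbC (eq_sym j). Qed.

Lemma annL_creL i j (v : F) :
  annL j (creL i v) - creL i (annL j v) = if j == i then v else 0.
Proof. by rewrite /annL /creL derX (inj_eq (@rshift_inj _ _)). Qed.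

Lemma annZ_creL i j k (v : F) : annZ i j (creL k v) = creL k (annZ i j v).
Proof.
by apply/eqP; rewrite -subr_eq0 /annZ /creL derX eq_lrshift.
Qed.

Lemma annL_creZ i j k (v : F) : annL k (creZ i j v) = creZ i j (annL k v).
Proof.
by apply/eqP; rewrite -subr_eq0 /annL /creZ derX eq_rlshift.
Qed.

Lemma annZ_vacuum i j : annZ i j vacuum = 0.
Proof. exact: mderivC. Qed.

Lemma annL_vacuum i : annL i vacuum = 0.
Proof. exact: mderivC. Qed.

(** Matrices of operators on the Fock space; in a product the operator entries
    are composed in the order of the matrix factors. *)
Definition opmx := 'I_N -> 'I_N -> F -> F.
Definition op1mx : opmx := fun i j v => if i == j then v else 0.
Definition opmulmx (A B : opmx) : opmx :=
  fun i j v => \sum_(k < N) A i k (B k j v).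
Definition opmxtrace (A : opmx) (v : F) : F := \sum_(i < N) A i i v.

(** In a word, [true] stands for [Z^dagger] and [false] for [Z]. *)
Definition wordmx (w : seq bool) : opmx :=
  foldr (fun b A => opmulmx (if b then creZ else annZ) A) op1mx w.

(** [Sym (Z^m Z^dagger^n)]: average over the ['C(m + n, n)] orderings. *)
Definition symmx (m n : nat) : opmx := fun i j v =>
  ('C(m + n, n)%:R : R[i])^-1 *:
    \sum_(w : (m + n).-tuple bool | count_mem true w == n) wordmx w i j v.

Definition tFock (m n : nat) : F -> F := opmxtrace (symmx m n).

(** Creation operators commute, so a product of them applied to the vacuum is
    computed in the commutative ring [F]. *)
Definition Zdag : 'M[F]_N := \matrix_(i, j) 'X_(zvar i j).
Definition ldag : 'rV[F]_N := \row_i 'X_(lvar i).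

(** The contraction with [epsilon^{i_1 ... i_N}] is the determinant of the
    matrix whose row [r] is [lambda^dagger Z^dagger^r], [0 <= r < N]. *)
Definition ground (k : nat) : F :=
  (\det (\matrix_(r < N, i < N) (ldag *m Zdag ^+ r) 0 i)) ^+ k * vacuum.

Definition sqrtN : R[i] := sqrtC N%:R.

(** The state [|c_1, ..., c_N>]; the index [i : 'I_N] stands for [i + 1]. *)
Definition state (k : nat) (c : 'X_{1..N}) : F :=
  (\prod_(i < N) ((sqrtN ^- i.+1) *: \tr (Zdag ^+ i.+1)) ^+ c i) * ground k.

(** The linear map from [C[p_1, ..., p_N]] to the Fock space sending [p^c] to
    [|c_1, ..., c_N>]; its image is [H_N], and it is the inverse of the
    isomorphism of [H_N] with [C[p_1, ..., p_N]]. *)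
Definition ofpoly (k : nat) (f : {mpoly R[i][N]}) : F :=
  \sum_(c <- msupp f) f@_c *: state k c.

(** [T] is the operator on [C[p_1, ..., p_N]] corresponding to the operator [t]
    on [H_N]. *)
Definition represents (k : nat) (t : F -> F)
    (T : {mpoly R[i][N]} -> {mpoly R[i][N]}) : Prop :=
  forall f, ofpoly k (T f) = t (ofpoly k f).

(** Differential operators with polynomial coefficients: finite sums of
    operators [a_al(p) d^al]. *)
Definition diffop (T : {mpoly R[i][N]} -> {mpoly R[i][N]}) : Prop :=
  exists (s : seq 'X_{1..N}) (a : 'X_{1..N} -> {mpoly R[i][N]}),
    forall f, T f = \sum_(al <- s) a al * f^`M[al].

(** Multiplication by [p_d] and the derivation [d / d p_d]; both vanish unless
    [1 <= d <= N]. *)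
Definition mulp (d : nat) (f : {mpoly R[i][N]}) : {mpoly R[i][N]} :=
  \sum_(i < N | i.+1 == d) 'X_i * f.
Definition derp (d : nat) (f : {mpoly R[i][N]}) : {mpoly R[i][N]} :=
  \sum_(i < N | i.+1 == d) f^`M(i).

End FockSpace.

Arguments tFock : clear implicits.
Arguments sqrtN : clear implicits.

(** A family of operators on [C[p_1, ..., p_N]], one for each [N]. *)
Definition opfamily (R : realType) :=
  forall N : nat, {mpoly R[i][N]} -> {mpoly R[i][N]}.

Definition opcomm (R : realType) (A B : opfamily R) : opfamily R :=
  fun N f => A N (B N f) - B N (A N f).

(** [A = B + O(sqrt N ^ q)] on the states of energy at most [E], as [N] tends to
    infinity.  The energy of [p^c], the sum of the [i * c_i], is [mnmwgt c]. *)
Definition eqO (R : realType) (E : nat) (q : int) (A B : opfamily R) : Prop :=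
  exists (K : R[i]) (N0 : nat), forall N : nat, (N0 <= N)%N ->
  forall c d : 'X_{1..N}, (mnmwgt c <= E)%N ->
    `|(A N 'X_[c] - B N 'X_[c])@_d| <= K * (sqrtN R N) ^ q.

(* Main.v *)
Require Import Defs.
From mathcomp Require Import all_boot all_order all_algebra.
From mathcomp Require Import reals complex mpoly.
From mathcomp Require Import zify ring.

Set Implicit Arguments.
Unset Strict Implicit.
Unset Printing Implicit Defensive.

Import Order.TTheory GRing.Theory Num.Theory.
Local Open Scope ring_scope.
Local Open Scope complex_scope.

(** Write [P_a = Tr Z^dagger^a] and let [g] be the ground state. The operator [H = t_(2,0)]
    is the Laplacian [Tr Z^2]; it kills [g], and [t_(0,n)] is multiplication by [P_n], while
    [[H, t_(m,n+1)] = 2 (n + 1) t_(m+1,n)]. So everything is determined by [H], a second order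
    operator whose brackets are [[[H, P_a], P_b] = 2 a b P_(a+b-2)] and
    [[H, P_a] g = a ((k + 1) sum_(c+d=a-2) P_c P_d - k (a - 1) P_(a-2)) g].

    These formulas do not mention [N] except through [P_0 = N]. Expand [t_(m,n)] applied to
    [P_(a_1) ... P_(a_r) g] in such monomials, with coefficients independent of [N]. After
    normalization each [P_a] weighs [N^(a/2)] and each factor [P_0] weighs [N], so the order
    of a term is governed by its number of factors [P_0]. By induction on [m], up to products
    with fewer factors,
    [(m + 1) t_(m,n) g = (k + 1)^m sum_(c_0+...+c_m=n-m) P_(c_0) ... P_(c_m) g],
    [[t_(m,n), P_a] = m a t_(m-1,n+a-1)] and [[t_(1,a), t_(m,n)] = (n - m a) t_(m,n+a-1)].
    The bracket with [t_(2,1)] follows from the one with [t_(1,2)] by the Jacobi identity.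

    The passage to polynomials uses Newton's identities for the traces of a matrix, and the
    algebraic independence of [P_1, ..., P_N]: if [f(P) = 0], differentiating in [Z^dagger]
    gives a linear relation between the vectors [lambda^dagger Z^dagger^a], [a < N], whose
    determinant is the ground state for [k = 1]. *)

(** The constant [2 (n + 1)] reflects [[Tr Z^2, Z^dagger] = 2 Z]: bracketing with [H] turns one
    letter [Z^dagger] into [Z], at every place of a symmetrized word.

    The obstacle is that leading terms are computed on [g] only, while brackets must be controlled
    on all states. Estimates are therefore attached to operators: a class bounds the length of the
    terms of [D g] and of all iterated commutators of [D] with the [P_a], applied to [g]. Although
    [H] lengthens products, [[H, -]] raises the order of a class by just one.

    The two brackets are proved together. Jacobi's identity with [H] derives [[t_(m+1,n), P_a]] from
    [[t_(1,a-1), t_(m,n+1)]]; conversely [[t_(1,a), t_(m+1,n)]] is determined by its value on [g]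
    and by its commutators with the [P_b].

    A remainder with at most [q] factors has [q] factors [P_0] only if its energy is zero. This
    saves a factor [N] except when the energy shift vanishes, that is for [m + 1 = n] and
    [m = n + 1] in the last two expansions.

    The derivation in [p_(n-m)] appears because [[t_(n,m), P_a]] is to leading order
    [n a t_(n-1,m+a-1)], which is diagonal exactly for [a = n - m]. *)

(** * Complete sums of products *)

Section PowerSums.
Variables (A : comNzRingType) (P : nat -> A).

(** The sum of [P c_1 * ... * P c_q] over all [c_1 + ... + c_q = w]. *)
Fixpoint hsum (q w : nat) : A :=
  if q is q'.+1 then \sum_(c < w.+1) P c * hsum q' (w - c) else (w == 0)%:R.

(** Powers of one generating polynomial make the convolution identities below instances of the
    product rule and of the rule for derivatives. The truncation degree [W] is free, so several
    weights can share one polynomial. *)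
Lemma hsum_coef W q w : (w <= W)%N ->
  hsum q w = ((\poly_(c < W.+1) P c) ^+ q)`_w.
Proof.
elim: q w => [|q IH] w lewW /=; first by rewrite expr0 coef1.
rewrite exprS coefM; apply: eq_bigr => j _; rewrite coef_poly.
have ltjW : (j < W.+1)%N by have := ltn_ord j; lia.
by rewrite ltjW IH //; lia.
Qed.

Lemma hsum_mul a b w :
  \sum_(x < w.+1) hsum a x * hsum b (w - x) = hsum (a + b) w.
Proof.
rewrite (hsum_coef _ (leqnn w)) exprD coefM; apply: eq_bigr => j _.
by rewrite -!hsum_coef //; have := ltn_ord j; lia.
Qed.

(** Compare coefficients in [a (p^(a+b))' = (a+b) (p^a)' p^b]: each of the [a + b] factors carries
    the same share of the total weight. *)
Lemma hsum_weight a b w :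
  (a + b)%:R * \sum_(x < w.+1) x%:R * hsum a x * hsum b (w - x)
  = (a * w)%:R * hsum (a + b) w.
Proof.
case: w => [|w]; first by rewrite big_ord1 !(muln0, mul0r, mulr0).
rewrite big_ord_recl !mul0r add0r.
set p := \poly_(c < w.+2) P c.
have coefx q x : (x <= w.+1)%N -> hsum q x = (p ^+ q)`_x.
  exact: hsum_coef.
have dE : ((p ^+ (a + b))^`() * a%:R = (p ^+ a)^`() * p ^+ b * (a + b)%:R).
  rewrite !deriv_exp.
  case: a => [|a]; first by rewrite !(mulr0n, mul0r, mulr0).
  rewrite addSn /= exprD.
  by ring.
have := congr1 (fun q : {poly A} => q`_w) dE.
rewrite -!polyC_natr !coefMC coef_deriv coefM -(coefx (a + b)%N) // => E.
transitivity (hsum (a + b) w.+1 *+ w.+1 * a%:R); last first.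
  by rewrite natrM -mulr_natr; ring.
rewrite E mulrC; congr (_ * _).
apply: eq_bigr => i _; rewrite lift0 coef_deriv.
have lt_i := ltn_ord i.
rewrite (coefx a) ?(coefx b); [|lia..].
by rewrite subSS mulr_natl.
Qed.

Lemma hsumS q w : hsum q.+1 w = \sum_(c < w.+1) P c * hsum q (w - c).
Proof. by []. Qed.

Arguments hsum : simpl never.

Lemma hsum1 w : hsum 1 w = P w.
Proof.
rewrite hsumS big_ord_recr /= {2}/hsum subnn mulr1 big1 ?add0r // => i _.
by rewrite /hsum subn_eq0 leqNgt ltn_ord mulr0.
Qed.

Lemma hsum_weight1 q w :
  q.+1%:R * \sum_(c < w.+1) c%:R * P c * hsum q (w - c)
  = w%:R * hsum q.+1 w.
Proof.
have := hsum_weight 1 q w; rewrite add1n mul1n => <-; congr (_ * _).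
by apply: eq_bigr => c _; rewrite hsum1.
Qed.

Lemma convolutionCA (f f' h : nat -> A) w :
  \sum_(c < w.+1) f c * \sum_(d < (w - c).+1) f' d * h (w - c - d)%N
  = \sum_(c < w.+1) f' c * \sum_(d < (w - c).+1) f d * h (w - c - d)%N.
Proof.
pose p (e : nat -> A) := \poly_(i < w.+1) e i.
have pE e i : (i <= w)%N -> (p e)`_i = e i.
  by rewrite coef_poly ltnS => ->.
have conv (e1 e2 : nat -> A) : \sum_(c < w.+1) e1 c *
    \sum_(d < (w - c).+1) e2 d * h (w - c - d)%N = (p e1 * (p e2 * p h))`_w.
  rewrite coefM; apply: eq_bigr => c _; have := ltn_ord c => lt_c.
  rewrite pE; last lia.
  congr (_ * _); rewrite coefM; apply: eq_bigr => d _; have := ltn_ord d => lt_d.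
  by rewrite !pE //; lia.
by rewrite !conv mulrCA.
Qed.

(** Weights such as [n - m] may be negative; no product has such a weight, so the sum is then
    empty. *)
Definition hsumz q (w : int) : A := if w is Posz w' then hsum q w' else 0.

Arguments hsumz : simpl never.

Lemma hsumzE q (w : nat) : hsumz q w = hsum q w. Proof. by []. Qed.

Lemma hsumz_lt0 q (w : int) : w < 0 -> hsumz q w = 0.
Proof. by case: w. Qed.

(** Both sums are pieces of a single sum over [x] of [(x - b) P_x] times the rest, of weight
    [w + b - x]: the first is [x = b + c], the second [x = b - c]. By [hsum_weight1] the factor [x]
    averages to [(w + b) / (m + 1)], which leaves [w - m b]. This is the origin of [n - m a] in the
    bracket with [t 1 a]. *)
Lemma hsum_shift m b (w : int) :
  m.+1%:R * ((if w is Posz w' then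
     \sum_(c < w'.+1) c%:R * P (b + c) * hsum m (w' - c) else 0)
   - \sum_(c < b.+1) c%:R * P (b - c) * hsumz m (w + c%:Z))
  = (w%:~R - (m * b)%:R) * hsumz m.+1 (w + b%:Z).
Proof.
have -> : \sum_(c < b.+1) c%:R * P (b - c) * hsumz m (w + c%:Z) =
    - \sum_(0 <= x < b) (x%:R - b%:R) * P x * hsumz m (w + b%:Z - x%:Z).
  have -> : \sum_(0 <= x < b) (x%:R - b%:R) * P x * hsumz m (w + b%:Z - x%:Z)
    = \sum_(0 <= x < b.+1) (x%:R - b%:R) * P x * hsumz m (w + b%:Z - x%:Z).
    by rewrite big_nat_recr //= subrr !mul0r addr0.
  rewrite big_mkord -sumrN (reindex_inj rev_ord_inj) /=.
  apply: eq_bigr => x _; have lt_x := ltn_ord x.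
  have -> : (b.+1 - x.+1 = b - x)%N by lia.
  have -> : (b - (b - x) = x)%N by lia.
  have -> : w + (b - x)%N%:Z = w + b%:Z - x%:Z by lia.
  by rewrite natrB; [ring|lia].
rewrite opprK.
have [lt0|] := ltrP (w + b%:Z) 0.
  rewrite hsumz_lt0 // mulr0 big1_seq.
    by case: w lt0 => [w|w _]; [lia|rewrite addr0 mulr0].
  move=> x _; rewrite hsumz_lt0 ?mulr0 //; lia.
case eW : (w + b%:Z) => [W|] // _.
have wE : w = W%:Z - b%:Z by lia.
transitivity (m.+1%:R * \sum_(0 <= x < W.+1) (x%:R - b%:R) * P x * hsumz m (W%:Z - x%:Z)).
  congr (_ * _); case: w eW wE => [w|w] eW wE.
    have leb : (b <= W.+1)%N by lia.
    rewrite [RHS](big_cat_nat (n := b)) //= [RHS]addrC; congr (_ + _).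
    rewrite -[X in _ = \sum_(X <= _ < _) _]add0n big_addn big_mkord.
    have -> : (W.+1 - b = w.+1)%N by lia.
    apply: eq_bigr => c _; have lt_c := ltn_ord c.
    have -> : W%:Z - (c + b)%N%:Z = (w - c)%N%:Z by lia.
    by rewrite hsumzE natrD addrK addnC.
  have leb : (W.+1 <= b)%N by lia.
  rewrite add0r (big_cat_nat (n := W.+1) (p := b)) //= addrC big1_seq ?add0r // => x.
  rewrite mem_index_iota => /andP[_ /andP[h _]].
  by rewrite hsumz_lt0 ?mulr0 //; lia.
rewrite big_mkord hsumzE.
have e1 : \sum_(x < W.+1) (x%:R - b%:R) * P x * hsumz m (W%:Z - x%:Z) =
   \sum_(x < W.+1) x%:R * P x * hsum m (W - x) - b%:R * hsum m.+1 W.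
  rewrite hsumS mulr_sumr -sumrB; apply: eq_bigr => x _; have lt_x := ltn_ord x.
  have -> : W%:Z - x%:Z = (W - x)%N%:Z by lia.
  by rewrite hsumzE; ring.
rewrite e1 mulrBr hsum_weight1 wE rmorphB /= -!pmulrn natrM; ring.
Qed.

(** The case [b = -1] of [hsum_shift], where the second sum is empty; it serves the bracket with
    [t 1 0]. *)
Lemma hsum_drop m w :
  m.+1%:R * \sum_(c < w.+1) c%:R * P c.-1 * hsum m (w - c)
  = (w + m)%:R * hsumz m.+1 (w%:Z - 1).
Proof.
case: w => [|w]; first by rewrite big_ord1 hsumz_lt0 // !(mul0r, mulr0).
rewrite big_ord_recl !mul0r add0r.
have -> : w.+1%:Z - 1 = w%:Z by lia.
have -> : \sum_(i < w.+1) (lift ord0 i)%:R * P (lift ord0 i).-1 * hsum m (w.+1 - lift ord0 i)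
   = \sum_(c < w.+1) c%:R * P c * hsum m (w - c) + hsum m.+1 w.
  rewrite hsumS -big_split; apply: eq_bigr => c _ /=.
  by rewrite /bump /= !add1n subSS /= -natr1; ring.
by rewrite mulrDr hsum_weight1 hsumzE; ring.
Qed.

(** Shows that the coefficient [2 q (w + q - 1)] of [spanned_H_hsum] propagates from [q] to [q + 1].
    The first sum is [H] acting on the last [q] factors, the second is the pair of factors created
    by the bracket of [H] with the first one. Both reduce to [hsum_weight]. *)
Lemma hsum_lap q w :
  q.+2%:R * \sum_(c < w.+1) (2 * q * (w - c + q - 1))%:R *
       (P c * hsumz q.+1 ((w - c)%N%:Z - 2))
  + (q.+1 * q.+2)%:R * \sum_(c < w.+1) c%:R * (hsumz 2 (c%:Z - 2) * hsum q (w - c))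
  = (q.+1 * (2 * q.+1 * (w + q)))%:R * hsumz q.+2 (w%:Z - 2).
Proof.
case: w => [|[|W]].
- by rewrite !big_ord1 !hsumz_lt0 // !(mulr0, mul0r) addr0.
- by rewrite !big_ord_recl !big_ord0 /= !hsumz_lt0 // !(mulr0, mul0r, addr0).
have -> : W.+2%:Z - 2 = W%:Z by lia.
rewrite hsumzE [X in _ * X + _]big_ord_recr [X in _ * (X + _) + _]big_ord_recr /=.
rewrite (_ : hsumz q.+1 ((W.+2 - W.+2)%N%:Z - 2) = 0); last by rewrite hsumz_lt0 //; lia.
rewrite (_ : hsumz q.+1 ((W.+2 - W.+1)%N%:Z - 2) = 0); last by rewrite hsumz_lt0 //; lia.
rewrite !mulr0 !addr0 [X in _ + _ * X]big_ord_recl [X in _ + _ * (_ + X)]big_ord_recl.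
rewrite !hsumz_lt0 // !(mul0r, mulr0, add0r).
have -> : \sum_(c < W.+1) (2 * q * (W.+2 - c + q - 1))%:R *
       (P c * hsumz q.+1 ((W.+2 - c)%N%:Z - 2)) =
   (2 * q * (W + 1 + q))%:R * hsum q.+2 W -
   (2 * q)%:R * \sum_(c < W.+1) c%:R * P c * hsum q.+1 (W - c).
  rewrite (hsumS q.+1) !mulr_sumr -sumrB; apply: eq_bigr => c _; have lt_c := ltn_ord c.
  have -> : (W.+2 - c)%N%:Z - 2 = (W - c)%N%:Z by lia.
  rewrite hsumzE.
  have -> : (2 * q * (W.+2 - c + q - 1))%:R = (2 * q * (W + 1 + q))%:R - (2 * q)%:R * c%:R :> A.
    by rewrite -natrM -natrB; [congr (_%:R); nia|nia].
  ring.
have -> : \sum_(i < W.+1) (lift ord0 (lift ord0 i))%:R *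
   (hsumz 2 ((lift ord0 (lift ord0 i))%:Z - 2) * hsum q (W.+2 - lift ord0 (lift ord0 i)))
   = 2%:R * hsum q.+2 W + \sum_(x < W.+1) x%:R * hsum 2 x * hsum q (W - x).
  rewrite -(add2n q) -(hsum_mul 2 q) mulr_sumr -big_split; apply: eq_bigr => c _ /=.
  rewrite /bump /= !add1n.
  have -> : c.+2%:Z - 2 = c%:Z by lia.
  by rewrite hsumzE !subSS; ring.
have := hsum_weight1 q.+1 W; set S1 := \sum_(c < _) _ => E1.
have := hsum_weight 2 q W; rewrite add2n; set S2 := \sum_(c < _) _ => E2.
transitivity (q.+2%:R * ((2 * q * (W + 1 + q))%:R * hsum q.+2 W) -
   (2 * q)%:R * (q.+2%:R * S1) + q.+1%:R * (q.+2%:R * (2%:R * hsum q.+2 W) + q.+2%:R * S2)).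
  by ring.
by rewrite E1 E2; ring.
Qed.

End PowerSums.
Arguments hsum : simpl never.
Arguments hsumz : simpl never.

(** * Operators on families indexed by N *)

Section Families.
Variables (K : numFieldType) (A : nat -> comAlgType K).
Variables (P : forall N, nat -> A N) (g : forall N, A N).

Definition psprod N (s : seq nat) : A N := \prod_(a <- s) P N a.

Lemma psprod_nil N : psprod N [::] = 1.
Proof. exact: big_nil. Qed.

Lemma psprod_cons N a s : psprod N (a :: s) = P N a * psprod N s.
Proof. exact: big_cons. Qed.

Lemma perm_psprod N s s' : perm_eq s s' -> psprod N s = psprod N s'.
Proof. exact: perm_big. Qed.

(** The vectors that are combinations of the [psprod s * g], [s] in [Q], with
    coefficients that do not depend on [N]. *)
Definition spanned (Q : pred (seq nat)) (v : forall N, A N) :=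
  exists2 l : seq (K * seq nat), all (fun x => Q x.2) l &
    forall N, v N = \sum_(x <- l) x.1 *: (psprod N x.2 * g N).

Lemma spanned_ext Q v w : (forall N, v N = w N) -> spanned Q v -> spanned Q w.
Proof. by move=> e [l Ql E]; exists l => // N; rewrite -e. Qed.

Lemma spanned0 Q v : (forall N, v N = 0) -> spanned Q v.
Proof. by move=> v0; exists [::] => // N; rewrite big_nil v0. Qed.

Lemma spannedD Q v w : spanned Q v -> spanned Q w ->
  spanned Q (fun N => v N + w N).
Proof.
move=> [l Ql E] [l' Ql' E']; exists (l ++ l'); first by rewrite all_cat Ql.
by move=> N; rewrite big_cat /= E E'.
Qed.

Lemma spannedZ Q c v : spanned Q v -> spanned Q (fun N => c *: v N).
Proof.
move=> [l Ql E]; exists [seq (c * x.1, x.2) | x <- l]; first by rewrite all_map.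
move=> N; rewrite big_map E scaler_sumr.
by apply: eq_bigr => x _; rewrite scalerA.
Qed.

Lemma spannedM_nat Q n v : spanned Q v -> spanned Q (fun N => n%:R * v N).
Proof.
move=> /(spannedZ n%:R); apply: spanned_ext => N.
by rewrite scaler_nat mulr_natl.
Qed.

(** Allows estimates to be proved after clearing denominators, the division being made in the
    coefficients. *)
Lemma spanned_natK Q n v : (0 < n)%N ->
  spanned Q (fun N => n%:R * v N) -> spanned Q v.
Proof.
case: n => // n _ /(spannedZ n.+1%:R^-1); apply: spanned_ext => N.
by rewrite mulr_natl -scaler_nat scalerA mulVf ?scale1r // pnatr_eq0.
Qed.

Lemma spannedN Q v : spanned Q v -> spanned Q (fun N => - v N).
Proof. by move=> /(spannedZ (-1)); apply: spanned_ext => N; rewrite scaleN1r. Qed.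

Lemma spannedB Q v w : spanned Q v -> spanned Q w ->
  spanned Q (fun N => v N - w N).
Proof. by move=> Qv /spannedN; apply: spannedD. Qed.

Lemma spanned_sum (I : Type) (r : seq I) Q (v : I -> forall N, A N) :
  (forall i, spanned Q (v i)) -> spanned Q (fun N => \sum_(i <- r) v i N).
Proof.
move=> Qv; elim: r => [|i r IH].
  by apply: spanned0 => N; rewrite big_nil.
by apply: spanned_ext (spannedD (Qv i) IH) => N; rewrite big_cons.
Qed.

Lemma spanned_psprod (Q : pred (seq nat)) s : Q s -> spanned Q (fun N => psprod N s * g N).
Proof.
move=> Qs; exists [:: (1, s)]; rewrite /= ?Qs // => N.
by rewrite big_seq1 scale1r.
Qed.

Lemma spanned_sub (Q Q' : pred (seq nat)) v : subpred Q Q' ->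
  spanned Q v -> spanned Q' v.
Proof.
by move=> sQ [l Ql E]; exists l => //; apply: sub_all Ql => x; apply: sQ.
Qed.

Definition lin (D : forall N, A N -> A N) :=
  forall N c u v, D N (c *: u + v) = c *: D N u + D N v.

Section Linear.
Variable D : forall N, A N -> A N.
Arguments D : clear implicits.
Hypothesis linD : lin D.
Arguments linD : clear implicits.

Lemma lin_D (N : nat) (u v : A N) : D N (u + v) = D N u + D N v.
Proof. by have := linD N 1 u v; rewrite !scale1r. Qed.
Lemma lin_0 (N : nat) : D N 0 = 0.
Proof. by have /eqP := @lin_D N 0 0; rewrite addr0 -subr_eq subrr => /eqP. Qed.
Lemma lin_Z (N : nat) c (u : A N) : D N (c *: u) = c *: D N u.
Proof. by have := linD N c u 0; rewrite !addr0 lin_0 addr0. Qed.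
Lemma lin_N (N : nat) (u : A N) : D N (- u) = - D N u.
Proof. by rewrite -scaleN1r lin_Z scaleN1r. Qed.
Lemma lin_B (N : nat) (u v : A N) : D N (u - v) = D N u - D N v.
Proof. by rewrite lin_D lin_N. Qed.
Lemma lin_nat (N : nat) n (u : A N) : D N (n%:R * u) = n%:R * D N u.
Proof. by rewrite !mulr_natl -!(scaler_nat n) lin_Z. Qed.
Lemma lin_sum (N : nat) (I : Type) (r : seq I) (F : I -> A N) :
  D N (\sum_(i <- r) F i) = \sum_(i <- r) D N (F i).
Proof.
by elim: r => [|i r IH]; rewrite ?big_nil ?lin_0 // !big_cons lin_D IH.
Qed.

Lemma spanned_lin (Q Q' : pred (seq nat)) v :
  (forall s, Q s -> spanned Q' (fun N => D N (psprod N s * g N))) ->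
  spanned Q v -> spanned Q' (fun N => D N (v N)).
Proof.
move=> QD [l Ql E].
have: spanned Q' (fun N => \sum_(x <- l) x.1 *: D N (psprod N x.2 * g N)).
  elim: l Ql {E} => [|x l IH] /=; first by move=> _; apply: spanned0 => N; rewrite big_nil.
  move=> /andP[Qx Ql]; apply: spanned_ext (spannedD (spannedZ x.1 (QD _ Qx)) (IH Ql)).
  by move=> N; rewrite big_cons.
by apply: spanned_ext => N; rewrite E lin_sum; apply: eq_bigr => x _; rewrite lin_Z.
Qed.
End Linear.

Lemma spannedM (Q Q' : pred (seq nat)) a v :
  (forall s, Q s -> Q' (a :: s)) -> spanned Q v ->
  spanned Q' (fun N => P N a * v N).
Proof.
move=> QQ'; apply: (@spanned_lin (fun N v => P N a * v)) => [N c u w|s Qs].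
  by rewrite mulrDr scalerAr.
by apply: spanned_ext (spanned_psprod (QQ' _ Qs)) => N; rewrite psprod_cons mulrA.
Qed.

Definition adP (D : forall N, A N -> A N) a N v := D N (P N a * v) - P N a * D N v.

Lemma lin_adP D a : lin D -> lin (adP D a).
Proof.
move=> linD N c u v.
by rewrite /adP mulrDr -scalerAr linD linD mulrDr scalerBr -scalerAr opprD addrACA.
Qed.

Lemma lin_comm D D' : lin D -> lin D' -> lin (fun N v => D N (D' N v) - D' N (D N v)).
Proof. by move=> l l' N c u v; rewrite !(l, l') scalerBr opprD addrACA. Qed.

Lemma linB D D' : lin D -> lin D' -> lin (fun N v => D N v - D' N v).
Proof. by move=> l l' N c u v; rewrite !(l, l') scalerBr opprD addrACA. Qed.

(** * Length, energy, and classes of operators *)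

Definition szsum q (e : int) : pred (seq nat) :=
  fun s => (size s <= q)%N && ((sumn s)%:Z == e).

Lemma szsum_widen q q' e : (q <= q')%N -> subpred (szsum q e) (szsum q' e).
Proof. by move=> le s /andP[h1 h2]; rewrite /szsum h2 (leq_trans h1 le). Qed.

Lemma szsum_cons q e a s : szsum q e s -> szsum q.+1 (e + a%:Z) (a :: s).
Proof.
by move=> /andP[h1 /eqP h2]; rewrite /szsum /= ltnS h1 PoszD h2 addrC eqxx.
Qed.

(** Differential operators of order at most [q] and energy [e]; in addition
    each of the [j]-fold commutators with the [P a] maps [g] to
    [spanned (szsum (q - j) _)]. *)
Fixpoint cls0 (q : nat) (e : int) (D : forall N, A N -> A N) : Prop :=
  spanned (szsum q e) (fun N => D N (g N)) /\
  if q is q'.+1 then forall a : nat, cls0 q' (e + a%:Z) (adP D a)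
  else forall a N v, adP D a v = 0 :> A N.

Definition cls q e D := lin D /\ cls0 q e D.

Lemma cls_g q e D : cls q e D -> spanned (szsum q e) (fun N => D N (g N)).
Proof. by case=> _; case: q => [|q] []. Qed.

Lemma cls_adP q e D a : cls q.+1 e D -> cls q (e + a%:Z) (adP D a).
Proof. by case=> l [_ h]; split; [exact: lin_adP|exact: h]. Qed.

Lemma cls_adP0 e D : cls 0 e D -> forall a N v, adP D a v = 0 :> A N.
Proof. by case=> l []. Qed.

Lemma clsS q e D : lin D -> spanned (szsum q.+1 e) (fun N => D N (g N)) ->
  (forall a : nat, cls q (e + a%:Z) (adP D a)) -> cls q.+1 e D.
Proof. by move=> l h1 h2; split=> //; split=> // a; case: (h2 a). Qed.

Lemma cls_ext q e D D' : (forall N v, D N v = D' N v) -> cls q e D -> cls q e D'.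
Proof.
move=> E [l h]; split; first by move=> N c u v; rewrite -!E.
elim: q e D D' E {l} h => [|q IH] e D D' E [h1 h2]; split.
- by apply: spanned_ext h1 => N; rewrite E.
- by move=> a N v; rewrite /adP -!E; apply: h2.
- by apply: spanned_ext h1 => N; rewrite E.
- by move=> a; apply: IH (h2 a) => N v; rewrite /adP !E.
Qed.

Lemma cls0P q e D : (forall N v, D N v = 0) -> cls q e D.
Proof.
move=> D0; split; first by move=> N c u v; rewrite !D0 scaler0 addr0.
elim: q e D D0 => [|q IH] e D D0; split; try by apply: spanned0 => N.
  by move=> a N v; rewrite /adP !D0 mulr0 subr0.
by move=> a; apply: IH => N v; rewrite /adP !D0 mulr0 subr0.
Qed.

Lemma cls0_ext q e D D' : (forall N v, D N v = D' N v) -> cls0 q e D -> cls0 q e D'.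
Proof.
elim: q e D D' => [|q IH] e D D' E [h1 h2]; split.
- by apply: spanned_ext h1 => N; rewrite E.
- by move=> a N v; rewrite /adP -!E; apply: h2.
- by apply: spanned_ext h1 => N; rewrite E.
- by move=> a; apply: IH (h2 a) => N v; rewrite /adP !E.
Qed.

Lemma clsD q e D D' : cls q e D -> cls q e D' -> cls q e (fun N v => D N v + D' N v).
Proof.
move=> [l h] [l' h']; split.
  by move=> N c u v; rewrite l l' scalerDr addrACA.
elim: q e D D' h h' {l l'} => [|q IH] e D D' [h1 h2] [h1' h2'].
  split=> [|a N v]; first exact: spannedD.
  have := h2 a N v; have := h2' a N v; rewrite /adP => e1 e2.
  by rewrite mulrDr opprD addrACA e1 e2 addr0.
split=> [|a]; first exact: spannedD.
apply: cls0_ext (IH _ _ _ (h2 a) (h2' a)) => N v.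
by rewrite /adP mulrDr opprD addrACA.
Qed.

Lemma clsZ q e c D : cls q e D -> cls q e (fun N v => c *: D N v).
Proof.
move=> [l h]; split.
  by move=> N d u v; rewrite l scalerDr !scalerA mulrC.
elim: q e D h {l} => [|q IH] e D [h1 h2].
  split=> [|a N v]; first exact: spannedZ.
  by have := h2 a N v; rewrite /adP -scalerAr -scalerBr => ->; rewrite scaler0.
split=> [|a]; first exact: spannedZ.
by apply: cls0_ext (IH _ _ (h2 a)) => N v; rewrite /adP -scalerAr -scalerBr.
Qed.

Lemma clsM_nat q e n D : cls q e D -> cls q e (fun N v => n%:R * D N v).
Proof.
by move/(clsZ n%:R); apply: cls_ext => N v; rewrite scaler_nat mulr_natl.
Qed.

Lemma cls_natK q e n D : (0 < n)%N ->
  cls q e (fun N v => n%:R * D N v) -> cls q e D.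
Proof.
case: n => // n _ /(clsZ n.+1%:R^-1); apply: cls_ext => N v.
by rewrite mulr_natl -scaler_nat scalerA mulVf ?scale1r // pnatr_eq0.
Qed.

Lemma clsB q e D D' : cls q e D -> cls q e D' -> cls q e (fun N v => D N v - D' N v).
Proof.
move=> h /(clsZ (-1)) h'; apply: cls_ext (clsD h h') => N v.
by rewrite scaleN1r.
Qed.

Lemma cls_widen q e D : cls q e D -> cls q.+1 e D.
Proof.
elim: q e D => [|q IH] e D h.
  apply: clsS; [by case: h| |].
    by apply: spanned_sub (cls_g h); apply: szsum_widen.
  by move=> a; apply: cls0P; apply: cls_adP0 h a.
apply: clsS; [by case: h| |].
  by apply: spanned_sub (cls_g h); apply: szsum_widen.
by move=> a; apply: IH; apply: cls_adP.
Qed.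

Lemma cls_adP_widen q e D a : cls q e D -> cls q (e + a%:Z) (adP D a).
Proof.
case: q => [|q] h; first by apply: cls0P; apply: cls_adP0 h a.
exact/cls_widen/cls_adP.
Qed.

Lemma spanned_mul_adP q e D a b : cls q e D ->
  spanned (szsum q (e + a%:Z + b%:Z)) (fun N => P N b * adP D a (g N)).
Proof.
case: q => [|q] h.
  by apply: spanned0 => N; rewrite (cls_adP0 h) mulr0.
apply: spannedM (cls_g (cls_adP a h)) => s; exact: szsum_cons.
Qed.

(** The exponent of [N] carried by [psprod s] exceeds [sumn s / 2] by the number
    of zeros in [s], because [P N 0 = N]. *)
Definition zsum q (e : int) : pred (seq nat) :=
  fun s => (count_mem 0%N s < q)%N && ((sumn s)%:Z == e).

Lemma zsum_cons q e a s : (0 < a)%N -> zsum q e s -> zsum q (e + a%:Z) (a :: s).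
Proof.
case: a => // a _ /andP[h1 /eqP h2].
by rewrite /zsum /= add0n h1 PoszD h2 addrC eqxx.
Qed.

Lemma szsum_zsum q e : subpred (szsum q e) (zsum q.+1 e).
Proof.
move=> s /andP[h1 h2]; rewrite /zsum h2 andbT ltnS.
exact: leq_trans (count_size _ _) h1.
Qed.

(** A list consisting of [q] zeros has sum zero, so a nonzero energy forbids it. This is the gain of
    a factor [N] outside the exceptional cases. *)
Lemma szsum_zsum_neq0 q e : e != 0 -> subpred (szsum q e) (zsum q e).
Proof.
move=> e0 s /andP[h1 h2]; rewrite /zsum h2 andbT.
apply: leq_trans h1; rewrite ltn_neqAle count_size andbT.
apply: contraNneq e0 => E; rewrite -(eqP h2).
have /all_pred1P -> : all (pred1 0%N) s by rewrite all_count E.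
by rewrite sumn_nseq mul0n.
Qed.

Lemma adP_eq D a N v : D N (P N a * v) = P N a * D N v + adP D a v.
Proof. by rewrite /adP addrC subrK. Qed.

Lemma adP_psprod D s a N : D N (psprod N (a :: s) * g N) =
  P N a * D N (psprod N s * g N) + adP D a (psprod N s * g N).
Proof. by rewrite psprod_cons -mulrA adP_eq. Qed.

(** Moving [D] past [P_a] either keeps the factor, which adds no zero since [a > 0], or replaces [D]
    by a commutator, again of order at most [q]. *)
Lemma cls_psprod q e D s : cls q e D -> all (leq 1) s ->
  spanned (zsum q.+1 (e + (sumn s)%:Z)) (fun N => D N (psprod N s * g N)).
Proof.
elim: s q e D => [|a s IH] q e D h /=.
  move=> _; rewrite addr0; apply: (spanned_sub (@szsum_zsum q e)).
  by apply: spanned_ext (cls_g h) => N; rewrite psprod_nil mul1r.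
move=> /andP[a0 s0].
apply: spanned_ext (fun N => esym (adP_psprod D s a N)) _.
apply: spannedD.
  have -> : e + (a + sumn s)%:Z = e + (sumn s)%:Z + a%:Z.
    by rewrite -addrA -PoszD addnC.
  by apply: spannedM (IH _ _ _ h s0) => t; apply: zsum_cons.
by rewrite PoszD addrA; apply: IH => //; apply: cls_adP_widen.
Qed.

(** Reduces a bound on all states to one on [g] and one on the commutators, which may be obtained
    for different reasons. *)
Lemma spanned_psprod_ind q e D s : spanned (zsum q e) (fun N => D N (g N)) ->
  (forall a t, (0 < a)%N -> all (leq 1) t ->
     spanned (zsum q (e + a%:Z + (sumn t)%:Z)) (fun N => adP D a (psprod N t * g N))) ->
  all (leq 1) s ->
  spanned (zsum q (e + (sumn s)%:Z)) (fun N => D N (psprod N s * g N)).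
Proof.
move=> hg hP; elim: s => [|a s IH] /=.
  move=> _; rewrite addr0.
  by apply: spanned_ext hg => N; rewrite psprod_nil mul1r.
move=> /andP[a0 s0].
apply: spanned_ext (fun N => esym (adP_psprod D s a N)) _.
apply: spannedD; last by rewrite PoszD addrA; apply: hP.
have -> : e + (a + sumn s)%:Z = e + (sumn s)%:Z + a%:Z.
  by rewrite -addrA -PoszD addnC.
by apply: spannedM (IH s0) => t; apply: zsum_cons.
Qed.

(** The bound of [cls_psprod] improves by one: on [g] because the energy is nonzero, and on the
    commutators because they have order [q - 1]. *)
Lemma cls_psprod_neq0 q e D s : cls q e D -> e != 0 -> all (leq 1) s ->
  spanned (zsum q (e + (sumn s)%:Z)) (fun N => D N (psprod N s * g N)).
Proof.
move=> h e0; apply: spanned_psprod_ind.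
  by apply: (spanned_sub (@szsum_zsum_neq0 q e e0)); apply: cls_g.
move=> a t a0 t0; case: q h => [|q] h.
  by apply: spanned0 => N; rewrite (cls_adP0 h).
by apply: cls_psprod => //; apply: cls_adP.
Qed.

End Families.

(** * Leading orders *)

Section Asymptotics.
Variables (K : numFieldType) (A : nat -> comAlgType K).
Variables (P : forall N, nat -> A N) (g : forall N, A N) (k : nat).
Variable H : forall N, A N -> A N.
Arguments H : clear implicits.
Hypothesis linH : lin H.
Arguments linH : clear implicits.
Hypothesis P0 : forall N, P N 0 = N%:R.
Hypothesis H_g : forall N, H N (g N) = 0.

Local Notation E := (adP P H).
Local Notation spanned := (spanned P g).
Local Notation cls := (cls P g).
Local Notation psprod := (psprod P).

Hypothesis E_P : forall a b N v,
  adP P (E a) b v = (2 * a * b)%:R * (P N (a + b - 2) * v).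

(** The multiplier of [[H, P_a]] on [g]. In [k + 1] the summand [1] comes from the Laplacian of
    [P_a]; all terms with [k] come from the first-order part acting on the power [Delta ^ k]. See
    [lap_psum_Delta]. *)
Definition Hc a N : A N :=
  if a is b.+2 then a%:R * (k.+1%:R * hsum (P N) 2 b - (k * b.+1)%:R * P N b)
  else 0.

Hypothesis E_g : forall a N, E a (g N) = Hc a N * g N.

Lemma lin_E a : lin (E a). Proof. exact: lin_adP. Qed.

(** What remains of [[H, P_a]] once its value on [g] is removed: it kills [g] and obeys a Leibniz
    rule, so on polynomials in the [P_b] applied to [g] it acts as a derivation. *)
Definition fieldE a N (v : A N) : A N := E a v - Hc a N * v.

Lemma lin_fieldE a : lin (fieldE a).
Proof.
by apply: linB; [exact: lin_E|move=> N c u v; rewrite mulrDr scalerAr].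
Qed.

Lemma fieldE_g a N : fieldE a (g N) = 0.
Proof. by rewrite /fieldE E_g subrr. Qed.

Lemma E_PM a b N (v : A N) :
  E a (P N b * v) = P N b * E a v + (2 * a * b)%:R * (P N (a + b - 2) * v).
Proof. by rewrite (adP_eq P (E a)) E_P. Qed.

Lemma fieldE_PM a b N (v : A N) : fieldE a (P N b * v) =
  P N b * fieldE a v + (2 * a * b)%:R * (P N (a + b - 2) * v).
Proof. by rewrite /fieldE E_PM; ring. Qed.

Lemma spanned_fieldE_psprod a s :
  spanned (szsum (size s) ((sumn s)%:Z + a%:Z - 2))
    (fun N => fieldE a (psprod N s * g N)).
Proof.
elim: s => [|b s IH].
  by apply: spanned0 => N; rewrite psprod_nil mul1r fieldE_g.
apply: (@spanned_ext _ _ _ _ _ (fun N => P N b * fieldE a (psprod N s * g N) +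
  (2 * a * b)%:R * (P N (a + b - 2) * (psprod N s * g N)))).
  by move=> N; rewrite psprod_cons -mulrA fieldE_PM.
apply: spannedD.
  apply: spannedM IH => t /szsum_cons -/(_ b).
  by rewrite /= PoszD; congr (szsum _ _ _); ring.
(* The truncated difference [a + b - 2] is the true one unless [a] or [b] is zero, and then the
   coefficient vanishes. *)
have [ab0|] := eqVneq (a * b)%N 0%N.
  by apply: spanned0 => N; rewrite -mulnA ab0 muln0 mul0r.
rewrite muln_eq0 negb_or -!lt0n => /andP[a0 b0].
apply: spannedM_nat.
apply: (@spanned_ext _ _ _ _ _ (fun N => psprod N ((a + b - 2)%N :: s) * g N)).
  by move=> N; rewrite psprod_cons mulrA.
apply: spanned_psprod; rewrite /szsum /= leqnn /=; apply/eqP; lia.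
Qed.

Lemma spanned_fieldE q e a v : spanned (szsum q e) v ->
  spanned (szsum q (e + a%:Z - 2)) (fun N => fieldE a (v N)).
Proof.
apply: spanned_lin => [|s /andP[h1 /eqP h2]]; first exact: lin_fieldE.
by rewrite -h2; apply: spanned_sub (spanned_fieldE_psprod a s); apply: szsum_widen.
Qed.

Lemma spanned_hsumM q q' e w v : spanned (szsum q' e) v ->
  spanned (szsum (q + q') (e + w%:Z)) (fun N => hsum (P N) q w * v N).
Proof.
move=> h; elim: q w => [|q IH] w.
  have [->|w0] := eqVneq w 0%N.
    by rewrite addr0; apply: spanned_ext h => N; rewrite /= mul1r.
  by apply: spanned0 => N; rewrite /hsum (negPf w0) mul0r.
apply: (@spanned_ext _ _ _ _ _ (fun N => \sum_(c < w.+1) P N c * (hsum (P N) q (w - c) * v N))).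
  by move=> N; rewrite hsumS mulr_suml; apply: eq_bigr => c _; rewrite mulrA.
apply: spanned_sum => c.
have -> : e + w%:Z = e + (w - c)%N%:Z + c%:Z by have := ltn_ord c; lia.
by apply: spannedM (IH _) => s; apply: szsum_cons.
Qed.

Lemma spanned_g : spanned (szsum 0 0) g.
Proof.
apply: spanned_ext (@spanned_psprod _ _ P g (szsum 0 0) [::] _) => // N.
by rewrite psprod_nil mul1r.
Qed.

Lemma spanned_hsum q (w : nat) : spanned (szsum q w) (fun N => hsum (P N) q w * g N).
Proof. by have := spanned_hsumM q w spanned_g; rewrite addn0 add0r. Qed.

Lemma spanned_HcM q e a v : spanned (szsum q e) v ->
  spanned (szsum q.+2 (e + a%:Z - 2)) (fun N => Hc a N * v N).
Proof.
move=> h; case: a => [|[|b]].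
- by apply: spanned0 => N; rewrite mul0r.
- by apply: spanned0 => N; rewrite mul0r.
apply: (@spanned_ext _ _ _ _ _ (fun N => b.+2%:R * (k.+1%:R * (hsum (P N) 2 b * v N)
   - (k * b.+1)%:R * (P N b * v N)))).
  by move=> N; rewrite /Hc; ring.
have -> : e + b.+2%:Z - 2 = e + b%:Z by lia.
apply/spannedM_nat/spannedB; apply/spannedM_nat; first exact: (@spanned_hsumM 2).
by apply: spannedM h => s /szsum_cons -/(_ b); apply: szsum_widen.
Qed.

(** Only [Hc] lengthens a product: the bracket with [P_a] uses up that factor and creates at most
    two, a net gain of one. *)
Lemma spanned_H_psprod s :
  spanned (szsum (size s).+1 ((sumn s)%:Z - 2)) (fun N => H N (psprod N s * g N)).
Proof.
elim: s => [|a s IH].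
  by apply: spanned0 => N; rewrite psprod_nil mul1r H_g.
apply: (@spanned_ext _ _ _ _ _ (fun N => P N a * H N (psprod N s * g N) +
   (fieldE a (psprod N s * g N) + Hc a N * (psprod N s * g N)))).
  by move=> N; rewrite /fieldE subrK -adP_psprod.
apply: spannedD.
  apply: spannedM IH => t /szsum_cons -/(_ a).
  by rewrite /= PoszD; congr (szsum _ _ _); ring.
have -> : (sumn (a :: s))%:Z - 2 = (sumn s)%:Z + a%:Z - 2 by rewrite /= PoszD; ring.
apply: spannedD.
  by apply: spanned_sub (spanned_fieldE_psprod a s); apply: szsum_widen; exact: leqW (leqnSn _).
by apply: spanned_HcM; apply: spanned_psprod; rewrite /szsum leqnn /=.
Qed.

Lemma spanned_H q e v : spanned (szsum q e) v ->
  spanned (szsum q.+1 (e - 2)) (fun N => H N (v N)).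
Proof.
apply: spanned_lin => [|s /andP[h1 /eqP h2]]; first exact: linH.
by rewrite -h2; apply: spanned_sub (spanned_H_psprod s); apply: szsum_widen.
Qed.

(** In the Leibniz expansion of [[D, P_c P_d]] each term has at least one commutator, and every
    factor [P] kept outside is paid for by a drop of order. Hence the length stays [q] instead of
    [q + 2]. *)
Lemma spanned_comm_hsum2 q e D w : cls q e D ->
  spanned (szsum q (e + w%:Z))
    (fun N => D N (hsum (P N) 2 w * g N) - hsum (P N) 2 w * D N (g N)).
Proof.
move=> h; have [l _] := h.
apply: (@spanned_ext _ _ _ _ _ (fun N => \sum_(c < w.+1)
   (adP P (adP P D c) (w - c) (g N) + P N (w - c) * adP P D c (g N)
    + P N c * adP P D (w - c) (g N)))).
  move=> N; rewrite hsumS !mulr_suml lin_sum // -sumrB; apply: eq_bigr => c _.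
  by rewrite hsum1 /adP -!mulrA; ring.
apply: spanned_sum => c.
have ec : e + w%:Z = e + c%:Z + (w - c)%:Z by have := ltn_ord c; lia.
apply: spannedD; last by rewrite ec -addrA [_ + (w - c)%:Z]addrC addrA; apply: spanned_mul_adP.
rewrite ec; apply: spannedD; last exact: spanned_mul_adP.
by apply: cls_g; do 2!apply: cls_adP_widen.
Qed.

Lemma spanned_comm_Hc q e D a : cls q e D ->
  spanned (szsum q (e + a%:Z - 2))
    (fun N => D N (Hc a N * g N) - Hc a N * D N (g N)).
Proof.
move=> h; have [l _] := h.
case: a => [|[|b]].
- by apply: spanned0 => N; rewrite !mul0r lin_0 // subrr.
- by apply: spanned0 => N; rewrite !mul0r lin_0 // subrr.
have -> : e + b.+2%:Z - 2 = e + b%:Z by lia.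
apply: (@spanned_ext _ _ _ _ _ (fun N => b.+2%:R *
   (k.+1%:R * (D N (hsum (P N) 2 b * g N) - hsum (P N) 2 b * D N (g N))
   - (k * b.+1)%:R * adP P D b (g N)))).
  move=> N; rewrite /Hc /adP -mulrA lin_nat // mulrBl lin_B // -!mulrA !lin_nat //.
  by ring.
apply/spannedM_nat/spannedB; apply/spannedM_nat; first exact: spanned_comm_hsum2.
by apply: cls_g; apply: cls_adP_widen.
Qed.

Definition comm (D D' : forall N, A N -> A N) N (v : A N) : A N :=
  D N (D' N v) - D' N (D N v).

Lemma adP_comm D D' a N v : lin D -> lin D' ->
  adP P (comm D D') a v = comm (adP P D a) D' v + comm D (adP P D' a) v :> A N.
Proof. by move=> l l'; rewrite /adP /comm !lin_B // ; ring. Qed.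

Lemma lin_commE a D : lin D -> lin (comm (E a) D).
Proof. by move=> l; apply: lin_comm => //; apply: lin_E. Qed.

(** [E a] behaves as a first-order operator, so its commutators preserve the order. On [g] it is a
    derivation plus multiplication by [Hc a]; the multiplications only enter through a commutator of
    [D] with [Hc a], which [spanned_comm_Hc] keeps at length [q]. *)
Lemma cls_commE q e D a : cls q e D -> cls q (e + a%:Z - 2) (comm (E a) D).
Proof.
elim: q e D => [|q IH] e D h; have [l _] := h.
(* The value on [g] is bounded in the same way in the base case and in the induction step. *)
all: have hg q0 : cls q0 e D -> spanned (szsum q0 (e + a%:Z - 2)) (fun N => comm (E a) D (g N)).
1,3: move=> h0; apply: (@spanned_ext _ _ _ _ _ (fun N => fieldE a (D N (g N))
      - (D N (Hc a N * g N) - Hc a N * D N (g N)))).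
1,3: by move=> N; rewrite /comm E_g /fieldE; ring.
1,2: by apply: spannedB; [apply: spanned_fieldE; exact: cls_g | exact: spanned_comm_Hc].
- split; first exact: lin_commE.
  split=> [|b N v]; first exact: hg.
  rewrite adP_comm //; last exact: lin_E.
  rewrite /comm !E_P !(cls_adP0 h) lin_nat //.
  have -> : D N (P N (a + b - 2) * v) = P N (a + b - 2) * D N v.
    by apply/eqP; rewrite -subr_eq0; apply/eqP/(cls_adP0 h).
  by rewrite (lin_0 (lin_E a)) !subrr addr0.
apply: clsS; [exact: lin_commE|exact: hg|move=> b].
apply: (@cls_ext _ _ _ _ _ _ (fun N v => comm (E a) (adP P D b) v -
   (2 * a * b)%:R * adP P D (a + b - 2) v)).
  move=> N v; rewrite adP_comm //; last exact: lin_E.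
  by rewrite /comm [in RHS]E_P E_P lin_nat // /adP; ring.
apply: clsB.
  have -> : e + a%:Z - 2 + b%:Z = e + b%:Z + a%:Z - 2 by ring.
  by apply: IH; apply: cls_adP.
have [ab0|] := eqVneq (a * b)%N 0%N.
  by apply: cls0P => N v; rewrite -mulnA ab0 muln0 mul0r.
rewrite muln_eq0 negb_or -!lt0n => /andP[a0 b0].
apply: clsM_nat; have -> : e + a%:Z - 2 + b%:Z = e + (a + b - 2)%N%:Z by lia.
exact: cls_adP.
Qed.

(** The commutator of [[H, D]] with [P_b] is [[E b, D] + [H, [D, P_b]]]: the first term has order
    [q] by [cls_commE], the second by induction. *)
Lemma cls_commH q e D : cls q e D -> cls q.+1 (e - 2) (comm H D).
Proof.
elim: q e D => [|q IH] e D h; have [l _] := h.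
all: apply: clsS; [exact: lin_comm| |move=> b].
1,3: by apply: spanned_ext (spanned_H (cls_g h)) => N; rewrite /comm H_g lin_0 // subr0.
all: apply: (@cls_ext _ _ _ _ _ _ (fun N v => comm (E b) D v + comm H (adP P D b) v));
  first by move=> N v; rewrite adP_comm.
all: have -> : e - 2 + b%:Z = e + b%:Z - 2 by ring.
- apply: clsD; first exact: cls_commE.
  by apply: cls0P => N v; rewrite /comm !(cls_adP0 h) lin_0 // subrr.
by apply: clsD; [exact: cls_commE|apply: IH; exact: cls_adP].
Qed.

Lemma spanned_Hc_lead q e a v : spanned (szsum q e) v ->
  spanned (szsum q.+1 (e + a%:Z - 2))
    (fun N => (Hc a N - (k.+1 * a)%:R * hsumz (P N) 2 (a%:Z - 2)) * v N).
Proof.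
case: a => [|[|b]] h.
- by apply: spanned0 => N; rewrite /= hsumz_lt0 // mulr0 subr0 mul0r.
- by apply: spanned0 => N; rewrite /= hsumz_lt0 // mulr0 subr0 mul0r.
have -> : e + b.+2%:Z - 2 = e + b%:Z by lia.
have -> : b.+2%:Z - 2 = b%:Z by lia.
apply: (@spanned_ext _ _ _ _ _ (fun N => - ((b.+2 * (k * b.+1))%:R * (P N b * v N)))).
  by move=> N; rewrite /Hc hsumzE !natrM; ring.
apply/spannedN/spannedM_nat.
by apply: spannedM h => s; apply: szsum_cons.
Qed.

(** For [q = m + 1] and [w = n + 1 - m] the coefficient is [(k + 1) 2 (m + 1) (n + 1)], which is
    what the passage from [t_(m,n+1)] to [t_(m+1,n)] requires in [t_lead]. The induction peels off
    one factor; the derivation [fieldE] preserves the length and so contributes to the remainder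
    only. *)
Lemma spanned_H_hsum q w : spanned (szsum q (w%:Z - 2))
  (fun N => q.+1%:R * H N (hsum (P N) q w * g N) -
    (k.+1 * (2 * q * (w + q - 1)))%:R * (hsumz (P N) q.+1 (w%:Z - 2) * g N)).
Proof.
elim: q w => [|q IH] w.
  apply: spanned0 => N; rewrite muln0 mul0n muln0 mul0r subr0 /hsum.
  by case: eqP => _; rewrite ?mul1r ?mul0r ?H_g ?(lin_0 linH) ?mulr0.
(* The goal carries [q + 2] and the induction hypothesis [q + 1]; both are cleared at once. *)
apply: (@spanned_natK _ _ _ _ _ q.+1) => //.
apply: (@spanned_ext _ _ _ _ _ (fun N =>
  q.+2%:R * \sum_(c < w.+1) P N c * (q.+1%:R * H N (hsum (P N) q (w - c) * g N) -
    (k.+1 * (2 * q * (w - c + q - 1)))%:R * (hsumz (P N) q.+1 ((w - c)%N%:Z - 2) * g N))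
  + (q.+1 * q.+2)%:R * (\sum_(c < w.+1) fieldE c (hsum (P N) q (w - c) * g N) +
     \sum_(c < w.+1) (Hc c N - (k.+1 * c)%:R * hsumz (P N) 2 (c%:Z - 2)) *
        (hsum (P N) q (w - c) * g N)))).
  move=> N.
  have Hs : H N (hsum (P N) q.+1 w * g N) =
     \sum_(c < w.+1) P N c * H N (hsum (P N) q (w - c) * g N) +
     \sum_(c < w.+1) fieldE c (hsum (P N) q (w - c) * g N) +
     \sum_(c < w.+1) Hc c N * (hsum (P N) q (w - c) * g N).
    rewrite hsumS mulr_suml lin_sum // -!big_split; apply: eq_bigr => c _ /=.
    by rewrite -mulrA (adP_eq P H) /fieldE; ring.
  have := hsum_lap (P N) q w.
  set S1 := \sum_(c < _) _; set S2 := \sum_(c < _) _ => HL.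
  rewrite Hs.
  have -> : \sum_(c < w.+1) P N c * (q.+1%:R * H N (hsum (P N) q (w - c) * g N) -
     (k.+1 * (2 * q * (w - c + q - 1)))%:R * (hsumz (P N) q.+1 ((w - c)%N%:Z - 2) * g N))
    = q.+1%:R * \sum_(c < w.+1) P N c * H N (hsum (P N) q (w - c) * g N)
      - k.+1%:R * S1 * g N.
    rewrite mulr_sumr !(mulr_sumr, mulr_suml) -sumrB.
    by apply: eq_bigr => c _; rewrite (natrM _ k.+1); ring.
  have -> : \sum_(c < w.+1) (Hc c N - (k.+1 * c)%:R * hsumz (P N) 2 (c%:Z - 2)) *
        (hsum (P N) q (w - c) * g N) =
     \sum_(c < w.+1) Hc c N * (hsum (P N) q (w - c) * g N) - k.+1%:R * S2 * g N.
    rewrite !(mulr_sumr, mulr_suml) -sumrB.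
    by apply: eq_bigr => c _; rewrite (natrM _ k.+1); ring.
  have e1 : (2 * q.+1 * (w + q.+1 - 1) = 2 * q.+1 * (w + q))%N by rewrite addnS subn1.
  rewrite e1; move: HL; set Z := hsumz _ _ _ => HL.
  set Y1 := \sum_(c < _) P N c * H N _; set Y2 := \sum_(c < _) @fieldE _ N _.
  set Y3 := \sum_(c < _) Hc _ _ * _.
  transitivity (q.+1%:R * (q.+2%:R * (Y1 + Y2 + Y3)) -
     k.+1%:R * ((q.+1 * (2 * q.+1 * (w + q)))%:R * Z) * g N); last by ring.
  by rewrite -HL; ring.
apply: spannedD.
  apply: spannedM_nat; apply: spanned_sum => c.
  have -> : w%:Z - 2 = ((w - c)%N%:Z - 2) + c%:Z by have := ltn_ord c; lia.
  by apply: spannedM (IH _) => s; apply: szsum_cons.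
apply: spannedM_nat; apply: spannedD; apply: spanned_sum => c.
  have -> : w%:Z - 2 = (w - c)%N%:Z + c%:Z - 2 by have := ltn_ord c; lia.
  apply: spanned_fieldE; apply: spanned_sub (spanned_hsum q _).
  by apply: szsum_widen.
have -> : w%:Z - 2 = (w - c)%N%:Z + c%:Z - 2 by have := ltn_ord c; lia.
by apply: spanned_Hc_lead; apply: spanned_hsum.
Qed.

(** A derivation hits one of [q] interchangeable factors, hence [q] times the first; [convolutionCA]
    brings the differentiated factor to the front. *)
Lemma fieldE_hsum a q w N : fieldE a (hsum (P N) q w * g N) =
  q%:R * (\sum_(c < w.+1) ((2 * a * c)%:R * P N (a + c - 2)) * hsum (P N) q.-1 (w - c)) * g N.
Proof.
elim: q w => [|q IH] w.
  rewrite !mul0r /hsum; case: eqP => _; rewrite ?mul1r ?mul0r ?fieldE_g //.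
  by rewrite (lin_0 (lin_fieldE a)).
rewrite {1}hsumS mulr_suml (lin_sum (lin_fieldE a)).
have -> : \sum_(i < w.+1) fieldE a (P N i * hsum (P N) q (w - i) * g N) =
   \sum_(c < w.+1) (P N c * fieldE a (hsum (P N) q (w - c) * g N)) +
   (\sum_(c < w.+1) ((2 * a * c)%:R * P N (a + c - 2)) * hsum (P N) q (w - c)) * g N.
  rewrite mulr_suml -big_split; apply: eq_bigr => c _ /=.
  by rewrite -mulrA fieldE_PM; ring.
have -> : \sum_(c < w.+1) (P N c * fieldE a (hsum (P N) q (w - c) * g N)) =
  q%:R * (\sum_(c < w.+1) ((2 * a * c)%:R * P N (a + c - 2)) * hsum (P N) q (w - c)) * g N.
  case: q IH => [|q] IH.
    by rewrite !mul0r big1 // => c _; rewrite IH !mul0r mulr0.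
  transitivity (q.+1%:R * (\sum_(c < w.+1) P N c * \sum_(d < (w - c).+1)
     ((2 * a * d)%:R * P N (a + d - 2)) * hsum (P N) q (w - c - d)) * g N).
    rewrite !(mulr_sumr, mulr_suml); apply: eq_bigr => c _; rewrite IH /=; ring.
  rewrite (convolutionCA (P N) (fun d => (2 * a * d)%:R * P N (a + d - 2))).
  by congr (_ * _ * _); apply: eq_bigr => c _; rewrite (hsumS _ q).
by rewrite /= -natr1; ring.
Qed.

(** * The operators [t_(m,n)]: order, leading terms and brackets *)

Variable t : nat -> nat -> forall N, A N -> A N.
Arguments t : clear implicits.
Hypothesis lint : forall m n, lin (t m n).
Arguments lint : clear implicits.
Hypothesis t0 : forall n N v, t 0 n N v = P N n * v.
Hypothesis tS : forall m n N v,
  comm H (t m n.+1) v = (2 * n.+1)%:R * t m.+1 n N v.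

Lemma natr_mulI N n (x y : A N) : (0 < n)%N -> n%:R * x = n%:R * y -> x = y.
Proof.
case: n => // n _; rewrite !mulr_natl -!(scaler_nat n.+1) => /(congr1 (fun z => n.+1%:R^-1 *: z)).
by rewrite !scalerA mulVf ?scale1r // pnatr_eq0.
Qed.

Lemma E_t1 a N v : E a.+1 v = (2 * a.+1)%:R * t 1 a N v.
Proof. by rewrite -tS /comm !t0. Qed.

Lemma adP_P0 D N v : lin D -> adP P D 0 v = 0 :> A N.
Proof. by move=> l; rewrite /adP P0 lin_nat // subrr. Qed.

Lemma adP_t0 n a N v : adP P (t 0 n) a v = 0 :> A N.
Proof. by rewrite /adP !t0 mulrCA subrr. Qed.

Lemma adP_t1 a b N v : adP P (t 1 a) b v = b%:R * (P N (a + b - 1) * v).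
Proof.
apply: (@natr_mulI _ (2 * a.+1)) => //.
have e : E a.+1 (P N b * v) - P N b * E a.+1 v = _ := E_P a.+1 b v.
rewrite !E_t1 mulrCA -mulrBr in e; rewrite /adP e.
by rewrite natrM addSn subSS -mulrA.
Qed.

(** Up to a scalar [t_(m+1,n)] is [[H, t_(m,n+1)]], so each step adds one to the order. The count
    starts at one: [t_(0,n)] commutes with all [P_a], but [P_n g] already has length one. *)
Lemma cls_t m n : cls m.+1 (n%:Z - m%:Z) (t m n).
Proof.
elim: m n => [|m IH] n.
  apply: clsS => [//||a]; last by apply: cls0P => N v; apply: adP_t0.
  apply: (@spanned_ext _ _ _ _ _ (fun N => hsum (P N) 1 n * g N)).
    by move=> N; rewrite t0 hsum1.
  by rewrite subr0; apply: spanned_hsum.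
apply: (@cls_natK _ _ _ _ _ _ (2 * n.+1)) => //.
have -> : n%:Z - m.+1%:Z = n.+1%:Z - m%:Z - 2 by lia.
by apply: cls_ext (cls_commH (IH n.+1)) => N v; rewrite tS.
Qed.

(** As [H g = 0], the bracket with [H] on [g] is [H] applied to [t_(m,n+1) g]; its leading term
    follows from [spanned_H_hsum], and [H] lengthens the remainder by one only. *)
Lemma t_lead m n : spanned (szsum m (n%:Z - m%:Z))
  (fun N => m.+1%:R * t m n N (g N)
     - (k.+1 ^ m)%:R * (hsumz (P N) m.+1 (n%:Z - m%:Z) * g N)).
Proof.
elim: m n => [|m IH] n.
  by apply: spanned0 => N; rewrite t0 subr0 hsumzE hsum1 !mul1r subrr.
have eH N : H N (t m n.+1 N (g N)) = (2 * n.+1)%:R * t m.+1 n N (g N).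
  by rewrite -tS /comm H_g lin_0 // subr0.
have e2 : n%:Z - m.+1%:Z = n.+1%:Z - m%:Z - 2 by lia.
apply: (@spanned_natK _ _ _ _ _ (m.+1 * (2 * n.+1))) => //.
have h1 := spanned_H (IH n.+1).
have h2 : spanned (szsum m.+1 (n.+1%:Z - m%:Z - 2)) (fun N => m.+2%:R * H N
  (hsumz (P N) m.+1 (n.+1%:Z - m%:Z) * g N) - (k.+1 * (2 * m.+1 * n.+1))%:R *
    (hsumz (P N) m.+2 (n.+1%:Z - m%:Z - 2) * g N)).
  case ew : (n.+1%:Z - m%:Z) => [w|w].
    have -> : n.+1 = (w + m.+1 - 1)%N by lia.
    exact: spanned_H_hsum.
  apply: spanned0 => N; rewrite !hsumz_lt0 // !mul0r (lin_0 linH) !mulr0 subrr //.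
rewrite e2; apply: spanned_ext (spannedD (spannedM_nat m.+2 h1) (spannedM_nat (k.+1 ^ m) h2)) => N.
rewrite lin_B // !lin_nat // eH expnSr; ring.
Qed.

Lemma cls_comm_t1 q e D a : cls q e D -> cls q (e + a%:Z - 1) (comm (t 1 a) D).
Proof.
move=> h; have [l _] := h; apply: (@cls_natK _ _ _ _ _ _ (2 * a.+1)) => //.
have -> : e + a%:Z - 1 = e + a.+1%:Z - 2 by lia.
by apply: cls_ext (cls_commE a.+1 h) => N v; rewrite /comm !E_t1 lin_nat // mulrBr.
Qed.

(** In [bracketP] and [bracket1] each of the compared operators has order [m + 1] in general;
    membership in a class of order [m] says that their leading parts agree. *)
Definition bracketP m := forall n a : nat, cls m (n%:Z - m.+1%:Z + a%:Z)
  (fun N v => adP P (t m.+1 n) a v - (m.+1 * a)%:R * t m (n + a - 1) N v).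

Definition bracket1 m := forall n a : nat, cls m (n%:Z - m%:Z + a%:Z - 1)
  (fun N v => comm (t 1 a) (t m n) v - (n%:R - (m * a)%:R) * t m (n + a - 1) N v).

Lemma bracket1_0 : bracket1 0.
Proof.
move=> n a; apply: cls0P => N v; rewrite subr0 !t0.
have := adP_t1 a n v; rewrite /comm /adP !t0 => ->.
by rewrite addnC subrr.
Qed.

(** By Jacobi, [2 (n + 1) [t_(m+1,n), P_(a+1)] = [E_(a+1), t_(m,n+1)] + [H, [t_(m,n+1), P_(a+1)]]].
    The coefficients of [t_(m,n+a)] add up as [2 (a + 1) (n + 1 - m a) + 2 m (a + 1) (n + a + 1) = 2
    (n + 1) (m + 1) (a + 1)]. *)
Lemma bracketP_step m : bracket1 m -> (if m is m'.+1 then bracketP m' else True) -> bracketP m.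
Proof.
move=> hV hG n [|a].
  by apply: cls0P => N v; rewrite adP_P0 // muln0 mul0r subrr.
apply: (@cls_natK _ _ _ _ _ _ (2 * n.+1)) => //.
(* The inner bracket is about [m (a + 1) t_(m-1,n+a+1)], which [[H, -]] turns into the subtracted
   term; for [m = 0] both vanish. *)
pose X N (v : A N) := comm H (adP P (t m n.+1) a.+1) v
  - (2 * (m * a.+1) * (n + a.+1))%:R * t m (n + a) N v.
have hX : cls m (n%:Z - m.+1%:Z + a.+1%:Z) X.
  case: m hV hG @X => [|m] hV hG X.
    by apply: cls0P => N v; rewrite /X /comm !adP_t0 (lin_0 linH) muln0 mul0n mul0r !subrr.
  apply: (@cls_ext _ _ _ _ _ _ (comm H (fun N v => adP P (t m.+1 n.+1) a.+1 v -
      (m.+1 * a.+1)%:R * t m (n.+1 + a.+1 - 1) N v))).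
    move=> N v; have := tS m (n + a) v.
    rewrite /X /comm lin_B // lin_nat // !addSn !addnS !subn1 /= => e.
    rewrite -[RHS]addr0 -[0](subrr ((m.+1 * a.+1)%:R *
      (H N (t m (n + a).+1 N v) - t m (n + a).+1 N (H N v)))).
    by rewrite {1}e; ring.
  have -> : n%:Z - m.+2%:Z + a.+1%:Z = n.+1%:Z - m.+1%:Z + a.+1%:Z - 2 by lia.
  exact: cls_commH.
apply: (@cls_ext _ _ _ _ _ _ (fun N v => (2 * a.+1)%:R *
    (comm (t 1 a) (t m n.+1) v - (n.+1%:R - (m * a)%:R) * t m (n.+1 + a - 1) N v) + X N v)).
  move=> N v; rewrite /X.
  have e1 : (2 * n.+1)%:R * adP P (t m.+1 n) a.+1 v =
     comm (E a.+1) (t m n.+1) v + comm H (adP P (t m n.+1) a.+1) v.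
    by rewrite -adP_comm // /adP !tS; ring.
  have e2 : comm (E a.+1) (t m n.+1) v = (2 * a.+1)%:R * comm (t 1 a) (t m n.+1) v.
    by rewrite /comm !E_t1 lin_nat // mulrBr.
  rewrite [RHS]mulrBr e1 e2 addSn addnS !subn1 /=; ring.
apply: clsD => //; apply: clsM_nat.
have -> : n%:Z - m.+1%:Z + a.+1%:Z = n.+1%:Z - m%:Z + a%:Z - 1 by lia.
exact: hV.
Qed.

Lemma lin_mulA (c : forall N, A N) D : lin D -> lin (fun N v => c N * D N v).
Proof. by move=> l N d u v; rewrite l mulrDr scalerAr. Qed.

Lemma clsM_natB q e n n' D : cls q e D -> cls q e (fun N v => (n%:R - n'%:R) * D N v).
Proof.
move=> h; apply: cls_ext (clsB (clsM_nat n h) (clsM_nat n' h)) => N v.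
by rewrite mulrBl.
Qed.

(** Expand the commutator with each product [P_c P_(a-c)]. The double commutators are too short to
    matter, [bracketP] replaces the single ones by multiples of [t_(m,n+c-1)], and [t_lead]
    evaluates these on [g]. The symmetry between [c] and [a - c] gives the factor 2. *)
Lemma spanned_comm_Hc_lead m n a : bracketP m ->
  spanned (szsum m.+1 (n%:Z - m.+1%:Z + a.+1%:Z - 1)) (fun N =>
    t m.+1 n N (Hc a.+2 N * g N) - Hc a.+2 N * t m.+1 n N (g N)
    - (2 * a.+2 * k.+1 ^ m.+1)%:R * ((\sum_(c < a.+1) c%:R * P N (a - c) *
         hsumz (P N) m.+1 (n%:Z - m.+1%:Z + c%:Z)) * g N)).
Proof.
move=> hG; have ht := cls_t m.+1 n; have lt := lint m.+1 n.
pose e : int := n%:Z - m.+1%:Z.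
have -> : n%:Z - m.+1%:Z + a.+1%:Z - 1 = e + a%:Z by rewrite /e; lia.
pose G x N (v : A N) := adP P (t m.+1 n) x v - (m.+1 * x)%:R * t m (n + x - 1) N v.
pose S x N : A N := m.+1%:R * t m x N (g N)
     - (k.+1 ^ m)%:R * (hsumz (P N) m.+1 (x%:Z - m%:Z) * g N).
have hP x q f v (h : spanned (szsum q f) v) :
    spanned (szsum q.+1 (f + x%:Z)) (fun N => P N x * v N).
  by apply: spannedM h => s; apply: szsum_cons.
apply: (@spanned_ext _ _ _ _ _ (fun N => a.+2%:R * (k.+1%:R *
   (\sum_(c < a.+1) (adP P (adP P (t m.+1 n) c) (a - c) (g N)
       + (P N (a - c) * G c N (g N) + P N c * G (a - c)%N N (g N))
       + (c%:R * (P N (a - c) * S (n + c - 1)%N N)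
          + (a - c)%:R * (P N c * S (n + (a - c) - 1)%N N))))
   - (k * a.+1)%:R * adP P (t m.+1 n) a (g N)))).
  move=> N.
  pose B c : A N := c%:R * P N (a - c) * hsumz (P N) m.+1 (n%:Z - m.+1%:Z + c%:Z) * g N.
  have hs c (hc : (c <= a)%N) : adP P (adP P (t m.+1 n) c) (a - c) (g N)
       + (P N (a - c) * G c N (g N) + P N c * G (a - c)%N N (g N))
       + (c%:R * (P N (a - c) * S (n + c - 1)%N N) + (a - c)%:R * (P N c * S (n + (a - c) - 1)%N N))
     = t m.+1 n N (P N c * (P N (a - c) * g N)) - P N c * (P N (a - c) * t m.+1 n N (g N))
       - (k.+1 ^ m)%:R * (B c + B (a - c)%N).
    have hz x : x%:R * hsumz (P N) m.+1 ((n + x - 1)%N%:Z - m%:Z) =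
        x%:R * hsumz (P N) m.+1 (n%:Z - m.+1%:Z + x%:Z).
      case: x => [|x]; first by rewrite !mul0r.
      by congr (_ * hsumz _ _ _); lia.
    rewrite /G /S /adP /B subKn // !natrM.
    have := hz c; have := hz (a - c)%N.
    set z1 := hsumz _ _ _; set z2 := hsumz _ _ _; set z3 := hsumz _ _ _; set z4 := hsumz _ _ _.
    move=> e1 e2.
    transitivity (t m.+1 n N (P N c * (P N (a - c) * g N))
       - P N c * (P N (a - c) * t m.+1 n N (g N))
       - (k.+1 ^ m)%:R * (P N (a - c) * (c%:R * z3) * g N + P N c * ((a - c)%:R * z1) * g N)).
      ring.
    by rewrite e1 e2; ring.
  rewrite (eq_bigr (fun c : 'I_a.+1 => t m.+1 n N (P N c * (P N (a - c) * g N))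
       - P N c * (P N (a - c) * t m.+1 n N (g N))
       - (k.+1 ^ m)%:R * (B c + B (a - c)%N))); last by move=> c _; apply: hs; rewrite -ltnS.
  rewrite !sumrB -!mulr_sumr big_split /=.
  have -> : \sum_(c < a.+1) B (a - c)%N = \sum_(c < a.+1) B c.
    by rewrite [RHS](reindex_inj rev_ord_inj); apply: eq_bigr => c _; rewrite /= subSS.
  have -> : (\sum_(c < a.+1) c%:R * P N (a - c) * hsumz (P N) m.+1 (n%:Z - m.+1%:Z + c%:Z)) * g N
    = \sum_(c < a.+1) B c by rewrite mulr_suml.
  have -> : \sum_(c < a.+1) t m.+1 n N (P N c * (P N (a - c) * g N))
    = t m.+1 n N (hsum (P N) 2 a * g N).
    rewrite hsumS mulr_suml lin_sum //; apply: eq_bigr => c _.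
    by rewrite hsum1 mulrA.
  have -> : \sum_(c < a.+1) P N c * (P N (a - c) * t m.+1 n N (g N))
    = hsum (P N) 2 a * t m.+1 n N (g N).
    rewrite hsumS mulr_suml; apply: eq_bigr => c _.
    by rewrite hsum1 mulrA.
  rewrite /Hc /adP -mulrA lin_nat // mulrBl lin_B // -!mulrA !lin_nat // expnS !natrM; ring.
apply: spannedM_nat; apply: spannedB; apply: spannedM_nat; last first.
  by apply: spanned_sub (cls_g (cls_adP a ht)); apply: szsum_widen.
apply: spanned_sum => c; have lt_c := ltn_ord c.
have hGs x : spanned (szsum m (e + x%:Z)) (fun N => G x N (g N)) by apply: cls_g (hG n x).
have hSs x : spanned (szsum m (x%:Z - m%:Z)) (fun N => S x N) by apply: t_lead.
have hxS x y : (x + y = a)%N ->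
    spanned (szsum m.+1 (e + a%:Z)) (fun N => x%:R * (P N y * S (n + x - 1)%N N)).
  case: x => [|x] xy; first by apply: spanned0 => N; rewrite mul0r.
  apply: spannedM_nat; have -> : e + a%:Z = (n + x.+1 - 1)%N%:Z - m%:Z + y%:Z by rewrite /e; lia.
  exact/hP/hSs.
apply: spannedD; [apply: spannedD; [|apply: spannedD]|apply: spannedD].
- have -> : e + a%:Z = e + c%:Z + (a - c)%N%:Z by lia.
  exact: cls_g (cls_adP_widen (a - c)%N (cls_adP c ht)).
- have -> : e + a%:Z = e + c%:Z + (a - c)%N%:Z by lia.
  exact/hP/hGs.
- have -> : e + a%:Z = e + (a - c)%N%:Z + c%:Z by lia.
  exact/hP/hGs.
- by apply: hxS; lia.
- by apply: hxS; lia.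
Qed.

Lemma fieldE_hsumz a q (w : int) N : fieldE a (hsumz (P N) q.+1 w * g N) =
  (2 * a)%:R * (q.+1%:R * (if w is Posz w' then
     \sum_(c < w'.+1) c%:R * P N (a + c - 2) * hsum (P N) q (w' - c) else 0)) * g N.
Proof.
case: w => w; last by rewrite hsumz_lt0 // mul0r (lin_0 (lin_fieldE a)) !mulr0 mul0r.
rewrite hsumzE fieldE_hsum !(mulr_sumr, mulr_suml).
by apply: eq_bigr => c _; rewrite /= !natrM; ring.
Qed.

(** Up to the scalar [2 (a + 1)], [t 1 a] is [E a.+1], a derivation plus [Hc] on [g]. Their leading
    contributions are precisely the two sums of [hsum_shift], or of [hsum_drop] when [a = 0]. *)
Lemma spanned_bracket1 m n a : bracketP m ->
  spanned (szsum m.+1 (n%:Z - m.+1%:Z + a%:Z - 1))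
  (fun N => comm (t 1 a) (t m.+1 n) (g N)
     - (n%:R - (m.+1 * a)%:R) * t m.+1 (n + a - 1) N (g N)).
Proof.
move=> hG; set e := n%:Z - _ + _ - _.
pose S x N : A N := m.+2%:R * t m.+1 x N (g N)
     - (k.+1 ^ m.+1)%:R * (hsumz (P N) m.+2 (x%:Z - m.+1%:Z) * g N).
pose CH N : A N := t m.+1 n N (Hc a.+1 N * g N) - Hc a.+1 N * t m.+1 n N (g N).
pose L N : A N := if a is b.+1 then
   \sum_(c < b.+1) c%:R * P N (b - c) * hsumz (P N) m.+1 (n%:Z - m.+1%:Z + c%:Z) else 0.
have hCH : spanned (szsum m.+1 e)
    (fun N => CH N - (2 * a.+1 * k.+1 ^ m.+1)%:R * (L N * g N)).
  rewrite /CH /L /e; case: (a) => [|b]; last exact: spanned_comm_Hc_lead.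
  by apply: spanned0 => N; rewrite /= !mul0r (lin_0 (lint _ _)) subrr mulr0 subr0.
apply: (@spanned_natK _ _ _ _ _ (m.+2 * (2 * a.+1))) => //.
apply: (@spanned_ext _ _ _ _ _ (fun N => fieldE a.+1 (S n N)
  - m.+2%:R * (CH N - (2 * a.+1 * k.+1 ^ m.+1)%:R * (L N * g N))
  - (2 * a.+1)%:R * ((n%:R - (m.+1 * a)%:R) * S (n + a - 1)%N N))).
  move=> N.
  have eC : (2 * a.+1)%:R * comm (t 1 a) (t m.+1 n) (g N)
    = fieldE a.+1 (t m.+1 n N (g N)) - CH N.
    by rewrite /comm mulrBr -(lin_nat (lint m.+1 n)) -!E_t1 E_g /fieldE /CH; ring.
  rewrite [in RHS]natrM -[RHS]mulrA [X in _ = _ * X]mulrBr eC /S.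
  rewrite (lin_B (lin_fieldE _)) !(lin_nat (lin_fieldE _)).
  rewrite fieldE_hsumz.
  set Y := if _ is Posz _ then _ else _.
  set T := t m.+1 (n + a - 1) N (g N).
  (* All that is left is the cancellation of the leading terms: [Y] comes from the derivation, [L]
     from the commutator with [Hc], and the right side from [t_(m+1,n+a-1)]. *)
  suff HL : m.+2%:R * (Y - L N) = (n%:R - (m.+1 * a)%:R) *
      hsumz (P N) m.+2 ((n + a - 1)%N%:Z - m.+1%:Z).
    set Z := hsumz _ _ _ in HL *.
    transitivity (m.+2%:R * (fieldE a.+1 (t m.+1 n N (g N)) - CH N)
      - m.+2%:R * ((2 * a.+1)%:R * ((n%:R - (m.+1 * a)%:R) * T))
      - (2 * a.+1)%:R * (k.+1 ^ m.+1)%:R * (m.+2%:R * (Y - L N) -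
          (n%:R - (m.+1 * a)%:R) * Z) * g N).
      by rewrite !natrM; ring.
    by rewrite HL subrr mulr0 mul0r subr0; ring.
  rewrite /Y /L; case: (a) => [|b]; last first.
    have -> : (n + b.+1 - 1)%N%:Z - m.+1%:Z = n%:Z - m.+1%:Z + b%:Z by lia.
    have := hsum_shift (P N) m.+1 b (n%:Z - m.+1%:Z).
    rewrite rmorphB /= -!pmulrn.
    have -> : (n%:R - m.+1%:R - (m.+1 * b)%:R : A N) = n%:R - (m.+1 * b.+1)%:R.
      by rewrite mulnS natrD; ring.
    move=> <-; case: (n%:Z - m.+1%:Z) => // w.
    congr (_ * (_ - _)); apply: eq_bigr => c _.
    by rewrite !addSn subn2.
  rewrite subr0 muln0 subr0 addn0.
  case ew : (n%:Z - m.+1%:Z) => [w|w]; last first.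
    by rewrite mulr0 hsumz_lt0 ?mulr0 //; lia.
  have -> : (n - 1)%N%:Z - m.+1%:Z = w%:Z - 1 by lia.
  have -> : n = (w + m.+1)%N by lia.
  rewrite -hsum_drop; congr (_ * _); apply: eq_bigr => c _.
  by rewrite add1n subn2.
apply: spannedB; first apply: spannedB.
- have -> : e = n%:Z - m.+1%:Z + a.+1%:Z - 2 by rewrite /e; lia.
  by apply: spanned_fieldE; apply: t_lead.
- exact: spannedM_nat.
(* For [n = a = 0] the truncated index [n + a - 1] is wrong, but its coefficient is zero. *)
have [na|na] := posnP (n + a).
  apply: spanned0 => N.
  have [-> ->] : n = 0%N /\ a = 0%N by lia.
  by rewrite muln0 subrr mul0r mulr0.
apply: spannedM_nat.
have hS : spanned (szsum m.+1 e) (S (n + a - 1)%N).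
  have -> : e = (n + a - 1)%N%:Z - m.+1%:Z by rewrite /e; lia.
  exact: t_lead.
apply: spanned_ext (spannedB (spannedM_nat n hS) (spannedM_nat (m.+1 * a) hS)) => N.
by rewrite mulrBl.
Qed.

(** The value on [g] is [spanned_bracket1]. In the commutator with [P_(b+1)], Jacobi leaves only the
    remainders [G] and [V] of known brackets: the main terms cancel because [(n + b - m a) - (a + b)
    - (n - (m + 1) a) = 0]. *)
Lemma bracket1_step m : bracketP m -> bracket1 m -> bracket1 m.+1.
Proof.
move=> hG hV n a.
pose D N (v : A N) := comm (t 1 a) (t m.+1 n) v
     - (n%:R - (m.+1 * a)%:R) * t m.+1 (n + a - 1) N v.
have lD : lin D by apply: linB; [exact: lin_comm|exact: lin_mulA].
apply: (@clsS _ _ _ _ _ _ D) => [//||[|b]]; first exact: spanned_bracket1.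
  by apply: cls0P => N v; rewrite adP_P0.
pose G n' x N (v : A N) := adP P (t m.+1 n') x v - (m.+1 * x)%:R * t m (n' + x - 1) N v.
pose V n' N (v : A N) := comm (t 1 a) (t m n') v
    - (n'%:R - (m * a)%:R) * t m (n' + a - 1) N v.
apply: (@cls_ext _ _ _ _ _ _ (fun N v => comm (t 1 a) (G n b.+1) v
   - b.+1%:R * G n (a + b)%N N v + (m.+1 * b.+1)%:R * V (n + b)%N N v
   - (n%:R - (m.+1 * a)%:R) * G (n + a - 1)%N b.+1 N v)).
  move=> N v.
  have -> : adP P D b.+1 v = comm (adP P (t 1 a) b.+1) (t m.+1 n) v +
     comm (t 1 a) (adP P (t m.+1 n) b.+1) v
     - (n%:R - (m.+1 * a)%:R) * adP P (t m.+1 (n + a - 1)) b.+1 v.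
    by rewrite -adP_comm // /D /adP; ring.
  have -> : comm (adP P (t 1 a) b.+1) (t m.+1 n) v = - (b.+1%:R * adP P (t m.+1 n) (a + b) v).
    rewrite {1}/comm !adP_t1 lin_nat // addnS subn1 /= {1}/adP; ring.
  have -> : comm (t 1 a) (G n b.+1) v = comm (t 1 a) (adP P (t m.+1 n) b.+1) v
    - (m.+1 * b.+1)%:R * comm (t 1 a) (t m (n + b)) v.
    by rewrite /comm /G lin_B // lin_nat // addnS subn1 /=; ring.
  rewrite /G /V.
  have [na|na] := posnP (n + a).
    have [-> ->] : n = 0%N /\ a = 0%N by lia.
    rewrite !(add0n, addn0, muln0); ring.
  have -> : (n + (a + b) - 1 = n + b + a - 1)%N by lia.
  have -> : (n + a - 1 + b.+1 - 1 = n + b + a - 1)%N by lia.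
  by ring.
have es : n%:Z - m.+1%:Z + a%:Z - 1 + b.+1%:Z = n%:Z - m.+1%:Z + b.+1%:Z + a%:Z - 1 by lia.
apply: clsB; [apply: clsD; [apply: clsB|]|].
- by rewrite es; apply: cls_comm_t1; apply: hG.
- apply: clsM_nat.
  have -> : n%:Z - m.+1%:Z + a%:Z - 1 + b.+1%:Z = n%:Z - m.+1%:Z + (a + b)%N%:Z by lia.
  exact: hG.
- apply: clsM_nat.
  have -> : n%:Z - m.+1%:Z + a%:Z - 1 + b.+1%:Z = (n + b)%N%:Z - m%:Z + a%:Z - 1 by lia.
  exact: hV.
have [na|na] := posnP (n + a).
  apply: cls0P => N v.
  have [-> ->] : n = 0%N /\ a = 0%N by lia.
  by rewrite muln0 subrr mul0r.
apply: clsM_natB.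
have -> : n%:Z - m.+1%:Z + a%:Z - 1 + b.+1%:Z = (n + a - 1)%N%:Z - m.+1%:Z + b.+1%:Z by lia.
exact: hG.
Qed.

Lemma brackets m : bracketP m /\ bracket1 m.
Proof.
elim: m => [|m [hG hV]].
  by split; [apply: bracketP_step => //|]; apply: bracket1_0.
have hV1 : bracket1 m.+1 by apply: bracket1_step.
by split=> //; apply: bracketP_step.
Qed.

Lemma cls_bracketP m n a : cls m (n%:Z - m.+1%:Z + a%:Z)
  (fun N v => adP P (t m.+1 n) a v - (m.+1 * a)%:R * t m (n + a - 1) N v).
Proof. by case: (brackets m). Qed.

Lemma cls_bracket1 m n a : cls m (n%:Z - m%:Z + a%:Z - 1)
  (fun N v => comm (t 1 a) (t m n) v - (n%:R - (m * a)%:R) * t m (n + a - 1) N v).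
Proof. by case: (brackets m). Qed.

(** The most zeros occur when one factor carries all the weight. It can stand in [m + 1] places, and
    this number cancels the [m + 1] of [t_lead]. *)
Lemma spanned_hsum_zsum m w : (0 < w)%N -> spanned (zsum m w)
  (fun N => (hsum (P N) m.+1 w - m.+1%:R * (P N 0 ^+ m * P N w)) * g N).
Proof.
move=> w0; elim: m => [|m IH].
  by apply: spanned0 => N; rewrite hsum1 !mul1r subrr mul0r.
case: w w0 IH => // w _ IH.
apply: (@spanned_ext _ _ _ _ _ (fun N =>
  P N 0 * ((hsum (P N) m.+1 w.+1 - m.+1%:R * (P N 0 ^+ m * P N w.+1)) * g N)
  + \sum_(c < w) P N c.+1 * (hsum (P N) m.+1 (w - c) * g N))).
  move=> N; rewrite [in RHS]hsumS big_ord_recl big_ord_recr /= subn0 /bump /= !add1n subnn.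
  have -> : hsum (P N) m.+1 0 = P N 0 ^+ m.+1.
    by elim: m.+1 => [|q IHq] //; rewrite hsumS big_ord1 IHq exprS.
  have -> : \sum_(i < w) P N (1 + i)%N * hsum (P N) m.+1 (w.+1 - (1 + i)) =
      \sum_(c < w) P N c.+1 * hsum (P N) m.+1 (w - c).
    by apply: eq_bigr => c _; rewrite add1n subSS.
  have -> : \sum_(c < w) P N c.+1 * (hsum (P N) m.+1 (w - c) * g N) =
     (\sum_(c < w) P N c.+1 * hsum (P N) m.+1 (w - c)) * g N.
    by rewrite mulr_suml; apply: eq_bigr => c _; rewrite mulrA.
  by rewrite -[m.+2%:R]natr1 !exprS; ring.
apply: spannedD.
  apply: spannedM IH => s /andP[h1 h2].
  by rewrite /zsum /= add1n ltnS h1.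
apply: spanned_sum => c; have lt_c := ltn_ord c.
have -> : w.+1%:Z = (w - c)%N%:Z + c.+1%:Z by lia.
have h : spanned (zsum m.+1 (w - c)%N%:Z) (fun N => hsum (P N) m.+1 (w - c) * g N).
  apply: spanned_sub (spanned_hsum m.+1 (w - c)); apply: szsum_zsum_neq0.
  by apply/eqP; lia.
by apply: spannedM h => s; apply: zsum_cons.
Qed.

(** The subtracted term is a multiplication, so the commutators of the difference are those of
    [t m n]; they have order [m] and positive energy. *)
Lemma t_psprod_up m n s : (m < n)%N -> all (leq 1) s ->
  spanned (zsum m (n%:Z - m%:Z + (sumn s)%:Z)) (fun N => t m n N (psprod N s * g N)
    - (k.+1 ^ m)%:R * (P N 0 ^+ m * P N (n - m)) * (psprod N s * g N)).
Proof.
move=> ltmn; apply: (@spanned_psprod_ind _ _ _ _ _ _ (fun N v => t m n N v -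
   (k.+1 ^ m)%:R * (P N 0 ^+ m * P N (n - m)) * v)); last first.
  move=> a u a0 u0.
  apply: (@spanned_ext _ _ _ _ _ (fun N => adP P (t m n) a (psprod N u * g N))).
    by move=> N; rewrite /adP; ring.
  apply: cls_psprod_neq0 => //; last by apply/eqP; lia.
  exact: cls_adP (cls_t m n).
apply: (@spanned_natK _ _ _ _ _ m.+1) => //.
have ez : n%:Z - m%:Z = (n - m)%N%:Z by lia.
apply: (@spanned_ext _ _ _ _ _ (fun N => (m.+1%:R * t m n N (g N)
     - (k.+1 ^ m)%:R * (hsumz (P N) m.+1 (n%:Z - m%:Z) * g N)) +
     (k.+1 ^ m)%:R * ((hsum (P N) m.+1 (n - m) - m.+1%:R * (P N 0 ^+ m * P N (n - m))) * g N))).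
  by move=> N; rewrite ez hsumzE; ring.
apply: spannedD.
  by apply: spanned_sub (t_lead m n); apply: szsum_zsum_neq0; apply/eqP; lia.
by apply: spannedM_nat; rewrite ez; apply: spanned_hsum_zsum; lia.
Qed.

Lemma t_psprod_diag n s : all (leq 1) s ->
  spanned (zsum n.+1 (sumn s)%:Z) (fun N => n.+1%:R * t n n N (psprod N s * g N)
    - (k.+1 ^ n)%:R * P N 0 ^+ n.+1 * (psprod N s * g N)).
Proof.
move=> s0; rewrite -[(sumn s)%:Z]add0r.
apply: (@spanned_psprod_ind _ _ _ _ _ _ (fun N v => n.+1%:R * t n n N v -
   (k.+1 ^ n)%:R * P N 0 ^+ n.+1 * v)) => //; last first.
  move=> a u a0 u0.
  apply: (@spanned_ext _ _ _ _ _ (fun N => n.+1%:R * adP P (t n n) a (psprod N u * g N))).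
    by move=> N; rewrite /adP; ring.
  apply: spannedM_nat; apply: cls_psprod => //.
  by rewrite -(subrr n%:Z); apply: cls_adP (cls_t n n).
have := t_lead n n; rewrite subrr => h.
apply: spanned_ext (spanned_sub (@szsum_zsum n 0) h) => N /=.
rewrite hsumzE (_ : hsum (P N) n.+1 0 = P N 0 ^+ n.+1); first ring.
by elim: n.+1 => [|q IHq] //; rewrite hsumS big_ord1 IHq exprS.
Qed.

(** Commuting [t_(n,m)] past [P_a] is negligible unless [a = n - m], since the result has nonzero
    energy. For [a = n - m] it is about [n a t_(n-1,n-1)], a scalar to leading order by
    [t_psprod_diag]. Every occurrence of [n - m] in [s] thus contributes once, as for a
    derivative. *)
Lemma t_psprod_down m n s : (m < n)%N -> all (leq 1) s ->
  spanned (zsum n (m%:Z - n%:Z + (sumn s)%:Z)) (fun N => t n m N (psprod N s * g N)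
    - (k.+1 ^ n.-1 * (n - m) * count_mem (n - m)%N s)%:R * P N 0 ^+ n *
        (psprod N (rem (n - m)%N s) * g N)).
Proof.
case: n => // n ltmn.
elim: s => [|a s IH] /=.
  (* No list has the negative sum [m - n]: the operator kills [g]. *)
  move=> _; apply: spanned_sub (spanned_ext _ (cls_g (cls_t n.+1 m))) => [u /andP[_ h]|N].
    by move: h; rewrite addr0 => /eqP h; have : (m%:Z < n.+1%:Z) by []; lia.
  by rewrite psprod_nil mul1r muln0 !mul0r subr0.
move=> /andP[a0 s0].
have e1 : m%:Z - n.+1%:Z + (a + sumn s)%N%:Z = m%:Z - n.+1%:Z + (sumn s)%:Z + a%:Z by lia.
have hPa := spannedM (fun u => @zsum_cons n.+1 _ a u a0) (IH s0).
have [ea|nea] := eqVneq a (n.+1 - m)%N; last first.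
  have eqr : (if a == (n.+1 - m)%N then s else a :: rem (n.+1 - m)%N s) = a :: rem (n.+1 - m)%N s.
    by rewrite (negPf nea).
  rewrite e1; apply: (@spanned_ext _ _ _ _ _ (fun N => P N a * (t n.+1 m N (psprod N s * g N)
    - (k.+1 ^ n * (n.+1 - m) * count_mem (n.+1 - m)%N s)%:R * P N 0 ^+ n.+1 *
        (psprod N (rem (n.+1 - m)%N s) * g N)) + adP P (t n.+1 m) a (psprod N s * g N))).
    by move=> N; rewrite add0n adP_psprod psprod_cons; ring.
  apply: spannedD => //.
  rewrite -addrA -[_ + a%:Z]addrC addrA; apply: cls_psprod_neq0 => //.
    exact: cls_adP (cls_t n.+1 m).
  by apply/eqP; move/eqP: nea; lia.
rewrite e1.
pose Y N : A N := adP P (t n.+1 m) a (psprod N s * g N)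
   - (n.+1 * a)%:R * t n (m + a - 1) N (psprod N s * g N).
have ema : (m + a - 1 = n)%N by lia.
apply: (@spanned_ext _ _ _ _ _ (fun N => P N a * (t n.+1 m N (psprod N s * g N)
    - (k.+1 ^ n * (n.+1 - m) * count_mem (n.+1 - m)%N s)%:R * P N 0 ^+ n.+1 *
        (psprod N (rem (n.+1 - m)%N s) * g N)) + (Y N +
    a%:R * (n.+1%:R * t n n N (psprod N s * g N)
    - (k.+1 ^ n)%:R * P N 0 ^+ n.+1 * (psprod N s * g N))))).
  move=> N; rewrite adP_psprod /Y ema -ea.
  have hr : (count_mem a s)%:R * (P N a * psprod N (rem a s)) =
     (count_mem a s)%:R * psprod N s.
    have [ins|] := boolP (a \in s); last by move/count_memPn=> ->; rewrite !mul0r.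
    by rewrite -psprod_cons (perm_psprod P N (perm_to_rem ins)).
  rewrite !natrM natrD.
  transitivity (P N a * t n.+1 m N (psprod N s * g N) + adP P (t n.+1 m) a (psprod N s * g N)
    - (k.+1 ^ n)%:R * a%:R * P N 0 ^+ n.+1 * (psprod N s * g N)
    - (k.+1 ^ n)%:R * a%:R * P N 0 ^+ n.+1 *
        ((count_mem a s)%:R * (P N a * psprod N (rem a s))) * g N).
    by ring.
  by rewrite hr -[true%:R]/(1%:R); ring.
apply: spannedD => //.
have e2 : m%:Z - n.+1%:Z + (sumn s)%:Z + a%:Z = m%:Z - n.+1%:Z + a%:Z + (sumn s)%:Z by lia.
rewrite e2; apply: spannedD.
  exact: (cls_psprod (cls_bracketP n m a)).
have -> : m%:Z - n.+1%:Z + a%:Z + (sumn s)%:Z = (sumn s)%:Z by lia.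
by apply: spannedM_nat; apply: t_psprod_diag.
Qed.

Lemma spanned_t12 m n s : all (leq 1) s ->
  spanned (zsum (if m == n.+1 then m.+1 else m) (n.+1%:Z - m%:Z + (sumn s)%:Z))
    (fun N => comm (t 1 2) (t m n) (psprod N s * g N)
      - (n%:R - 2 * m%:R) * t m n.+1 N (psprod N s * g N)).
Proof.
move=> s0; have h := cls_bracket1 m n 2.
have e1 : n%:Z - m%:Z + 2%N%:Z - 1 = n.+1%:Z - m%:Z by lia.
rewrite e1 in h.
apply: (@spanned_ext _ _ _ _ _ (fun N => comm (t 1 2) (t m n) (psprod N s * g N)
   - (n%:R - (m * 2)%:R) * t m (n + 2 - 1) N (psprod N s * g N))).
  by move=> N; rewrite addn2 subn1 /= mulnC natrM.
case: eqP => mn; first exact: (cls_psprod h).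
by apply: (cls_psprod_neq0 h) => //; apply/eqP; lia.
Qed.

(** From [4 t_(2,1) = [H, t_(1,2)]] and Jacobi, [4 [t_(2,1), t_(m,n)] = [H, [t_(1,2), t_(m,n)]] - 2
    n [t_(1,2), t_(m+1,n-1)]], and [2 (n + 1) (n - 2 m) - 2 n (n - 2 m - 3) = 4 (2 n - m)]. The
    hypothesis on [t m' 0] covers [n = 0]. *)
Lemma spanned_t21 m n s : (forall m' N v, comm H (t m' 0) v = 0 :> A N) ->
  all (leq 1) s ->
  spanned (zsum (if m.+1 == n then m.+2 else m.+1) (n%:Z - m.+1%:Z + (sumn s)%:Z))
    (fun N => comm (t 2 1) (t m n) (psprod N s * g N)
      - (2 * n%:R - m%:R) * t m.+1 n N (psprod N s * g N)).
Proof.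
move=> Ht0 s0.
pose D N (v : A N) := comm (t 2 1) (t m n) v - (2 * n%:R - m%:R) * t m.+1 n N v.
suff h : cls m.+1 (n%:Z - m.+1%:Z) D.
  case: eqP => mn; first exact: (cls_psprod h).
  by apply: (cls_psprod_neq0 h) => //; apply/eqP; lia.
apply: (@cls_natK _ _ _ _ _ _ 4) => //.
pose V m n N (v : A N) := comm (t 1 2) (t m n) v
  - (n%:R - (m * 2)%:R) * t m (n + 2 - 1) N v.
have tE m' n' N v : comm H (t m' n') v = (2 * n')%:R * t m'.+1 n'.-1 N v.
  by case: n' => [|n']; [rewrite Ht0 mul0r | rewrite tS].
apply: (@cls_ext _ _ _ _ _ _ (fun N v => comm H (V m n) v - (2 * n)%:R * V m.+1 n.-1 N v)).
  move=> N v.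
  have e4 : 4%:R * comm (t 2 1) (t m n) v = comm H (comm (t 1 2) (t m n)) v
     - (2 * n)%:R * comm (t 1 2) (t m.+1 n.-1) v.
    have e u : 4%:R * t 2 1 N u = comm H (t 1 2) u by rewrite tE.
    have -> : 4%:R * comm (t 2 1) (t m n) v = comm (comm H (t 1 2)) (t m n) v.
      by rewrite {1}/comm mulrBr e -lin_nat // e.
    have -> : (2 * n)%:R * comm (t 1 2) (t m.+1 n.-1) v = comm (t 1 2) (comm H (t m n)) v.
      by rewrite /comm mulrBr -lin_nat // -!tE /comm.
    rewrite /comm !lin_B //; ring.
  have eV : comm H (V m n) v = comm H (comm (t 1 2) (t m n)) v -
     (n%:R - (m * 2)%:R) * comm H (t m n.+1) v.
    rewrite {1}/comm /V lin_B // !mulrBl !lin_B // !lin_nat // addn2 subn1 /= /comm !lin_B //; ring.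
  rewrite /D [RHS]mulrBr e4 eV /V tE /=.
  case: (n) => [|n']; first by rewrite muln0 !mul0r; ring.
  by rewrite /= addn2 subn1 /= !natrM -(natr1 n'); ring.
apply: clsB.
  have -> : n%:Z - m.+1%:Z = n%:Z - m%:Z + 2%N%:Z - 1 - 2 by lia.
  by apply: cls_commH; apply: cls_bracket1.
case: (n) => [|n']; first by apply: cls0P => N v; rewrite mul0r.
apply: clsM_nat; have -> : n'.+1%:Z - m.+1%:Z = n'%:Z - m.+1%:Z + 2%N%:Z - 1 by lia.
exact: cls_bracket1.
Qed.

End Asymptotics.

(** * Derivations and determinants *)

Section Derivation.
Variables (A : comNzRingType) (D : A -> A).
Hypothesis DD : forall x y, D (x + y) = D x + D y.
Hypothesis DM : forall x y, D (x * y) = D x * y + x * D y.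

Lemma deriv_0 : D 0 = 0.
Proof. by have /eqP := DD 0 0; rewrite addr0 -subr_eq subrr => /eqP. Qed.

Lemma deriv_1 : D 1 = 0.
Proof.
by have /eqP := DM 1 1; rewrite !mulr1 mul1r -subr_eq subrr => /eqP.
Qed.

Lemma deriv_N x : D (- x) = - D x.
Proof. by apply/eqP; rewrite -subr_eq0 opprK -DD addNr deriv_0. Qed.

Lemma deriv_sum (I : Type) (r : seq I) (Q : pred I) (F : I -> A) :
  D (\sum_(i <- r | Q i) F i) = \sum_(i <- r | Q i) D (F i).
Proof. exact: (big_morph D DD deriv_0). Qed.

Lemma deriv_signM (b : bool) x : D ((-1) ^+ b * x) = (-1) ^+ b * D x.
Proof. by case: b; rewrite ?mul1r // !mulN1r deriv_N. Qed.

Lemma deriv_prod (I : eqType) (r : seq I) (F : I -> A) : uniq r ->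
  D (\prod_(i <- r) F i)
  = \sum_(j <- r) \prod_(i <- r) (if i == j then D (F i) else F i).
Proof.
elim: r => [|x r IH] /=; first by rewrite !big_nil deriv_1.
move=> /andP[xr /IH{}IH]; rewrite big_cons DM IH [RHS]big_cons; congr (_ + _).
  rewrite big_cons eqxx; congr (_ * _); apply: eq_big_seq => i ir.
  by case: eqP => // ix; rewrite -ix ir in xr.
rewrite mulr_sumr; apply: eq_big_seq => j jr; rewrite big_cons.
by case: eqP => // xj; rewrite xj jr in xr.
Qed.

Lemma deriv_exp n x : D (x ^+ n) = n%:R * x ^+ n.-1 * D x.
Proof.
elim: n => [|n IH]; first by rewrite expr0 deriv_1 !mul0r.
rewrite exprS DM IH; case: n {IH} => [|n]; first by rewrite expr0; ring.
by rewrite /= !exprS -[n.+2%:R]natr1; ring.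
Qed.

Lemma deriv_det N (M : 'M[A]_N) :
  D (\det M) = \sum_r \det (\matrix_(i, j) if i == r then D (M i j) else M i j).
Proof.
rewrite /determinant deriv_sum exchange_big /=; apply: eq_bigr => s _.
rewrite deriv_signM deriv_prod ?index_enum_uniq // -mulr_sumr; congr (_ * _).
apply: eq_bigr => r _; apply: eq_bigr => i _; by rewrite !mxE.
Qed.
End Derivation.

Section RowReplacement.
Variables (A : comNzRingType) (N : nat).
Implicit Types (M : 'M[A]_N) (v : 'rV[A]_N).

Definition setrow r v M : 'M[A]_N := \matrix_(i, j) if i == r then v 0 j else M i j.

Lemma det_setrow r v M : \det (setrow r v M) = \sum_j v 0 j * cofactor M r j.
Proof.
rewrite (expand_det_row _ r); apply: eq_bigr => j _.
rewrite mxE eqxx; congr (_ * (_ * \det _)).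
by apply/matrixP => i l; rewrite !mxE eq_sym (negPf (neq_lift _ _)).
Qed.

Lemma det_setrowD r v w M :
  \det (setrow r (v + w) M) = \det (setrow r v M) + \det (setrow r w M).
Proof.
by rewrite !det_setrow -big_split; apply: eq_bigr => j _; rewrite mxE mulrDl.
Qed.

Lemma det_setrowZ r c v M : \det (setrow r (c *: v) M) = c * \det (setrow r v M).
Proof.
by rewrite !det_setrow mulr_sumr; apply: eq_bigr => j _; rewrite mxE mulrA.
Qed.

Lemma det_setrow0 r M : \det (setrow r 0 M) = 0.
Proof. by rewrite det_setrow big1 // => j _; rewrite mxE mul0r. Qed.

Lemma det_setrow_sum (I : Type) (s : seq I) (Q : pred I) r (F : I -> 'rV[A]_N) M :
  \det (setrow r (\sum_(i <- s | Q i) F i) M) = \sum_(i <- s | Q i) \det (setrow r (F i) M).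
Proof.
by apply: (big_morph (fun v => \det (setrow r v M))) => [v w|];
  rewrite ?det_setrowD ?det_setrow0.
Qed.

Lemma setrowC r r' v w M : r != r' ->
  setrow r v (setrow r' w M) = setrow r' w (setrow r v M).
Proof.
move=> nr; apply/matrixP => i j; rewrite !mxE.
by case: (eqVneq i r) => // ->; rewrite (negPf nr).
Qed.

Lemma row_setrow r v M : row r (setrow r v M) = v.
Proof. by apply/rowP => j; rewrite !mxE eqxx. Qed.

Lemma row_setrow_neq r r' v M : r' != r -> row r' (setrow r v M) = row r' M.
Proof. by move=> nr; apply/rowP => j; rewrite !mxE (negPf nr). Qed.

Lemma setrow_setrow r v w M : setrow r v (setrow r w M) = setrow r v M.
Proof. by apply/matrixP => i j; rewrite !mxE; case: eqP. Qed.

Lemma det_setrow_eq r s v M : s != r -> (forall j, v 0 j = M s j) ->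
  \det (setrow r v M) = 0.
Proof.
move=> nsr vM; apply: (determinant_alternate (i1 := r) (i2 := s)).
  by rewrite eq_sym.
by move=> j; rewrite !mxE eqxx (negPf nsr) vM.
Qed.

(** Both sides are the trace of [M Y adj(M)], whose diagonal entries are cofactor expansions. *)
Lemma trace_det (Y M : 'M[A]_N) :
  \tr Y * \det M = \sum_r \det (setrow r (row r M *m Y) M).
Proof.
transitivity (\tr (M *m Y *m \adj M)).
  rewrite -mulmxA mxtrace_mulC -mulmxA mul_adj_mx -scalemx1 -scalemxAr mulmx1.
  by rewrite mxtraceZ mulrC.
rewrite /mxtrace; apply: eq_bigr => r _; rewrite det_setrow mxE.
by apply: eq_bigr => j _; rewrite -row_mul !mxE.
Qed.

Lemma deriv_det_setrow (D : A -> A) M : (forall x y, D (x + y) = D x + D y) ->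
  (forall x y, D (x * y) = D x * y + x * D y) ->
  D (\det M) = \sum_r \det (setrow r (map_mx D (row r M)) M).
Proof.
move=> DD DM; rewrite (deriv_det DD DM); apply: eq_bigr => r _; congr (\det _).
by apply/matrixP => i j; rewrite !mxE; case: eqP => // ->.
Qed.

End RowReplacement.

(** * Alternants of Krylov vectors *)

Section Alternants.
Variables (A : comNzRingType) (N : nat) (X : 'M[A]_N) (lam : 'rV[A]_N).
Hypothesis char0 : forall x : A, x + x = 0 -> x = 0.

Definition krylov e : 'rV[A]_N := lam *m X ^+ e.
(** For diagonal [X] with entries [x_i] this is, up to the product of the entries of [lam], the
    classical alternant [det (x_i ^ f r)]. With [f r = r] it is the ground state for [k = 1]. *)
Definition alternant (f : 'I_N -> nat) := \det (\matrix_(r, i) krylov (f r) 0 i).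
Definition psum n : A := \tr (X ^+ n).
Definition upd (f : 'I_N -> nat) r x := fun i => if i == r then x else f i.

Lemma krylovD e c : krylov (e + c) = krylov e *m X ^+ c.
Proof. by rewrite /krylov exprD -mulmxA. Qed.

Lemma krylovS e : krylov e.+1 = krylov e *m X.
Proof. by rewrite /krylov exprSr -mulmxE mulmxA. Qed.

Lemma alternant_ext f h : f =1 h -> alternant f = alternant h.
Proof. by move=> e; congr (\det _); apply/matrixP => i j; rewrite !mxE e. Qed.

Lemma alternant_upd f r x :
  alternant (upd f r x) = \det (setrow r (krylov x) (\matrix_(r, i) krylov (f r) 0 i)).
Proof.
by congr (\det _); apply/matrixP => i j; rewrite !mxE /upd; case: eqP => // _; rewrite ?mxE.
Qed.

Lemma alternant_eq0 f r s : r != s -> f r = f s -> alternant f = 0.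
Proof.
by move=> rs e; apply: (determinant_alternate rs) => j; rewrite !mxE e.
Qed.

Lemma alternant_swap f r s x y : r != s ->
  alternant (upd (upd f r y) s x) = - alternant (upd (upd f r x) s y).
Proof.
move=> rs; apply/eqP; rewrite -addr_eq0; apply/eqP.
have sr : s != r by rewrite eq_sym.
have key v w : alternant (upd (upd f r v) s w) =
   \det (setrow s (krylov w) (setrow r (krylov v) (\matrix_(r, i) krylov (f r) 0 i))).
  rewrite alternant_upd; congr (\det (setrow _ _ _)).
  by apply/matrixP => i j; rewrite !mxE /upd; case: eqP => // _; rewrite ?mxE.
set M := \matrix_(_, _) _ in key.
have h0 v : \det (setrow s v (setrow r v M)) = 0.
  by apply: (det_setrow_eq (s := r)) => // j; rewrite mxE eqxx.
have := h0 (krylov x + krylov y).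
rewrite det_setrowD !(setrowC _ _ _ sr) !det_setrowD -!(setrowC _ _ _ sr) !h0 add0r addr0.
by rewrite !key.
Qed.

(** [trace_det] at [X ^ c]: as for classical alternants, a power sum raises one exponent at a
    time. *)
Lemma psumM_alternant c f :
  psum c * alternant f = \sum_r alternant (upd f r (f r + c)).
Proof.
rewrite trace_det; apply: eq_bigr => r _.
rewrite alternant_upd krylovD; congr (\det (setrow _ (_ *m _) _)).
by apply/rowP => j; rewrite !mxE.
Qed.

Lemma antisym_sum0 (f : nat -> nat -> A) n c :
  (forall x y, f y x = - f x y) ->
  \sum_(x < n.+1) f (c + x)%N (c + (n - x))%N = 0.
Proof.
move=> anti; apply: char0; rewrite -[X in _ + X]opprK; apply/eqP; rewrite subr_eq0; apply/eqP.
rewrite [LHS](reindex_inj rev_ord_inj) -sumrN; apply: eq_bigr => x _ /=.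
rewrite subSS subKn; first by rewrite anti.
by rewrite -ltnS.
Qed.

(** The sum over the whole antidiagonal from [(r, s + b)] to [(s + b, r)] vanishes by antisymmetry.
    Past its first [b + 1] terms, only the last one, [f (s + b) r], survives the gap condition. *)
Lemma antisym_sum (f : nat -> nat -> A) r s b : (r < s)%N ->
  (forall x y, f y x = - f x y) ->
  (forall x y, (r < x < s)%N -> f x y = 0) ->
  \sum_(c < b.+1) f (r + c)%N (s + (b - c))%N = f r (s + b)%N.
Proof.
move=> ltrs anti f0.
have f0' x y : (r < y < s)%N -> f x y = 0 by move=> h; rewrite anti f0 ?oppr0.
have T0 := antisym_sum0 (s - r + b) r anti.
rewrite -(big_mkord xpredT (fun x => f (r + x)%N (r + (s - r + b - x))%N)) in T0.
rewrite (big_cat_nat (n := b.+1)) //= in T0; last lia.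
rewrite big_mkord in T0.
have e1 : \sum_(i < b.+1) f (r + i)%N (r + (s - r + b - i))%N =
    \sum_(c < b.+1) f (r + c)%N (s + (b - c))%N.
  by apply: eq_bigr => c _; congr (f _ _); have := ltn_ord c; lia.
have e2 : \sum_(b.+1 <= i < (s - r + b).+1) f (r + i)%N (r + (s - r + b - i))%N =
    - f r (s + b)%N.
  rewrite big_nat_recr /=; last lia.
  rewrite big_nat big1 ?add0r; last first.
    by move=> i /andP[h1 h2]; apply: f0'; apply/andP; split; lia.
  by rewrite anti; congr (- f _ _); lia.
by apply/eqP; rewrite -subr_eq0 -e1 -e2 T0.
Qed.

Local Notation rho := (@nat_of_ord N).

Lemma sum_ltn_const (x : A) (s : 'I_N) : \sum_(r < N | (r < s)%N) x = s%:R * x.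
Proof.
by rewrite (big_ord_narrow (ltnW (ltn_ord s))) sumr_const card_ord mulr_natl.
Qed.

(** An exponent strictly between [r] and [s] belongs to another row, so the alternant vanishes there
    and [antisym_sum] applies. *)
Lemma alternant_upd_sum b (r s : 'I_N) : (r < s)%N ->
  \sum_(c < b.+1) alternant (upd (upd rho r (r + c)) s (s + (b - c)))
  = alternant (upd rho s (s + b)).
Proof.
move=> ltrs; have nrs : r != s by rewrite neq_ltn ltrs.
rewrite (@antisym_sum (fun x y => alternant (upd (upd rho r x) s y)) r s b) //.
- by apply: alternant_ext => i; rewrite /upd; case: (i == s) => //; case: eqP => [->|].
- by move=> x y; apply: alternant_swap.
move=> x y /andP[rx xs].
have ltxN : (x < N)%N by exact: ltn_trans xs (ltn_ord s).
apply: (@alternant_eq0 _ r (Ordinal ltxN)); first by rewrite neq_ltn rx.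
rewrite /upd eqxx (negPf nrs).
by rewrite -!val_eqE /= (ltn_eqF xs) (gtn_eqF rx).
Qed.

(** Multiply the alternant by [P_c P_(b-c)] and sum over [c]. Raising the same row twice gives
    [b + 1] equal terms; for two distinct rows the sum collapses to raising the larger exponent by
    [b]. As [s] rows lie below row [s], the ordered pairs produce the weight [s] twice. *)
Lemma alternant_weight b :
  2%:R * \sum_(r < N) r%:R * alternant (upd rho r (r + b))
  = (hsum psum 2 b - b.+1%:R * psum b) * alternant rho.
Proof.
rewrite mulrBl.
have -> : hsum psum 2 b * alternant rho =
   \sum_(r < N) \sum_(s < N) \sum_(c < b.+1) alternant (upd (upd rho r (r + c)) s
      (upd rho r (r + c) s + (b - c))).
  rewrite hsumS mulr_suml.
  transitivity (\sum_(c < b.+1) \sum_(r < N) \sum_(s < N)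
     alternant (upd (upd rho r (r + c)) s (upd rho r (r + c) s + (b - c)))).
    apply: eq_bigr => c _; rewrite hsum1 mulrAC psumM_alternant mulrC mulr_sumr.
    by apply: eq_bigr => r _; rewrite psumM_alternant.
  by rewrite exchange_big; apply: eq_bigr => r _; rewrite exchange_big.
pose a s := alternant (upd rho s (s + b)).
have inner (r s : 'I_N) : \sum_(c < b.+1) alternant (upd (upd rho r (r + c)) s
      (upd rho r (r + c) s + (b - c))) =
    (if s == r then b.+1%:R * a r else 0) + (if (s < r)%N then a r else 0)
    + (if (r < s)%N then a s else 0).
  case: (ltngtP s r) => [ltsr|ltrs|ers].
  - rewrite -val_eqE /= (ltn_eqF ltsr) add0r addr0 /a -(alternant_upd_sum b ltsr).
    rewrite [LHS](reindex_inj rev_ord_inj); apply: eq_bigr => c _ /=.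
    have lt_c := ltn_ord c; apply: alternant_ext => i.
    rewrite /upd subSS subKn; last by rewrite -ltnS.
    rewrite -(val_eqE s r) /= (ltn_eqF ltsr).
    by case: (eqVneq i s) => // ->; rewrite -val_eqE /= (ltn_eqF ltsr).
  - rewrite -val_eqE /= (gtn_eqF ltrs) !add0r /a -(alternant_upd_sum b ltrs).
    apply: eq_bigr => c _; congr (alternant (upd _ _ (_ + _)%N)).
    by rewrite /upd -val_eqE /= (gtn_eqF ltrs).
  have -> : s = r by apply: val_inj.
  rewrite eqxx !addr0 mulr_natl -[b.+1 in RHS]card_ord -sumr_const.
  apply: eq_bigr => c _; apply: alternant_ext => i; rewrite /upd eqxx.
  by case: eqP => // _; rewrite -addnA subnKC // -ltnS.
have -> : \sum_(r < N) \sum_(s < N) \sum_(c < b.+1) alternant (upd (upd rho r (r + c)) s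
      (upd rho r (r + c) s + (b - c))) =
   b.+1%:R * \sum_(r < N) a r + \sum_(r < N) r%:R * a r + \sum_(s < N) s%:R * a s.
  transitivity (\sum_(r < N) \sum_(s < N) ((if s == r then b.+1%:R * a r else 0)
      + (if (s < r)%N then a r else 0) + (if (r < s)%N then a s else 0))).
    by apply: eq_bigr => r _; apply: eq_bigr => s _.
  transitivity (\sum_(r < N) (\sum_(s < N) (if s == r then b.+1%:R * a r else 0)
    + \sum_(s < N) (if (s < r)%N then a r else 0)
    + \sum_(s < N) (if (r < s)%N then a s else 0))).
    by apply: eq_bigr => r _; rewrite !big_split.
  rewrite !big_split /=; congr (_ + _ + _).
  - by rewrite mulr_sumr; apply: eq_bigr => r _; rewrite -big_mkcond big_pred1_eq.
  - by apply: eq_bigr => r _; rewrite -big_mkcond sum_ltn_const.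
  rewrite exchange_big; apply: eq_bigr => s _.
  by rewrite -big_mkcond sum_ltn_const.
have -> : \sum_(r < N) a r = psum b * alternant rho by rewrite psumM_alternant.
by rewrite -[\sum_(r < N) r%:R * alternant _]/(\sum_(r < N) r%:R * a r); ring.
Qed.

End Alternants.

Lemma exchange_big4 (A : nmodType) (I J S T : finType) (F : I -> J -> S -> T -> A) :
  \sum_i \sum_j \sum_s \sum_t F i j s t = \sum_s \sum_t \sum_j \sum_i F i j s t.
Proof.
rewrite (eq_bigr _ (fun i _ => exchange_big _ _ _ _ _ _)) exchange_big.
apply: eq_bigr => s _.
rewrite (eq_bigr _ (fun i _ => exchange_big _ _ _ _ _ _)) exchange_big.
by apply: eq_bigr => t _; rewrite exchange_big.
Qed.

(** * The matrix Laplacian *)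

Section MatrixLaplacian.
Variables (A : comNzRingType) (N : nat) (X : 'M[A]_N) (lam : 'rV[A]_N).
Variable d : 'I_N -> 'I_N -> A -> A.
Hypothesis char0 : forall x : A, x + x = 0 -> x = 0.
Hypothesis dD : forall i j x y, d i j (x + y) = d i j x + d i j y.
Hypothesis dM : forall i j x y, d i j (x * y) = d i j x * y + x * d i j y.
Hypothesis dX : forall i j k l, d i j (X k l) = ((i == k) && (j == l))%:R.
Hypothesis dlam : forall i j l, d i j (lam 0 l) = 0.

Local Notation u := (krylov X lam).
Local Notation P := (psum X).
Local Notation rho := (@nat_of_ord N).
Local Notation M := (\matrix_(r < N, i < N) u r 0 i).
Local Notation Delta := (alternant X lam rho).

(** This is [Tr Z^2], since [Z^i_j] differentiates in the transposed entry; [gam] is its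
    polarization. *)
Definition lap (f : A) := \sum_i \sum_j d i j (d j i f).
Definition gam (f h : A) := \sum_i \sum_j d i j f * d j i h.
(** On the eigenvalues of [X] this is the vector field [x^b d/dx], which explains [field_psum] and
    [field_krylov]. *)
Definition field b (f : A) := \sum_i \sum_j (X ^+ b) i j * d i j f.

Lemma lapM f h : lap (f * h) = lap f * h + 2%:R * gam f h + f * lap h.
Proof.
have -> : 2%:R * gam f h = gam f h + \sum_i \sum_j d j i f * d i j h.
  by rewrite mulr_natl mulr2n; congr (_ + _); rewrite /gam exchange_big.
rewrite /lap /gam !(mulr_suml, mulr_sumr) -!big_split; apply: eq_bigr => i _ /=.
rewrite !(mulr_suml, mulr_sumr) -!big_split; apply: eq_bigr => j _ /=.
by rewrite !(dM, dD); ring.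
Qed.

Lemma gamMr f h h' : gam f (h * h') = gam f h * h' + h * gam f h'.
Proof.
rewrite /gam !(mulr_suml, mulr_sumr) -!big_split; apply: eq_bigr => i _ /=.
rewrite !(mulr_suml, mulr_sumr) -!big_split; apply: eq_bigr => j _ /=.
by rewrite dM; ring.
Qed.

Lemma gam1 f : gam f 1 = 0.
Proof.
by apply: big1 => i _; apply: big1 => j _; rewrite (deriv_1 (dM _ _)) mulr0.
Qed.

Lemma fieldM b f h : field b (f * h) = field b f * h + f * field b h.
Proof.
rewrite /field !(mulr_suml, mulr_sumr) -!big_split; apply: eq_bigr => i _ /=.
rewrite !(mulr_suml, mulr_sumr) -!big_split; apply: eq_bigr => j _ /=.
by rewrite dM; ring.
Qed.

Lemma d_sum i j (I : Type) (r : seq I) (Q : pred I) (F : I -> A) :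
  d i j (\sum_(x <- r | Q x) F x) = \sum_(x <- r | Q x) d i j (F x).
Proof. exact: deriv_sum. Qed.

Lemma d_Xexp i j n k l : d i j ((X ^+ n) k l) =
  \sum_(s < n) (X ^+ s) k i * (X ^+ (n - s.+1)) j l.
Proof.
elim: n k l => [|n IH] k l.
  rewrite big_ord0 expr0 mxE; case: eqP => _; first exact: (deriv_1 (dM i j)).
  exact: (deriv_0 (dD i j)).
rewrite exprS -mulmxE mxE d_sum.
transitivity (\sum_m ((i == k)%:R * (j == m)%:R * (X ^+ n) m l +
   X k m * \sum_(s < n) (X ^+ s) m i * (X ^+ (n - s.+1)) j l)).
  apply: eq_bigr => m _; rewrite dM dX IH; congr (_ * _ + _).
  by case: (i == k); case: (j == m); rewrite ?mulr0 ?mul0r ?mulr1.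
rewrite big_split big_ord_recl /= expr0 mxE subn1 /= [k == i]eq_sym; congr (_ + _).
  rewrite (bigD1 j) //= eqxx mulr1 big1 ?addr0 // => m mj.
  by rewrite [j == m]eq_sym (negPf mj) mulr0 mul0r.
under eq_bigr do rewrite mulr_sumr.
rewrite exchange_big; apply: eq_bigr => s _ /=.
rewrite /bump /= add1n subSS exprS -mulmxE [in RHS]mxE mulr_suml.
by apply: eq_bigr => m _; rewrite mulrA.
Qed.

Lemma d_krylov i j e l : d i j (u e 0 l) =
  \sum_(s < e) u s 0 i * (X ^+ (e - s.+1)) j l.
Proof.
rewrite /krylov mxE d_sum.
under eq_bigr do rewrite dM dlam mul0r add0r d_Xexp mulr_sumr.
rewrite exchange_big; apply: eq_bigr => s _ /=; rewrite mxE mulr_suml.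
by apply: eq_bigr => m _; rewrite mulrA.
Qed.

Lemma d_psum i j n : d i j (P n) = n%:R * (X ^+ n.-1) j i.
Proof.
rewrite /psum /mxtrace d_sum.
under eq_bigr do rewrite d_Xexp.
rewrite exchange_big /=.
rewrite (eq_bigr (fun=> (X ^+ n.-1) j i)) ?sumr_const ?card_ord ?mulr_natl // => s _.
have -> : n.-1 = (n - s.+1 + s)%N by have := ltn_ord s; lia.
rewrite exprD -mulmxE mxE; apply: eq_bigr => m _; exact: mulrC.
Qed.

Lemma gam_psum n f : gam (P n) f = n%:R * field n.-1 f.
Proof.
rewrite /gam /field exchange_big mulr_sumr; apply: eq_bigr => i _.
rewrite mulr_sumr; apply: eq_bigr => j _.
by rewrite d_psum mulrA.
Qed.

Lemma field_psum b n : field b (P n) = n%:R * P (b + n.-1).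
Proof.
rewrite /field /psum exprD -mulmxE /mxtrace mulr_sumr; apply: eq_bigr => i _.
rewrite mxE mulr_sumr; apply: eq_bigr => j _.
by rewrite d_psum; ring.
Qed.

Lemma d_natM i j n x : d i j (n%:R * x) = n%:R * d i j x.
Proof.
rewrite !mulr_natl; elim: n => [|n IH]; first by rewrite !mulr0n (deriv_0 (dD i j)).
by rewrite !mulrS dD IH.
Qed.

Lemma lap_psum n : lap (P n.+2) = n.+2%:R * hsum P 2 n.
Proof.
rewrite /lap hsumS mulr_sumr.
transitivity (\sum_i \sum_j \sum_(s < n.+1) n.+2%:R * ((X ^+ s) i i * (X ^+ (n - s)) j j)).
  apply: eq_bigr => i _; apply: eq_bigr => j _.
  by rewrite d_psum d_natM d_Xexp mulr_sumr; apply: eq_bigr => s _; rewrite subSS.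
under eq_bigr do rewrite exchange_big.
rewrite exchange_big; apply: eq_bigr => s _ /=; rewrite hsum1 /psum /mxtrace.
rewrite mulr_suml mulr_sumr; apply: eq_bigr => i _.
by rewrite !mulr_sumr.
Qed.

Lemma lap_psum_lt2 n : (n < 2)%N -> lap (P n) = 0.
Proof.
move=> n2; apply: big1 => i _; apply: big1 => j _; rewrite d_psum d_natM d_Xexp.
by case: n n2 => [|[|]] // _; rewrite big_ord0 mulr0.
Qed.

Lemma field_krylov b e l : field b (u e 0 l) = e%:R * u (b + e).-1 0 l.
Proof.
rewrite /field; under eq_bigr do under eq_bigr do rewrite d_krylov mulr_sumr.
under eq_bigr do rewrite exchange_big.
rewrite exchange_big /=.
rewrite (eq_bigr (fun=> u (b + e).-1 0 l)) ?sumr_const ?card_ord ?mulr_natl // => s _.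
have -> : (b + e).-1 = (s + (b + (e - s.+1)))%N by have := ltn_ord s; lia.
rewrite krylovD exprD -mulmxE mulmxA [RHS]mxE exchange_big; apply: eq_bigr => j _ /=.
rewrite mxE mulr_suml; apply: eq_bigr => i _; ring.
Qed.

Lemma field_det b : field b Delta = \sum_(r < N) r%:R * alternant X lam (upd rho r (b + r).-1).
Proof.
rewrite /field.
under eq_bigr do under eq_bigr do rewrite (deriv_det_setrow _ (dD _ _) (dM _ _)) mulr_sumr.
under eq_bigr do rewrite exchange_big.
rewrite exchange_big; apply: eq_bigr => r _ /=.
rewrite alternant_upd -det_setrowZ.
transitivity (\det (setrow r (\sum_i \sum_j (X ^+ b) i j *: map_mx (d i j) (row r M)) M)).
  rewrite det_setrow_sum; apply: eq_bigr => i _.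
  by rewrite det_setrow_sum; apply: eq_bigr => j _; rewrite det_setrowZ.
congr (\det (setrow _ _ _)); apply/rowP => l; rewrite mxE -field_krylov summxE.
apply: eq_bigr => i _; rewrite summxE; apply: eq_bigr => j _.
by rewrite !mxE.
Qed.

Lemma field_Delta b : 2%:R * field b.+1 Delta = (hsum P 2 b - b.+1%:R * P b) * Delta.
Proof.
rewrite -alternant_weight // field_det; congr (_ * _); apply: eq_bigr => r _.
by rewrite addSn addnC.
Qed.

Lemma field0_Delta : field 0 Delta = 0.
Proof.
rewrite field_det; apply: big1 => r _; rewrite add0n.
case: (posnP r) => [->|r0]; first by rewrite mul0r.
have lt : (r.-1 < N)%N by have := ltn_ord r; lia.
have ne : (r == Ordinal lt) = false by apply/negbTE; rewrite -val_eqE /=; lia.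
rewrite (@alternant_eq0 _ _ _ _ _ r (Ordinal lt)) ?mulr0 ?ne //.
by rewrite /upd eqxx eq_sym ne.
Qed.

Lemma det_setrow_krylov_eq0 (r : 'I_N) x : (x < N)%N -> x != r ->
  \det (setrow r (u x) M) = 0.
Proof.
move=> xN xr; apply: (det_setrow_eq (s := Ordinal xN)); first by rewrite -val_eqE.
by move=> j; rewrite [RHS]mxE.
Qed.

Lemma d_krylov_row i j (r : 'I_N) :
  map_mx (d i j) (row r M) = \sum_(s < r) u s 0 i *: row j (X ^+ (r - s.+1)).
Proof.
apply/rowP => l; rewrite 3!mxE d_krylov summxE; apply: eq_bigr => s _.
by rewrite !mxE.
Qed.

Lemma krylov_row e c : u (e + c) = \sum_j u e 0 j *: row j (X ^+ c).
Proof. by rewrite krylovD mulmx_sum_row. Qed.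

(** Contracting the indices puts exponents [x] and [x'] in rows [r] and [r'] of the two
    determinants, with [x + x' = r + r' - 2]. One of them is below its row number and repeats
    another row. *)
Lemma gam_Delta : gam Delta Delta = 0.
Proof.
pose B r e i := \det (setrow r (row i (X ^+ e)) M).
have dDelta i j : d i j Delta = \sum_(r < N) \sum_(s < r) u s 0 i * B r (r - s.+1)%N j.
  rewrite (deriv_det_setrow _ (dD _ _) (dM _ _)); apply: eq_bigr => r _.
  by rewrite d_krylov_row det_setrow_sum; apply: eq_bigr => s _; rewrite det_setrowZ.
have Bu r e s : \sum_j u s 0 j * B r e j = \det (setrow r (u (s + e)) M).
  by rewrite krylov_row det_setrow_sum; apply: eq_bigr => j _; rewrite det_setrowZ.
transitivity (\sum_(r < N) \sum_(s < r) \sum_(r' < N) \sum_(s' < r')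
   (\sum_j u s' 0 j * B r (r - s.+1)%N j) * (\sum_i u s 0 i * B r' (r' - s'.+1)%N i)).
  rewrite /gam.
  under eq_bigr do under eq_bigr do rewrite !dDelta mulr_suml.
  under eq_bigr do rewrite exchange_big.
  rewrite exchange_big; apply: eq_bigr => r _ /=.
  under eq_bigr do under eq_bigr do rewrite mulr_suml.
  under eq_bigr do rewrite exchange_big.
  rewrite exchange_big; apply: eq_bigr => s _ /=.
  under eq_bigr do under eq_bigr do rewrite mulr_sumr.
  under eq_bigr do rewrite exchange_big.
  rewrite exchange_big; apply: eq_bigr => r' _ /=.
  under eq_bigr do under eq_bigr do rewrite mulr_sumr.
  under eq_bigr do rewrite exchange_big.
  rewrite exchange_big; apply: eq_bigr => s' _ /=.
  rewrite exchange_big mulr_suml; apply: eq_bigr => j _ /=.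
  by rewrite mulr_sumr; apply: eq_bigr => i _; ring.
apply: big1 => r _; apply: big1 => s _; apply: big1 => r' _; apply: big1 => s' _.
rewrite !Bu; have lts := ltn_ord s; have lts' := ltn_ord s'.
have ltr := ltn_ord r; have ltr' := ltn_ord r'.
have [h|h] := ltnP (s' + (r - s.+1)) r.
  by rewrite det_setrow_krylov_eq0 ?mul0r //; lia.
by rewrite (@det_setrow_krylov_eq0 r') ?mulr0 //; lia.
Qed.

Lemma lap_krylov_row (r : 'I_N) :
  map_mx lap (row r M) = \sum_(s < r) (\sum_(x < s) P (s - x.+1) *: u (x + (r - s.+1))
     + \sum_(x < r - s.+1) P x *: u (s + (r - s.+1 - x.+1))).
Proof.
apply/rowP => l; rewrite 3!mxE summxE.
transitivity (\sum_i \sum_j \sum_(s < r)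
   (\sum_(x < s) (u x 0 i * (X ^+ (s - x.+1)) j j) * (X ^+ (r - s.+1)) i l
   + u s 0 j * \sum_(x < r - s.+1) (X ^+ x) i i * (X ^+ (r - s.+1 - x.+1)) j l)).
  apply: eq_bigr => i _; apply: eq_bigr => j _; rewrite d_krylov d_sum.
  by apply: eq_bigr => s _; rewrite dM d_krylov d_Xexp mulr_suml.
under eq_bigr do rewrite exchange_big.
rewrite exchange_big; apply: eq_bigr => s _ /=; rewrite mxE !summxE.
under eq_bigr do rewrite big_split.
rewrite big_split; congr (_ + _).
  under eq_bigr do rewrite exchange_big.
  rewrite exchange_big; apply: eq_bigr => x _ /=.
  rewrite mxE krylovD mxE /psum /mxtrace mulr_sumr; apply: eq_bigr => i _.
  by rewrite mulr_suml; apply: eq_bigr => j _; ring.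
under eq_bigr do under eq_bigr do rewrite mulr_sumr.
under eq_bigr do rewrite exchange_big.
rewrite exchange_big; apply: eq_bigr => x _ /=.
rewrite mxE krylovD mxE /psum /mxtrace mulr_suml; apply: eq_bigr => i _.
by rewrite mulr_sumr; apply: eq_bigr => j _; ring.
Qed.

(** Two derivatives of [u r] only leave vectors [u x] with [x < r], which are other rows of [M]. *)
Lemma det_setrow_lap (r : 'I_N) : \det (setrow r (map_mx lap (row r M)) M) = 0.
Proof.
have ltr := ltn_ord r.
rewrite lap_krylov_row det_setrow_sum; apply: big1 => s _; have lts := ltn_ord s.
rewrite det_setrowD !det_setrow_sum !big1 ?addr0 // => x _; have ltx := ltn_ord x.
  by rewrite det_setrowZ det_setrow_krylov_eq0 ?mulr0 //; lia.
by rewrite det_setrowZ det_setrow_krylov_eq0 ?mulr0 //; lia.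
Qed.

(** To avoid equal rows, [x] and [y] must be distinct and lie in [{r, r'}] or be at least [N]; their
    sum is then at least [r + r']. *)
Lemma det_setrow2_krylov_eq0 (r r' : 'I_N) x y : r != r' -> (x + y < r + r')%N ->
  \det (setrow r (u x) (setrow r' (u y) M)) = 0.
Proof.
move=> nr xy; have ltr := ltn_ord r; have ltr' := ltn_ord r'.
have nr' : r' != r by rewrite eq_sym.
have [exy|nxy] := eqVneq x y.
  by apply: (det_setrow_eq nr') => j; rewrite exy [RHS]mxE eqxx.
have [/andP[xN xr]|hx] := boolP ((x < N) && (x != r) && (x != r'))%N.
  case/andP: xN => xN xr0; apply: (det_setrow_eq (s := Ordinal xN)); rewrite -?val_eqE //.
  by move=> j; rewrite [RHS]mxE -val_eqE /= (negPf xr) [RHS]mxE.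
rewrite setrowC //.
have yN : (y < N)%N by move: nxy hx; move: (val r) (val r') ltr ltr' nr xy => a b; lia.
have yr : (y != r)%N by move: hx nxy; rewrite -val_eqE /= in nr; lia.
have yr' : (y != r')%N by move: hx nxy; rewrite -val_eqE /= in nr; lia.
apply: (det_setrow_eq (s := Ordinal yN)); rewrite -?val_eqE //.
by move=> j; rewrite [RHS]mxE -val_eqE /= (negPf yr) [RHS]mxE.
Qed.

(** Both derivatives hit one row, or they hit two rows [r] and [r'] and leave exponents of sum
    [r + r' - 2]. For powers of [Delta] the vanishing of [gam_Delta] is needed as well. *)
Lemma lap_Delta : lap Delta = 0.
Proof.
pose C r r' e e' i j := \det (setrow r' (row i (X ^+ e')) (setrow r (row j (X ^+ e)) M)).
rewrite /lap.
transitivity (\sum_i \sum_j \sum_r (\det (setrow r (map_mx (d i j \o d j i) (row r M)) M) +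
   \sum_(r' | r' != r) \det (setrow r' (map_mx (d i j) (row r' M))
      (setrow r (map_mx (d j i) (row r M)) M)))).
  apply: eq_bigr => i _; apply: eq_bigr => j _.
  rewrite (deriv_det_setrow _ (dD _ _) (dM _ _)) d_sum; apply: eq_bigr => r _.
  rewrite (deriv_det_setrow _ (dD _ _) (dM _ _)) (bigD1 r) //=; congr (_ + _).
    by rewrite row_setrow setrow_setrow -map_mx_comp.
  by apply: eq_bigr => r' nr; rewrite row_setrow_neq.
transitivity (\sum_r (\det (setrow r (map_mx lap (row r M)) M) + \sum_(r' | r' != r)
   \sum_(s < r) \sum_(s' < r') \det (setrow r' (u (s + (r' - s'.+1)))
       (setrow r (u (s' + (r - s.+1))) M)))).
  under eq_bigr do rewrite exchange_big.
  rewrite exchange_big; apply: eq_bigr => r _ /=.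
  under eq_bigr do rewrite big_split.
  rewrite big_split; congr (_ + _).
    transitivity (\det (setrow r (\sum_i \sum_j map_mx (d i j \o d j i) (row r M)) M)).
      rewrite det_setrow_sum; apply: eq_bigr => i _.
      by rewrite det_setrow_sum.
    congr (\det (setrow _ _ _)); apply/rowP => l; rewrite !mxE summxE.
    by apply: eq_bigr => i _; rewrite summxE; apply: eq_bigr => j _; rewrite !mxE.
  under eq_bigr do rewrite exchange_big.
  rewrite exchange_big; apply: eq_bigr => r' nr /=; have nr' : r != r' by rewrite eq_sym.
  transitivity (\sum_i \sum_j \sum_(s < r) \sum_(s' < r')
     u s 0 j * u s' 0 i * C r r' (r - s.+1)%N (r' - s'.+1)%N j i).
    apply: eq_bigr => i _; apply: eq_bigr => j _.
    rewrite !d_krylov_row setrowC // det_setrow_sum; apply: eq_bigr => s _.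
    rewrite det_setrowZ setrowC // det_setrow_sum mulr_sumr; apply: eq_bigr => s' _.
    by rewrite det_setrowZ mulrA.
  rewrite [LHS]exchange_big4; apply: eq_bigr => s _; apply: eq_bigr => s' _.
  rewrite krylov_row det_setrow_sum; apply: eq_bigr => j _.
  rewrite det_setrowZ setrowC // krylov_row det_setrow_sum mulr_sumr.
  by apply: eq_bigr => i _; rewrite det_setrowZ setrowC // mulrA.
apply: big1 => r _; rewrite det_setrow_lap add0r.
apply: big1 => r' nr; apply: big1 => s _; apply: big1 => s' _.
have lts := ltn_ord s; have lts' := ltn_ord s'.
by apply: det_setrow2_krylov_eq0 => //; lia.
Qed.

Lemma gam_Delta_exp k : gam Delta (Delta ^+ k) = 0.
Proof.
elim: k => [|k IH]; first by rewrite expr0 gam1.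
by rewrite exprS gamMr gam_Delta IH mul0r mulr0 addr0.
Qed.

Lemma lap_Delta_exp k : lap (Delta ^+ k) = 0.
Proof.
elim: k => [|k IH].
  apply: big1 => i _; apply: big1 => j _.
  by rewrite expr0 (deriv_1 (dM _ _)) (deriv_0 (dD _ _)).
by rewrite exprS lapM lap_Delta gam_Delta_exp IH mul0r !mulr0 !addr0.
Qed.

Lemma field_Delta_exp k b :
  2%:R * field b.+1 (Delta ^+ k) = k%:R * (hsum P 2 b - b.+1%:R * P b) * Delta ^+ k.
Proof.
elim: k => [|k IH].
  rewrite expr0 !mul0r /field big1 ?mulr0 // => i _; apply: big1 => j _.
  by rewrite (deriv_1 (dM _ _)) mulr0.
rewrite exprS fieldM mulrDr mulrA field_Delta mulrCA IH -natr1; ring.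
Qed.

Lemma field0_Delta_exp k : field 0 (Delta ^+ k) = 0.
Proof.
elim: k => [|k IH].
  apply: big1 => i _; apply: big1 => j _.
  by rewrite expr0 (deriv_1 (dM _ _)) mulr0.
by rewrite exprS fieldM field0_Delta IH mul0r mulr0 addr0.
Qed.

Lemma lap_psum_Delta k a : lap (P a * Delta ^+ k) = (if a is b.+2 then
   a%:R * (k.+1%:R * hsum P 2 b - (k * b.+1)%:R * P b) else 0) * Delta ^+ k.
Proof.
rewrite lapM lap_Delta_exp mulr0 addr0 gam_psum.
case: a => [|[|b]].
- by rewrite lap_psum_lt2 // !mul0r mulr0 addr0.
- by rewrite lap_psum_lt2 // field0_Delta_exp !mulr0 mul0r addr0.
rewrite lap_psum mulrCA field_Delta_exp -natr1 natrM; ring.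
Qed.

Lemma lap_comm_psum a b v :
  let E w := lap (P a * w) - P a * lap w in
  E (P b * v) - P b * E v = (2 * a * b)%:R * (P (a + b - 2) * v).
Proof.
move=> E; rewrite /E !lapM.
have -> : gam (P a) (P b * v) = gam (P a) (P b) * v + P b * gam (P a) v by rewrite gamMr.
rewrite [gam (P a) (P b)]gam_psum field_psum.
have [ab0|] := eqVneq (a * b)%N 0%N.
  have -> : (a%:R * (b%:R * P (a.-1 + b.-1)) : A) = 0.
    by rewrite mulrA -natrM ab0 mul0r.
  by rewrite -mulnA ab0 muln0 mul0r; ring.
rewrite muln_eq0 negb_or -!lt0n => /andP[a0 b0].
have -> : (a.-1 + b.-1 = a + b - 2)%N by lia.
by rewrite !natrM; ring.
Qed.

(** The sum of all words in the operators [X] and [d] of length [L] with [n]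
    letters [X], as a matrix of operators. *)
Fixpoint wordsum L n (i j : 'I_N) (v : A) : A :=
  if L is L'.+1 then \sum_k d k i (wordsum L' n k j v) +
    (if n is n'.+1 then \sum_k X i k * wordsum L' n' k j v else 0)
  else if (n == 0%N) && (i == j) then v else 0.

Lemma wordsumS L n i j v : wordsum L.+1 n i j v = \sum_k d k i (wordsum L n k j v) +
    (if n is n'.+1 then \sum_k X i k * wordsum L n' k j v else 0).
Proof. by []. Qed.

Lemma wordsum_gt L n i j v : (L < n)%N -> wordsum L n i j v = 0.
Proof.
elim: L n i j => [|L IH] [|n] i j // ltLn; rewrite wordsumS !big1 ?addr0 // => k _.
  by rewrite IH ?mulr0.
by rewrite IH ?(deriv_0 (dD _ _)) //; apply: ltnW.
Qed.

Lemma wordsum_full n i j v : wordsum n n i j v = (X ^+ n) i j * v.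
Proof.
elim: n i j => [|n IH] i j /=.
  by rewrite expr0 mxE; case: (i == j); rewrite ?mul1r ?mul0r.
rewrite big1 ?add0r => [|k _]; last by rewrite wordsum_gt ?(deriv_0 (dD _ _)).
rewrite exprS -mulmxE mxE mulr_suml; apply: eq_bigr => k _.
by rewrite IH mulrA.
Qed.

Hypothesis dC : forall i j k l x, d i j (d k l x) = d k l (d i j x).

Lemma lap_sum (I : Type) (r : seq I) (F : I -> A) :
  lap (\sum_(x <- r) F x) = \sum_(x <- r) lap (F x).
Proof.
rewrite /lap; under eq_bigr do under eq_bigr do rewrite !d_sum.
under eq_bigr do rewrite exchange_big.
by rewrite exchange_big.
Qed.

Lemma lap_D x y : lap (x + y) = lap x + lap y.
Proof.
rewrite /lap -big_split; apply: eq_bigr => i _; rewrite -big_split.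
by apply: eq_bigr => j _; rewrite !dD.
Qed.

Lemma lap_d i j v : lap (d i j v) = d i j (lap v).
Proof.
rewrite /lap d_sum; apply: eq_bigr => k _; rewrite d_sum; apply: eq_bigr => l _.
by rewrite (dC l k) (dC k l).
Qed.

Lemma lap_XM i k v : lap (X i k * v) = X i k * lap v + 2%:R * d k i v.
Proof.
rewrite lapM.
have -> : lap (X i k) = 0.
  apply: big1 => a _; apply: big1 => b _; rewrite dX.
  by case: (_ && _); rewrite ?(deriv_1 (dM _ _)) ?(deriv_0 (dD _ _)).
rewrite mul0r add0r addrC; congr (_ + _ * _).
rewrite /gam (bigD1 i) //= (bigD1 k) //= dX !eqxx mul1r !big1 ?addr0 //.
- move=> a nai; apply: big1 => b _.
  by rewrite dX (negPf nai) mul0r.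
- by move=> b nbk; rewrite dX eqxx (negPf nbk) mul0r.
Qed.

Lemma lap_wordsum0 L i j v : lap (wordsum L 0 i j v) = wordsum L 0 i j (lap v).
Proof.
elim: L i j => [|L IH] i j.
  rewrite /=; case: eqP => _ //.
  by apply: big1 => a _; apply: big1 => b _; rewrite !(deriv_0 (dD _ _)).
rewrite !wordsumS !addr0 lap_sum; apply: eq_bigr => k _.
by rewrite lap_d IH.
Qed.

(** Commuting with [lap] changes one letter [X] into [2 d]. A word with [n] letters [X] arises in
    this way from each of its [L - n] letters [d]. *)
Lemma lap_wordsum L n i j v : lap (wordsum L n.+1 i j v) =
  wordsum L n.+1 i j (lap v) + (2 * (L - n))%:R * wordsum L n i j v.
Proof.
elim: L n i j => [|L IH] n i j.
  rewrite sub0n muln0 mul0r addr0 /=.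
  by apply: big1 => a _; apply: big1 => b _; rewrite !(deriv_0 (dD _ _)).
rewrite !wordsumS lap_D !lap_sum.
have -> : \sum_k lap (d k i (wordsum L n.+1 k j v)) =
   \sum_k d k i (wordsum L n.+1 k j (lap v)) + (2 * (L - n))%:R * \sum_k d k i (wordsum L n k j v).
  rewrite mulr_sumr -big_split; apply: eq_bigr => k _ /=.
  by rewrite lap_d IH dD d_natM.
have -> : \sum_k lap (X i k * wordsum L n k j v) = \sum_k X i k * wordsum L n k j (lap v)
   + 2%:R * \sum_k d k i (wordsum L n k j v)
   + (2 * (L.+1 - n))%:R * (if n is n'.+1 then \sum_k X i k * wordsum L n' k j v else 0).
  rewrite mulr_sumr; case: n {IH}(IH n.-1) => [|n] IH.
    rewrite mulr0 addr0 -big_split; apply: eq_bigr => k _ /=.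
    by rewrite lap_XM lap_wordsum0.
  rewrite mulr_sumr -!big_split; apply: eq_bigr => k _ /=.
  by rewrite lap_XM IH subSS; ring.
have -> : (2 * (L.+1 - n))%:R * (\sum_k d k i (wordsum L n k j v) +
    (if n is n'.+1 then \sum_k X i k * wordsum L n' k j v else 0)) =
   ((2 * (L - n))%:R + 2%:R) * \sum_k d k i (wordsum L n k j v) +
   (2 * (L.+1 - n))%:R * (if n is n'.+1 then \sum_k X i k * wordsum L n' k j v else 0).
  rewrite mulrDr; congr (_ + _); have [lenL|ltLn] := leqP n L.
    by rewrite -natrD subSn // mulnS addnC.
  by rewrite !big1 ?mulr0 // => k _; rewrite wordsum_gt // (deriv_0 (dD _ _)).
by ring.
Qed.

End MatrixLaplacian.

Lemma mderiv_var (K : comNzRingType) n (a b : 'I_n) :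
  ('X_b : {mpoly K[n]})^`M(a) = (a == b)%:R.
Proof.
rewrite mderivX mnm1E eq_sym; case: eqP => [->|_]; last by rewrite scale0r.
have -> : (U_(b) - U_(b) = 0 :> 'X_{1..n})%MM.
  by apply/mnmP => i; rewrite mnmBE subnn mnm0E.
by rewrite mpolyX0 scale1r.
Qed.

(** * The symmetrized traces on the Fock space *)

Section FockOperators.
Variables (R : realType) (N : nat).
Local Notation F := {mpoly R[i][N * N + N]}.
Local Notation X := (Zdag R N).
Local Notation lam := (ldag R N).

Definition dZ (i j : 'I_N) (v : F) : F := v^`M(zvar i j).

Lemma dZ_D i j x y : dZ i j (x + y) = dZ i j x + dZ i j y.
Proof. exact: mderivD. Qed.

Lemma dZ_M i j x y : dZ i j (x * y) = dZ i j x * y + x * dZ i j y.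
Proof. exact: mderivM. Qed.

Lemma dZ_X i j k l : dZ i j (X k l) = ((i == k) && (j == l))%:R.
Proof. by rewrite mxE /dZ mderiv_var zvar_eq. Qed.

Lemma dZ_lam i j l : dZ i j (lam 0 l) = 0.
Proof. by rewrite mxE /dZ mderiv_var eq_lrshift. Qed.

Lemma dZ_C i j k l x : dZ i j (dZ k l x) = dZ k l (dZ i j x).
Proof. exact: mderiv_comm. Qed.

Lemma mpoly_char0 (x : F) : x + x = 0 -> x = 0.
Proof.
rewrite -mulr2n -scaler_nat => /eqP; rewrite scaler_eq0 pnatr_eq0 /=.
by move/eqP.
Qed.

Local Notation lapF := (lap dZ).
Local Notation PF := (psum X).
Local Notation Delta := (alternant X lam (@nat_of_ord N)).

Lemma groundE k : ground R N k = Delta ^+ k.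
Proof. by rewrite /ground mulr1. Qed.

Lemma sum_tuple_cons (V : nmodType) L (Q : pred (L.+1.-tuple bool)) (G : L.+1.-tuple bool -> V) :
  \sum_(w | Q w) G w = \sum_b \sum_(w : L.-tuple bool | Q (cons_tuple b w)) G (cons_tuple b w).
Proof.
rewrite pair_big_dep.
rewrite (reindex (fun p : bool * L.-tuple bool => cons_tuple p.1 p.2)) //=.
exists (fun w => (thead w, behead_tuple w)) => [[b w] _|w _] /=.
  by congr (_, _); apply: val_inj.
by rewrite [RHS]tuple_eta; apply: val_inj.
Qed.

Lemma sum_wordmx L n i j (v : F) :
  \sum_(w : L.-tuple bool | count_mem true w == n) wordmx w i j v = wordsum X dZ L n i j v.
Proof.
elim: L n i j => [|L IH] n i j.
  case: n => [|n]; last by rewrite big_pred0 // => w; rewrite tuple0.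
  by rewrite (big_pred1 [tuple]) // => w; rewrite tuple0 /= [RHS]eqxx.
rewrite sum_tuple_cons big_bool /= addrC.
congr (_ + _).
  transitivity (\sum_(w : L.-tuple bool | count_mem true w == n)
      \sum_k dZ k i (wordmx w k j v)); first by apply: eq_bigl => w.
  rewrite exchange_big; apply: eq_bigr => k _.
  by rewrite -IH /dZ raddf_sum.
case: n => [|n]; first by rewrite big_pred0.
transitivity (\sum_(w : L.-tuple bool | count_mem true w == n)
    \sum_k X i k * wordmx w k j v).
  by apply: eq_big => w // _; apply: eq_bigr => k _; rewrite mxE.
rewrite exchange_big; apply: eq_bigr => k _.
by rewrite -IH mulr_sumr.
Qed.

Lemma tFockE m n (v : F) : tFock R N m n v =
  'C(m + n, n)%:R^-1 *: \sum_i wordsum X dZ (m + n) n i i v.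
Proof.
rewrite /tFock /opmxtrace scaler_sumr; apply: eq_bigr => i _.
by rewrite /symmx sum_wordmx.
Qed.

Lemma tFock0 n v : tFock R N 0 n v = PF n * v.
Proof.
rewrite tFockE binn invr1 scale1r /psum /mxtrace mulr_suml; apply: eq_bigr => i _.
by rewrite add0n; apply: wordsum_full; exact: dZ_D.
Qed.

Lemma tFock_lap_comm m n v :
  lapF (tFock R N m n.+1 v) - tFock R N m n.+1 (lapF v)
  = (2 * n.+1)%:R * tFock R N m.+1 n v.
Proof.
have lapZ c x : lapF (c *: x) = c *: lapF x.
  rewrite /lap scaler_sumr; apply: eq_bigr => i _; rewrite scaler_sumr.
  by apply: eq_bigr => j _; rewrite /dZ !mderivZ.
have dDF := dZ_D; have dMF := dZ_M.
rewrite !tFockE lapZ lap_sum // -scalerBr -sumrB.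
have -> : \sum_i (lapF (wordsum X dZ (m + n.+1) n.+1 i i v) -
    wordsum X dZ (m + n.+1) n.+1 i i (lapF v))
   = (2 * m.+1)%:R * \sum_i wordsum X dZ (m + n.+1) n i i v.
  rewrite mulr_sumr; apply: eq_bigr => i _.
  rewrite (lap_wordsum dDF dMF dZ_X dZ_C) addrC addKr addnS subSn ?leq_addl //.
  by rewrite addnK.
have natZ a (x : F) : a%:R * x = a%:R *: x by rewrite mulr_natl scaler_nat.
rewrite addnS addSn !natZ !scalerA; congr (_ *: _).
(* The normalizations on the two sides differ by [(n + 1) C(m+n+1, n+1) = (m + 1) C(m+n+1, n)]. *)
have := mul_bin_left (m + n).+1 n; rewrite subSn ?leq_addl // addnK => e.
have c0 : 'C((m + n).+1, n)%:R != 0 :> R[i].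
  by rewrite pnatr_eq0 -lt0n bin_gt0 leqW // leq_addl.
have c1 : 'C((m + n).+1, n.+1)%:R != 0 :> R[i].
  by rewrite pnatr_eq0 -lt0n bin_gt0 ltnS leq_addl.
apply: (mulfI c1); rewrite mulVKf //; apply: (mulIf c0); rewrite -mulrA mulfVK //.
by rewrite -!natrM; congr (_%:R); rewrite -mulnA -e; ring.
Qed.

Lemma tFock_lap_comm0 m v : lapF (tFock R N m 0 v) = tFock R N m 0 (lapF v).
Proof.
have lapZ c x : lapF (c *: x) = c *: lapF x.
  rewrite /lap scaler_sumr; apply: eq_bigr => i _; rewrite scaler_sumr.
  by apply: eq_bigr => j _; rewrite /dZ !mderivZ.
rewrite !tFockE lapZ (lap_sum dZ_D); congr (_ *: _); apply: eq_bigr => i _.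
by rewrite lap_wordsum0 //; [exact: dZ_D|exact: dZ_C].
Qed.

Lemma tFock_linear m n c u v :
  tFock R N m n (c *: u + v) = c *: tFock R N m n u + tFock R N m n v.
Proof.
have lw L q i j : wordsum X dZ L q i j (c *: u + v) =
    c *: wordsum X dZ L q i j u + wordsum X dZ L q i j v.
  elim: L q i j => [|L IH] q i j.
    by rewrite /=; case: ifP; rewrite // scaler0 addr0.
  rewrite !wordsumS scalerDr addrACA; congr (_ + _).
    rewrite scaler_sumr -big_split; apply: eq_bigr => k _ /=.
    by rewrite IH /dZ mderivD mderivZ.
  case: q => [|q]; first by rewrite scaler0 addr0.
  rewrite scaler_sumr -big_split; apply: eq_bigr => k _ /=.
  by rewrite IH mulrDr scalerAr.
rewrite !tFockE scalerA mulrC -scalerA -scalerDr; congr (_ *: _).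
by rewrite scaler_sumr -big_split; apply: eq_bigr => i _; rewrite lw.
Qed.

Lemma lap_linear c u v : lapF (c *: u + v) = c *: lapF u + lapF v.
Proof.
rewrite (lap_D dZ_D); congr (_ + _).
rewrite /lap scaler_sumr; apply: eq_bigr => i _; rewrite scaler_sumr.
by apply: eq_bigr => j _; rewrite /dZ !mderivZ.
Qed.

Lemma psum0 : PF 0 = N%:R.
Proof. by rewrite /psum expr0 mxtrace1. Qed.

End FockOperators.

(** * The leading orders specialized to the Fock space *)

Section FockAsymptotics.
Variables (R : realType) (k : nat).

Definition fock N := {mpoly R[i][N * N + N]}.
Local Notation A := (fun N : nat => fock N : comAlgType R[i]).
Definition powersum N : nat -> fock N := psum (Zdag R N).
Definition vac N : fock N := ground R N k.
Definition flap N : fock N -> fock N := lap (@dZ R N).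
Definition fockt m n N : fock N -> fock N := tFock R N m n.

Lemma flap_vac N : flap (vac N) = 0.
Proof.
rewrite /flap /vac groundE; apply: lap_Delta_exp.
- exact: dZ_D.
- exact: dZ_M.
- exact: dZ_X.
- exact: dZ_lam.
Qed.

Lemma fock_E_P a b N (v : fock N) :
  adP powersum (adP powersum flap a) b v
  = (2 * a * b)%:R * (powersum N (a + b - 2) * v).
Proof.
apply: lap_comm_psum; [exact: dZ_D|exact: dZ_M|exact: dZ_X].
Qed.

Lemma fock_E_g a N : adP powersum flap a (vac N) = Hc (A := A) powersum k a N * vac N.
Proof.
rewrite /adP flap_vac mulr0 subr0 /vac groundE.
rewrite /flap /powersum lap_psum_Delta.
- by case: a => [|[|a]].
- exact: mpoly_char0.
- exact: dZ_D.
- exact: dZ_M.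
- exact: dZ_X.
- exact: dZ_lam.
Qed.

Lemma fock_P0 N : powersum N 0 = N%:R. Proof. exact: psum0. Qed.

Lemma fock_lin_lap : lin (A := A) flap.
Proof. by move=> N c u v; apply: lap_linear. Qed.

Lemma fock_lin_t m n : lin (A := A) (fockt m n).
Proof. by move=> N c u v; apply: tFock_linear. Qed.

Lemma fock_t0 n N (v : fock N) : fockt 0 n v = powersum N n * v.
Proof. exact: tFock0. Qed.

Lemma fock_tS m n N (v : fock N) :
  comm (A := A) flap (fockt m n.+1) v = (2 * n.+1)%:R * fockt m.+1 n v.
Proof. exact: tFock_lap_comm. Qed.

Lemma fock_Ht0 m N (v : fock N) : comm (A := A) flap (fockt m 0) v = 0.
Proof. by rewrite /comm /flap /fockt tFock_lap_comm0 subrr. Qed.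

Local Notation psp := (psprod (A := A) powersum).
Local Notation fspanned := (spanned (K := R[i]) (A := A) powersum vac).

Lemma fock_up m n s : (m < n)%N -> all (leq 1) s ->
  fspanned (zsum m (n%:Z - m%:Z + (sumn s)%:Z)) (fun N => fockt m n (psp N s * vac N)
    - (k.+1 ^ m)%:R * (powersum N 0 ^+ m * powersum N (n - m)) * (psp N s * vac N)).
Proof.
exact: (t_psprod_up fock_lin_lap flap_vac fock_E_P fock_E_g fock_lin_t fock_t0 fock_tS).
Qed.

Lemma fock_diag n s : all (leq 1) s ->
  fspanned (zsum n.+1 (sumn s)%:Z) (fun N => n.+1%:R * fockt n n (psp N s * vac N)
    - (k.+1 ^ n)%:R * powersum N 0 ^+ n.+1 * (psp N s * vac N)).
Proof.
exact: (t_psprod_diag fock_lin_lap flap_vac fock_E_P fock_E_g fock_lin_t fock_t0 fock_tS).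
Qed.

Lemma fock_down m n s : (m < n)%N -> all (leq 1) s ->
  fspanned (zsum n (m%:Z - n%:Z + (sumn s)%:Z)) (fun N => fockt n m (psp N s * vac N)
    - (k.+1 ^ n.-1 * (n - m) * count_mem (n - m)%N s)%:R * powersum N 0 ^+ n *
        (psp N (rem (n - m)%N s) * vac N)).
Proof.
exact: (t_psprod_down fock_lin_lap fock_P0 flap_vac fock_E_P fock_E_g fock_lin_t fock_t0 fock_tS).
Qed.

Lemma fock_t12 m n s : all (leq 1) s ->
  fspanned (zsum (if m == n.+1 then m.+1 else m) (n.+1%:Z - m%:Z + (sumn s)%:Z))
    (fun N => fockt 1 2 (fockt m n (psp N s * vac N)) - fockt m n (fockt 1 2 (psp N s * vac N))
      - (n%:R - 2 * m%:R) * fockt m n.+1 (psp N s * vac N)).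
Proof.
exact: (spanned_t12 fock_lin_lap fock_P0 flap_vac fock_E_P fock_E_g fock_lin_t fock_t0 fock_tS).
Qed.

Lemma fock_t21 m n s : all (leq 1) s ->
  fspanned (zsum (if m.+1 == n then m.+2 else m.+1) (n%:Z - m.+1%:Z + (sumn s)%:Z))
    (fun N => fockt 2 1 (fockt m n (psp N s * vac N)) - fockt m n (fockt 2 1 (psp N s * vac N))
      - (2 * n%:R - m%:R) * fockt m.+1 n (psp N s * vac N)).
Proof.
move=> s0.
exact: (spanned_t21 fock_lin_lap fock_P0 flap_vac fock_E_P fock_E_g fock_lin_t fock_t0 fock_tS
  m n fock_Ht0 s0).
Qed.

End FockAsymptotics.

(** * Newton's identities for traces *)

Section Newton.
Variables (A : comNzRingType) (N : nat) (X : 'M[A]_N).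
Local Notation P := (psum X).
Local Notation chi := (char_poly X).
Local Notation Q := (\adj (char_poly_mx X)).

Definition adjcoef j : 'M[A]_N := \matrix_(i, l) (Q i l)`_j.

Lemma mul_char_poly_adj i l :
  'X * Q i l - \sum_k (X i k)%:P * Q k l = chi *+ (i == l).
Proof.
have := mul_mx_adj (char_poly_mx X); rewrite -/chi; move: Q => Qa.
move=> /(congr1 (fun C : 'M[{poly A}]_N => C i l)).
rewrite /char_poly_mx mulmxBl mul_scalar_mx !mxE => <-; congr (_ - _).
by apply: eq_bigr => k _; rewrite mxE.
Qed.

Lemma adjcoefE j i l : adjcoef j i l = (Q i l)`_j.
Proof. by rewrite mxE. Qed.

(** Coefficients of [(x - X) adj(x - X) = chi]. This recursion gives Newton's identities over any
    commutative ring, without eigenvalues. *)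
Lemma adjcoefS j : adjcoef j = X *m adjcoef j.+1 + (chi`_j.+1)%:M.
Proof.
apply/matrixP => i l.
rewrite adjcoefE [RHS]mxE [X in _ = X + _]mxE [X in _ = _ + X]mxE.
have := congr1 (fun p : {poly A} => p`_j.+1) (mul_char_poly_adj i l).
rewrite coefMn coefB coefXM /= coef_sum => <-.
rewrite (eq_bigr (fun k => ((X i k)%:P * Q k l)`_j.+1)); last first.
  by move=> k _; rewrite coefCM adjcoefE.
by rewrite addrC subrK.
Qed.

Lemma adjcoef0 : X *m adjcoef 0 + (chi`_0)%:M = 0.
Proof.
apply/matrixP => i l.
rewrite mxE [X in X + _]mxE [X in _ + X]mxE [RHS]mxE.
have := congr1 (fun p : {poly A} => p`_0) (mul_char_poly_adj i l).
rewrite coefMn coefB coefXM /= sub0r coef_sum => <-; apply/eqP; rewrite subr_eq0.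
by apply/eqP; apply: eq_bigr => k _; rewrite coefCM adjcoefE.
Qed.

Lemma trace_adj : \tr Q = chi^`().
Proof.
rewrite /char_poly (deriv_det_setrow _ (@derivD _) (@derivM _)) /mxtrace.
apply: eq_bigr => r _; rewrite det_setrow mxE (bigD1 r) //= big1 ?addr0 => [|j jr].
  by rewrite !mxE eqxx derivB derivX derivC subr0 mul1r.
by rewrite !mxE eq_sym (negPf jr) derivB derivC mulr0n deriv0 subr0 mul0r.
Qed.
Lemma adjcoef_bound : exists B, forall j, (B <= j)%N -> adjcoef j = 0.
Proof.
exists (\max_i \max_l size (Q i l)) => j lej; apply/matrixP => i l; rewrite adjcoefE [RHS]mxE.
apply: nth_default; apply: leq_trans lej.
by apply: leq_trans (leq_bigmax i); apply: (leq_bigmax l).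
Qed.

Lemma trace_adjcoef j : \tr (adjcoef j) = j.+1%:R * chi`_j.+1.
Proof.
have := congr1 (fun p : {poly A} => p`_j) trace_adj.
rewrite coef_deriv mulr_natl => <-; rewrite /mxtrace coef_sum.
by apply: eq_bigr => i _; rewrite adjcoefE.
Qed.

(** With [c_l] the coefficients of the characteristic polynomial, the trace of
    [X ^ n] times the [j]-th coefficient of the adjugate is the sum of the
    [c_l P_(n + l - j - 1)] over [l > j]. *)
Lemma newton_sums : exists B, [/\ (N < B)%N,
  forall n, \sum_(x < B) chi`_x * P (n + x) = 0 &
  forall i, i%:R * chi`_i = \sum_(x < B) chi`_(i + x) * P x].
Proof.
have [B leNB hB] : exists2 B, (N <= B)%N & forall j, (B <= j)%N -> adjcoef j = 0.
  have [B0 hB0] := adjcoef_bound; exists (maxn B0 N); first exact: leq_maxr.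
  by move=> j; rewrite geq_max => /andP[h _]; apply: hB0.
have eX n : X ^+ n *m X = X ^+ n.+1 by rewrite mulmxE -exprSr.
have T e j n : (B <= j + e)%N ->
    \tr (X ^+ n *m adjcoef j) = \sum_(x < e) chi`_(j.+1 + x) * P (n + x).
  elim: e j n => [|e IH] j n le.
    by rewrite big_ord0 hB ?mulmx0 ?mxtrace0 //; rewrite addn0 in le.
  rewrite adjcoefS mulmxDr mulmxA eX mul_mx_scalar mxtraceD mxtraceZ.
  rewrite IH ?addSnnS // big_ord_recl !addn0 addrC; congr (_ + _).
  by apply: eq_bigr => x _; rewrite /= /bump /= add1n !addnS !addSn.
have T0 n : \sum_(x < B.+1) chi`_x * P (n + x) = 0.
  have := congr1 (fun C => \tr (X ^+ n *m C)) adjcoef0.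
  rewrite mulmxDr mulmxA eX mul_mx_scalar mxtraceD mxtraceZ mulmx0 mxtrace0.
  rewrite (T B) ?add0n // => e; rewrite big_ord_recl addn0 -[RHS]e addrC; congr (_ + _).
  by apply: eq_bigr => x _; rewrite /= /bump /= add1n !addnS !addSn.
exists B.+1; split=> // i; case: i => [|i].
  by rewrite mul0r -[LHS](T0 0%N).
have := T B.+1 i 0%N; rewrite expr0 mul1mx trace_adjcoef => -> //.
by rewrite addnS ltnW // ltnS leq_addl.
Qed.

(** Newton's identities express the coefficients of the characteristic polynomial through
    [P_1, ..., P_N] after division by integers, and the trace of the Cayley-Hamilton relation then
    expresses each higher [P_n]. *)
Lemma powersums_generate (S : A -> Prop) :
  (forall n, S n%:R) -> (forall x y, S x -> S y -> S (x - y)) ->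
  (forall x y, S x -> S y -> S (x * y)) ->
  (forall n x, (0 < n)%N -> S (n%:R * x) -> S x) ->
  (forall n, (0 < n <= N)%N -> S (P n)) -> forall n, S (P n).
Proof.
move=> Sn SB SM Sdiv SP.
have S0 : S 0 by apply: (Sn 0%N).
have SN x : S x -> S (- x) by move=> h; rewrite -sub0r; apply: SB.
have SD x y : S x -> S y -> S (x + y).
  by move=> hx hy; rewrite -[y]opprK; apply: SB => //; apply: SN.
have SSum (I : Type) (r : seq I) (F : I -> A) : (forall i, S (F i)) -> S (\sum_(i <- r) F i).
  by move=> h; apply: (big_ind S).
have [B [ltNB hCH hNewton]] := newton_sums.
have sz : size chi = N.+1 := size_char_poly X.
have chiN : chi`_N = 1.
  by have /monicP := char_poly_monic X; rewrite lead_coefE sz.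
have chi_gt l : (N < l)%N -> chi`_l = 0 by move=> h; apply: nth_default; rewrite sz.
have P0 : P 0 = N%:R by rewrite /psum expr0 mxtrace1.
(* Descending induction on [i]: the term [P_0 = N] in Newton's identity leaves [(N - i) chi_i] on
   one side and higher coefficients on the other. *)
have Schi e i : (N <= i + e)%N -> S chi`_i.
  elim: e i => [|e IH] i.
    rewrite addn0 leq_eqVlt => /orP[/eqP <-|/chi_gt->] //.
    by rewrite chiN; apply: (Sn 1%N).
  move=> le; have [lti|] := ltnP i N; last first.
    rewrite leq_eqVlt => /orP[/eqP <-|/chi_gt->] //.
    by rewrite chiN; apply: (Sn 1%N).
  apply: (Sdiv (N - i)%N); first by rewrite subn_gt0.
  have := hNewton i; case: B ltNB {hCH hNewton} => [//|B] _.
  rewrite big_ord_recl addn0 P0 => e1.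
  rewrite natrB ?mulrBl; last exact: ltnW.
  rewrite e1 (mulrC N%:R) opprD addrA subrr sub0r; apply: SN; apply: SSum => x.
  have [h|h] := leqP (i + lift ord0 x) N; last by rewrite chi_gt // mul0r.
  by apply: SM; [apply: IH|apply: SP]; move: h; rewrite /= /bump /= add1n; lia.
elim/ltn_ind => n IH; have [leN|ltN] := leqP n N.
  case: n leN {IH} => [|n] leN; first by rewrite P0.
  exact: SP.
have := hCH (n - N)%N; rewrite (bigD1 (Ordinal ltNB)) //= chiN mul1r subnK ?(ltnW ltN) //.
move/eqP; rewrite addr_eq0 => /eqP ->; apply: SN.
apply: (big_ind S) => // x nx.
have [h|h] := leqP x N; last by rewrite chi_gt // mul0r.
apply: SM; first by apply: (Schi N); lia.
apply: IH; have : (x != N :> nat) by [].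
by lia.
Qed.

End Newton.

Lemma mulrACA_l (A : comNzRingType) (x y z t : A) : x * y * (z * t) = z * (x * (y * t)).
Proof. by ring. Qed.

Lemma mderiv_chain (K : comNzRingType) (n : nat) (A : comAlgType K)
    (phi : {mpoly K[n]} -> A) (D : A -> A) :
  (forall c x y, phi (c *: x + y) = c *: phi x + phi y) ->
  (forall x y, phi (x * y) = phi x * phi y) -> phi 1 = 1 ->
  (forall c x y, D (c *: x + y) = c *: D x + D y) ->
  (forall x y, D (x * y) = D x * y + x * D y) ->
  forall f, D (phi f) = \sum_a phi f^`M(a) * D (phi 'X_a).
Proof.
move=> phiL phiM phi1 DL DM f.
have phi0 : phi 0 = 0 by have := phiL (-1) 0 0; rewrite scaler0 addr0 scaleN1r addNr.
have phiD x y : phi (x + y) = phi x + phi y by have := phiL 1 x y; rewrite !scale1r.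
have DD x y : D (x + y) = D x + D y by have := DL 1 x y; rewrite !scale1r.
pose Q f := D (phi f) = \sum_a phi f^`M(a) * D (phi 'X_a).
have QM f1 f2 : Q f1 -> Q f2 -> Q (f1 * f2).
  rewrite /Q phiM DM => -> ->; rewrite mulr_suml mulr_sumr -big_split.
  by apply: eq_bigr => a _; rewrite mderivM phiD !phiM /=; ring.
have Q1 : Q 1.
  rewrite /Q phi1 (deriv_1 DM) big1 // => a _.
  by rewrite mderivC phi0 mul0r.
have QX a : Q 'X_a.
  rewrite /Q (bigD1 a) //= mderiv_var eqxx phi1 mul1r big1 ?addr0 // => b ba.
  by rewrite mderiv_var (negPf ba) phi0 mul0r.
suff: Q f by [].
elim/mpolyind: f => [|c m f _ _ Qf].
  by rewrite /Q phi0 (deriv_0 DD) big1 // => a _; rewrite mderiv0 phi0 mul0r.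
have Qm : Q 'X_[m].
  rewrite mpolyXE_id; apply: (big_ind Q) => // a _.
  by elim: (m a) => [|e IH]; rewrite ?expr0 // exprS; apply: QM.
rewrite /Q phiL DL Qf Qm scaler_sumr -big_split.
apply: eq_bigr => a _ /=.
by rewrite mderivD mderivZ phiL mulrDl scalerAl.
Qed.

(** * States as polynomials in the power sums, and algebraic independence *)

Section PolynomialStates.
Variables (R : realType) (N : nat).
Local Notation F := {mpoly R[i][N * N + N]}.
Local Notation Pol := {mpoly R[i][N]}.
Local Notation X := (Zdag R N).
Local Notation lam := (ldag R N).
Local Notation PF := (psum X).
Local Notation Delta := (alternant X lam (@nat_of_ord N)).

Definition npsum (i : 'I_N) : F := (sqrtN R N ^- i.+1) *: PF i.+1.

Definition subst_psum : Pol -> F := locked (mmap (@mpolyC _ _) npsum).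
Local Notation phi := subst_psum.

Lemma substD f h : phi (f + h) = phi f + phi h. Proof. by rewrite /subst_psum -lock mmapD. Qed.
Lemma substB f h : phi (f - h) = phi f - phi h. Proof. by rewrite /subst_psum -lock mmapB. Qed.
Lemma subst0 : phi 0 = 0. Proof. by rewrite /subst_psum -lock mmap0. Qed.
Lemma substM f h : phi (f * h) = phi f * phi h. Proof. by rewrite /subst_psum -lock rmorphM. Qed.
Lemma subst1 : phi 1 = 1. Proof. by rewrite /subst_psum -lock rmorph1. Qed.
Lemma substC c : phi c%:MP = c%:MP. Proof. by rewrite /subst_psum -lock mmapC. Qed.
Lemma substZ c f : phi (c *: f) = c *: phi f.
Proof. by rewrite /subst_psum -lock mmapZ mul_mpolyC. Qed.
Lemma subst_var (i : 'I_N) : phi 'X_i = npsum i.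
Proof. by rewrite /subst_psum -lock mmapX mmap1U. Qed.
Lemma subst_sum (I : Type) (r : seq I) (G : I -> Pol) :
  phi (\sum_(i <- r) G i) = \sum_(i <- r) phi (G i).
Proof. exact: (big_morph phi substD subst0). Qed.

Lemma substE f : phi f = \sum_(m <- msupp f) (f@_m)%:MP * \prod_(i < N) npsum i ^+ m i.
Proof. by rewrite /subst_psum -lock. Qed.
Lemma d_npsum i j (a : 'I_N) :
  dZ i j (npsum a) = (sqrtN R N ^- a.+1 * a.+1%:R)%:MP * (X ^+ a) j i.
Proof.
rewrite /npsum /dZ mderivZ -/(dZ i j (PF a.+1)) d_psum.
- by rewrite -mul_mpolyC mpolyCM mpolyC_nat mulrA.
- exact: dZ_D.
- exact: dZ_M.
- exact: dZ_X.
Qed.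


Lemma sqrtN_neq0 : (0 < N)%N -> sqrtN R N != 0.
Proof. by move=> N0; rewrite sqrtC_eq0 pnatr_eq0 -lt0n. Qed.

Lemma sqr_sqrtN : sqrtN R N ^+ 2 = N%:R.
Proof. exact: sqrtCK. Qed.

Lemma ofpolyE k f : ofpoly k f = phi f * Delta ^+ k.
Proof.
rewrite /ofpoly substE mulr_suml; apply: eq_bigr => m _.
by rewrite -groundE mul_mpolyC -scalerAl.
Qed.

(** At [Z = diag (1, ..., N)] and [lambda = (1, ..., 1)] the matrix of the
    ground state is a Vandermonde matrix. *)
Lemma Delta_neq0 : Delta != 0.
Proof.
pose a : 'rV[R[i]]_N := \row_i i.+1%:R.
pose w : 'I_(N * N + N) -> R[i] := fun x => row_mx (mxvec (diag_mx a)) (const_mx 1) 0 x.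
have wz i j : w (zvar i j) = (diag_mx a) i j by rewrite /w /zvar row_mxEl mxvecE.
have wl i : w (lvar i) = 1 by rewrite /w /lvar row_mxEr mxE.
apply/eqP => /(congr1 (meval w)); rewrite meval0 => D0.
have: \det (Vandermonde N a) = 0.
  rewrite -D0 /alternant -det_map_mx; congr (\det _); apply/matrixP => r i.
  have key e l : (map_mx (meval w) (krylov X lam e)) 0 l = l.+1%:R ^+ e.
    elim: e l => [|e IH] l.
      by rewrite /krylov expr0 mulmx1 !mxE mevalXU wl.
    rewrite krylovS map_mxM mxE (bigD1 l) //= IH big1 ?addr0.
      by rewrite !mxE mevalXU wz !mxE eqxx exprSr.
    by move=> j jl; rewrite !mxE mevalXU wz !mxE (negPf jl) mulr0.
  have kr : meval w (krylov X lam r 0 i) = i.+1%:R ^+ r by rewrite -key [RHS]mxE.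
  by rewrite [RHS]mxE [in RHS]mxE; apply: etrans (esym kr); rewrite !mxE.
apply/eqP; rewrite det_Vandermonde; apply/prodf_neq0 => i _; apply/prodf_neq0 => j ij.
by rewrite !mxE subr_eq0 eqr_nat eqSS gtn_eqF.
Qed.

Lemma d_subst i j f : dZ i j (phi f) = \sum_a phi f^`M(a) * dZ i j (npsum a).
Proof.
have := @mderiv_chain _ _ _ phi (dZ i j) _ _ _ _ _ f.
rewrite (eq_bigr (fun a => phi f^`M(a) * dZ i j (npsum a))) => [h|a _].
  apply: h.
  - by move=> c x y; rewrite substD substZ.
  - exact: substM.
  - exact: subst1.
  - by move=> c x y; rewrite /dZ mderivD mderivZ.
  - exact: dZ_M.
by rewrite subst_var.
Qed.

(** Multiplication by the adjugate gives [Delta * w a = 0], in a domain where [Delta] is nonzero. *)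
Lemma krylov_free (w : 'I_N -> F) :
  (forall l, \sum_a w a * krylov X lam a 0 l = 0) -> forall a, w a = 0.
Proof.
move=> h a; pose M : 'M[F]_N := \matrix_(r, i) krylov X lam r 0 i.
have: (\row_r w r) *m M *m \adj M = 0.
  apply/rowP => l; rewrite mxE [RHS]mxE big1 // => j _.
  rewrite mxE (eq_bigr (fun r => w r * krylov X lam r 0 j)) ?h ?mul0r // => r _.
  by rewrite mxE [M _ _]mxE.
rewrite -mulmxA mul_mx_adj mul_mx_scalar => /rowP/(_ a).
rewrite 2!mxE [RHS]mxE => /eqP; rewrite mulf_eq0 => /orP[|/eqP //].
by rewrite (negPf Delta_neq0).
Qed.

(** Induction on the degree: the chain rule and [krylov_free] show that the partial derivatives of
    [f] lie in the kernel too, so they vanish and [f] is constant. *)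
Lemma subst_inj0 f : (0 < N)%N -> phi f = 0 -> f = 0.
Proof.
move=> N0; have [n] : exists n, (msize f <= n.+1)%N by exists (msize f).
elim: n f => [|n IH] f szf phif.
  move: phif; rewrite (msize1_polyC szf) substC => /eqP; rewrite mpolyC_eq0 => /eqP ->.
  exact: mpolyC0.
have df a : f^`M(a) = 0.
  have wa0 : (phi f^`M(a)) * ((sqrtN R N ^- a.+1 * a.+1%:R)%:MP) = 0.
    apply: (krylov_free (w := fun a => (phi f^`M(a)) * ((sqrtN R N ^- a.+1 * a.+1%:R)%:MP))) => l.
    (* Contracting the derivatives with [lam] turns the matrices [X ^+ a] into the vectors
       [krylov a]. *)
    transitivity (\sum_j lam 0 j * (\sum_b phi f^`M(b) * dZ l j (npsum b))); last first.
      by apply: big1 => j _; rewrite -d_subst phif /dZ mderiv0 mulr0.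
    under [RHS]eq_bigr do rewrite mulr_sumr.
    rewrite exchange_big; apply: eq_bigr => b _ /=.
    rewrite /krylov mxE mulr_sumr; apply: eq_bigr => j _.
    rewrite d_npsum.
    exact: mulrACA_l.
  have: phi f^`M(a) = 0.
    move/eqP: wa0; rewrite mulf_eq0 => /orP[/eqP //|].
    rewrite mpolyC_eq0 mulf_eq0 invr_eq0 expf_eq0 (negPf (sqrtN_neq0 N0)) andbF /=.
    by rewrite pnatr_eq0 => /eqP.
  apply: IH; rewrite msizeE; apply/bigmax_leqP_seq => m; rewrite mcoeff_msupp => mf _.
  have: (m + U_(a))%MM \in msupp f.
    by rewrite mcoeff_msupp; apply: contraNneq mf; rewrite mcoeff_deriv => ->; rewrite mul0rn.
  move/msize_mdeg_lt; rewrite mdegD mdeg1 addn1 => lt.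
  by rewrite -ltnS; apply: leq_trans lt szf.
have fC : f = (f@_0)%:MP.
  apply/mpolyP => m; have [->|m0] := eqVneq m 0%MM.
    by rewrite mcoeffC eqxx mulr1.
  rewrite mcoeffC (_ : (m == 0%MM) = false) ?mulr0; last exact/negbTE.
  have [a ma] : exists a, (0 < m a)%N.
    apply/existsP; apply: contraNT m0; rewrite negb_exists => /forallP h.
    by apply/eqP/mnmP => a; rewrite mnm0E; apply/eqP; rewrite -leqn0 leqNgt.
  have := congr1 (mcoeff (m - U_(a))%MM) (df a); rewrite mcoeff_deriv mcoeff0.
  have -> : (m - U_(a) + U_(a))%MM = m.
    by apply/mnmP => b; rewrite mnmDE mnmBE mnm1E subnK //; case: eqP => // <-.
  by move/eqP; rewrite mulrn_eq0 /= => /eqP.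
move: phif; rewrite fC substC => /eqP; rewrite mpolyC_eq0 => /eqP ->.
by rewrite mpolyC0.
Qed.

Lemma ofpoly_inj k (f h : Pol) : (0 < N)%N -> ofpoly k f = ofpoly k h -> f = h.
Proof.
move=> N0; rewrite !ofpolyE => /(mulIf (expf_neq0 k Delta_neq0)) e.
by apply/eqP; rewrite -subr_eq0; apply/eqP/(subst_inj0 N0); rewrite substB e subrr.
Qed.

End PolynomialStates.

Lemma exchange_big3 (A : nmodType) (I J S : finType) (F : I -> J -> S -> A) :
  \sum_i \sum_j \sum_s F i j s = \sum_s \sum_i \sum_j F i j s.
Proof.
rewrite exchange_big; under [RHS]eq_bigr do rewrite exchange_big.
by rewrite [RHS]exchange_big; apply: eq_bigr => j _; rewrite exchange_big.
Qed.

Section ChainRule.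
Variables (K A : comNzRingType) (n N : nat).
Variables (phi : {mpoly K[n]} -> A) (h : 'I_n -> A) (d : 'I_N -> 'I_N -> A -> A).
Hypothesis dD : forall i j x y, d i j (x + y) = d i j x + d i j y.
Hypothesis dM : forall i j x y, d i j (x * y) = d i j x * y + x * d i j y.
Hypothesis d_phi : forall i j f, d i j (phi f) = \sum_a phi f^`M(a) * d i j (h a).

Lemma gam_chain f x : gam d (phi f) x = \sum_a phi f^`M(a) * gam d (h a) x.
Proof.
rewrite /gam; under eq_bigr do under eq_bigr do rewrite d_phi mulr_suml.
rewrite exchange_big3; apply: eq_bigr => a _ /=; rewrite mulr_sumr.
apply: eq_bigr => i _; rewrite mulr_sumr; apply: eq_bigr => j _.
by rewrite mulrA.
Qed.

Lemma lap_chain f : lap d (phi f) =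
  \sum_a \sum_b phi (f^`M(a))^`M(b) * gam d (h b) (h a) + \sum_a phi f^`M(a) * lap d (h a).
Proof.
rewrite -big_split /=.
transitivity (\sum_i \sum_j \sum_a
   (\sum_b phi (f^`M(a))^`M(b) * (d i j (h b) * d j i (h a)) + phi f^`M(a) * d i j (d j i (h a)))).
  apply: eq_bigr => i _; apply: eq_bigr => j _.
  rewrite d_phi (deriv_sum (dD i j)); apply: eq_bigr => a _.
  rewrite dM d_phi mulr_suml; congr (_ + _).
  by apply: eq_bigr => b _; rewrite mulrA.
rewrite exchange_big3; apply: eq_bigr => a _ /=.
under eq_bigr do rewrite big_split.
rewrite big_split; congr (_ + _).
  rewrite exchange_big3; apply: eq_bigr => b _ /=; rewrite mulr_sumr.
  by apply: eq_bigr => i _; rewrite mulr_sumr.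
rewrite mulr_sumr; apply: eq_bigr => i _; by rewrite mulr_sumr.
Qed.
End ChainRule.

(** * Algebra of differential operators *)

Section DifferentialOperators.
Variables (R : realType) (N : nat).
Local Notation Pol := {mpoly R[i][N]}.
Implicit Types (T : Pol -> Pol).

(** Unlike in [diffop], an exponent may come with several coefficients, so that sums are
    concatenations; [dop_diffop] collects the repetitions. *)
Definition dop T := exists l : seq (Pol * 'X_{1..N}),
  forall f, T f = \sum_(x <- l) x.1 * f^`M[x.2].

Lemma dop_ext T T' : T =1 T' -> dop T -> dop T'.
Proof. by move=> e [l E]; exists l => f; rewrite -e. Qed.

Lemma dop_diffop T : dop T -> diffop T.
Proof.
move=> [l E]; exists (undup [seq x.2 | x <- l]), (fun al => \sum_(x <- l | x.2 == al) x.1) => f.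
rewrite E; under [RHS]eq_bigr do rewrite mulr_suml big_mkcond.
rewrite exchange_big /=; apply: eq_big_seq => x xl.
rewrite (bigD1_seq x.2) ?mem_undup ?map_f ?undup_uniq //= eqxx big1 ?addr0 // => al ne.
by rewrite eq_sym (negPf ne).
Qed.

Lemma dop_id : dop id.
Proof. by exists [:: (1, 0%MM)] => f; rewrite big_seq1 mul1r mderivm0m. Qed.

Lemma dopD T T' : dop T -> dop T' -> dop (fun f => T f + T' f).
Proof.
by move=> [l E] [l' E']; exists (l ++ l') => f; rewrite big_cat E E'.
Qed.

Lemma dopM a T : dop T -> dop (fun f => a * T f).
Proof.
move=> [l E]; exists [seq (a * x.1, x.2) | x <- l] => f.
by rewrite E big_map mulr_sumr; apply: eq_bigr => x _; rewrite mulrA.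
Qed.

Lemma dop0 : dop (fun=> 0).
Proof. by exists [::] => f; rewrite big_nil. Qed.

Lemma dopZ c T : dop T -> dop (fun f => c *: T f).
Proof. by move/(dopM c%:MP); apply: dop_ext => f; rewrite mul_mpolyC. Qed.

Lemma dopB T T' : dop T -> dop T' -> dop (fun f => T f - T' f).
Proof.
move=> h /(dopZ (-1)) h'; apply: dop_ext (dopD h h') => f.
by rewrite scaleN1r.
Qed.

Lemma dop_sum (I : Type) (r : seq I) (T : I -> Pol -> Pol) :
  (forall i, dop (T i)) -> dop (fun f => \sum_(i <- r) T i f).
Proof.
move=> h; elim: r => [|i r IH].
  by apply: dop_ext dop0 => f; rewrite big_nil.
by apply: dop_ext (dopD (h i) IH) => f; rewrite big_cons.
Qed.

Lemma dop_mderiv i T : dop T -> dop (fun f => (T f)^`M(i)).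
Proof.
move=> [l E].
apply: dop_ext (dop_sum l (T := fun x f => x.1^`M(i) * f^`M[x.2] + x.1 * f^`M[x.2 + U_(i)]) _).
  move=> f; rewrite E raddf_sum; apply: eq_bigr => x _ /=.
  by rewrite mderivM mderivmDm mderivmU1m.
move=> x; apply: dopD; apply: dopM.
  by exists [:: (1, x.2)] => f; rewrite big_seq1 mul1r.
by exists [:: (1, (x.2 + U_(i))%MM)] => f; rewrite big_seq1 mul1r.
Qed.

Lemma dop_comp T T' : dop T -> dop T' -> dop (fun f => T (T' f)).
Proof.
move=> [l E] h.
apply: dop_ext (dop_sum l (T := fun x f => x.1 * (T' f)^`M[x.2]) _) => [f|x].
  by rewrite E.
apply: dopM; apply: (@dop_ext (fun f => foldr (mderiv (R := _)) (T' f)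
   (flatten [seq nseq (x.2 i) i | i <- enum 'I_N]))).
  by move=> f; rewrite mderivm_foldr.
by elim: (flatten _) => [|i s IH] //=; apply: dop_mderiv.
Qed.

End DifferentialOperators.

(** * Representation by differential operators *)

Section Representation.
Variables (R : realType) (N k : nat).
Hypothesis N_gt0 : (0 < N)%N.
Local Notation Pol := {mpoly R[i][N]}.
Local Notation F := {mpoly R[i][N * N + N]}.
Local Notation phi := (@subst_psum R N).
Local Notation PF := (psum (Zdag R N)).
Local Notation Delta := (alternant (Zdag R N) (ldag R N) (@nat_of_ord N)).

Definition polyrep (x : F) := exists q, phi q = x.

Lemma scale_natrVK m (x : F) : (0 < m)%N -> m%:R^-1 *: (m%:R * x) = x.
Proof.
by move=> m0; rewrite mulr_natl -[x *+ m]scaler_nat scalerA mulVf ?scale1r // pnatr_eq0 -lt0n.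
Qed.

Lemma polyrep_nat n : polyrep n%:R.
Proof. by exists (n%:R%:MP); rewrite substC mpolyC_nat. Qed.

Lemma polyrepB x y : polyrep x -> polyrep y -> polyrep (x - y).
Proof. by move=> [p <-] [q <-]; exists (p - q); rewrite substB. Qed.

Lemma polyrepM x y : polyrep x -> polyrep y -> polyrep (x * y).
Proof. by move=> [p <-] [q <-]; exists (p * q); rewrite substM. Qed.

Lemma polyrepZ c x : polyrep x -> polyrep (c *: x).
Proof. by move=> [p <-]; exists (c *: p); rewrite substZ. Qed.

Lemma polyrep_sum (I : Type) (r : seq I) (G : I -> F) :
  (forall i, polyrep (G i)) -> polyrep (\sum_(i <- r) G i).
Proof.
move=> h; apply: (big_ind polyrep) => //; first exact: (polyrep_nat 0).
by move=> x _ [p <-] [q <-]; exists (p + q); rewrite substD.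
Qed.

Lemma polyrep_psum_le n : (0 < n <= N)%N -> polyrep (PF n).
Proof.
case: n => // n /= ltnN; exists (sqrtN R N ^+ n.+1 *: 'X_(Ordinal ltnN)).
rewrite substZ subst_var /npsum scalerA divff ?scale1r //.
by rewrite expf_neq0 // sqrtN_neq0.
Qed.

Lemma polyrep_psum n : polyrep (PF n).
Proof.
apply: powersums_generate.
- exact: polyrep_nat.
- exact: polyrepB.
- exact: polyrepM.
- move=> m x m0 /(polyrepZ m%:R^-1).
  by rewrite scale_natrVK.
- exact: polyrep_psum_le.
Qed.

Lemma polyrep_hsum q n : polyrep (hsum PF q n).
Proof.
elim: q n => [|q IH] n; first exact: polyrep_nat.
rewrite hsumS; apply: polyrep_sum => c.
by apply: polyrepM => //; apply: polyrep_psum.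
Qed.

Definition realizes (t : F -> F) := exists2 T : Pol -> Pol, represents k t T & dop T.

Lemma realizes_t0 n : realizes (tFock R N 0 n).
Proof.
have [q qE] := polyrep_psum n; exists (fun f => q * f); last exact: dopM (dop_id _ _).
by move=> f; rewrite !ofpolyE tFock0 substM qE mulrA.
Qed.

Lemma ofpolyB (f h : Pol) : ofpoly k (f - h) = ofpoly k f - ofpoly k h.
Proof. by rewrite !ofpolyE substB mulrBl. Qed.

Lemma ofpolyZ c (f : Pol) : ofpoly k (c *: f) = c *: ofpoly k f.
Proof. by rewrite !ofpolyE substZ scalerAl. Qed.

(** The second-order coefficients of [H] are multiples of [P_(a+b)], whose index may exceed [N];
    this is where Newton's identities enter. *)
Lemma gam_npsum (a b : 'I_N) : exists q, phi q = gam (@dZ R N) (npsum R b) (npsum R a).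
Proof.
apply: (_ : polyrep _).
have -> : gam (@dZ R N) (npsum R b) (npsum R a) = (sqrtN R N ^- b.+1 * sqrtN R N ^- a.+1) *:
    gam (@dZ R N) (PF b.+1) (PF a.+1).
  rewrite /gam scaler_sumr; apply: eq_bigr => i _; rewrite scaler_sumr.
  apply: eq_bigr => j _.
  by rewrite /npsum /dZ !mderivZ -scalerAl -scalerAr scalerA.
apply: polyrepZ; rewrite gam_psum; last 3 first.
- exact: dZ_D.
- exact: dZ_M.
- exact: dZ_X.
rewrite field_psum; last 3 first.
- exact: dZ_D.
- exact: dZ_M.
- exact: dZ_X.
apply: polyrepM; first exact: polyrep_nat.
by apply: polyrepM; [exact: polyrep_nat|exact: polyrep_psum].
Qed.

(** The first-order coefficients of [H]. They include the cross term with the ground state, which is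
    again a polynomial multiple of it. *)
Lemma lap_npsum_ground (a : 'I_N) : exists q,
  lap (@dZ R N) (npsum R a) * Delta ^+ k + 2%:R * gam (@dZ R N) (npsum R a) (Delta ^+ k)
  = phi q * Delta ^+ k.
Proof.
have lapZ c x : lap (@dZ R N) (c *: x) = c *: lap (@dZ R N) x.
  rewrite /lap scaler_sumr; apply: eq_bigr => i _; rewrite scaler_sumr.
  by apply: eq_bigr => j _; rewrite /dZ !mderivZ.
have gamZ c x y : gam (@dZ R N) (c *: x) y = c *: gam (@dZ R N) x y.
  rewrite /gam scaler_sumr; apply: eq_bigr => i _; rewrite scaler_sumr.
  by apply: eq_bigr => j _; rewrite /dZ mderivZ scalerAl.
have [W [SW]] : exists W, polyrep W /\
    lap (@dZ R N) (PF a.+1 * Delta ^+ k) = W * Delta ^+ k.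
  eexists; split; last first.
    apply: lap_psum_Delta.
    - exact: mpoly_char0.
    - exact: dZ_D.
    - exact: dZ_M.
    - exact: dZ_X.
    - exact: dZ_lam.
  case: (a : nat) => [|b]; first exact: (polyrep_nat 0).
  apply: polyrepM; first exact: polyrep_nat.
  apply: polyrepB; apply: polyrepM; try exact: polyrep_nat.
    exact: polyrep_hsum.
  exact: polyrep_psum.
have [q qE] := polyrepZ (sqrtN R N ^- a.+1) SW.
rewrite lapM; last 2 first.
- exact: dZ_D.
- exact: dZ_M.
rewrite lap_Delta_exp; last 4 first.
- exact: dZ_D.
- exact: dZ_M.
- exact: dZ_X.
- exact: dZ_lam.
rewrite mulr0 addr0 => E; exists q.
by rewrite qE -scalerAl -E /npsum lapZ gamZ scalerDr scalerAl scalerAr.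
Qed.

Lemma realizes_lap : realizes (lap (@dZ R N)).
Proof.
have [Q2 Q2E] := fin_all_exists (fun ab => gam_npsum ab.1 ab.2).
have [Q1 Q1E] := fin_all_exists lap_npsum_ground.
exists (fun f => \sum_a \sum_b Q2 (a, b) * (f^`M(a))^`M(b) + \sum_a Q1 a * f^`M(a)).
  move=> f; rewrite !ofpolyE lapM; last 2 first.
  - exact: dZ_D.
  - exact: dZ_M.
  rewrite lap_Delta_exp; last 4 first.
  - exact: dZ_D.
  - exact: dZ_M.
  - exact: dZ_X.
  - exact: dZ_lam.
  rewrite mulr0 addr0 (gam_chain (@d_subst R N)) (lap_chain (@dZ_D R N) (@dZ_M R N) (@d_subst R N)).
  rewrite substD !subst_sum [LHS]mulrDl [X in _ = X + _]mulrDl -addrA; congr (_ + _).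
    congr (_ * _); apply: eq_bigr => a _; rewrite subst_sum; apply: eq_bigr => b _.
    by rewrite substM (Q2E (a, b)) mulrC.
  rewrite !mulr_suml mulr_sumr -big_split; apply: eq_bigr => a _ /=.
  rewrite substM mulrAC -Q1E mulrDl.
  by congr (_ + _); rewrite [LHS]mulrC; [apply: mulrA|apply: mulrCA].
apply: dopD.
  apply: dop_sum => a; apply: dop_sum => b; apply: dopM.
  by apply: dop_mderiv; apply: dop_mderiv; apply: dop_id.
by apply: dop_sum => a; apply: dopM; apply: dop_mderiv; apply: dop_id.
Qed.

(** Commutators of representable operators are representable, so the recursion through [H] carries
    this over from [t_(0,n)] to every [t_(m,n)]. *)
Lemma realizes_tFock m n : realizes (tFock R N m n).
Proof.
elim: m n => [|m IH] n; first exact: realizes_t0.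
have [T TE dT] := IH n.+1; have [L LE dL] := realizes_lap.
exists (fun f => (2 * n.+1)%:R^-1 *: (L (T f) - T (L f))); last first.
  by apply: dopZ; apply: dopB; apply: dop_comp.
move=> f; rewrite ofpolyZ ofpolyB LE !TE LE tFock_lap_comm.
exact: scale_natrVK.
Qed.

End Representation.

(** * Matrix entries *)

Section Estimates.
Variables (R : realType) (k : nat).
Local Notation C := R[i].
Local Notation fspanned := (spanned (K := R[i]) (A := fun N => fock R N : comAlgType R[i])
  (powersum R) (vac R k)).
Local Notation psp := (psprod (A := fun N => fock R N : comAlgType R[i]) (powersum R)).

(** Zeros of [s] do not count: they become powers of [N] in [psprod_ofpoly]. *)
Definition mcount N (s : seq nat) : 'X_{1..N} := [multinom count_mem i.+1 s | i < N].

Lemma sqrtN_ge1 N : (0 < N)%N -> 1 <= sqrtN R N.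
Proof. by move=> N0; rewrite -[1]sqrtC1 ler_sqrtC ?ler1n // qualifE /= ?ler01 ?ler0n. Qed.

Lemma ler_sqrtN_exp N (m n : int) : (0 < N)%N -> m <= n ->
  sqrtN R N ^ m <= sqrtN R N ^ n.
Proof.
move=> N0 lemn; have x1 := sqrtN_ge1 N0.
have x0 : sqrtN R N != 0 by apply: sqrtN_neq0.
rewrite -(subrK m n) expfzDr // ler_peMl ?exprz_ge0 ?(le_trans ler01) //.
have: 0 <= n - m by rewrite subr_ge0.
by case: (n - m) => // j _; apply: exprn_ege1.
Qed.

Lemma all_leq_sumn s : all (fun a => a <= sumn s)%N s.
Proof.
elim: s => //= a s IH; rewrite leq_addr /=; apply: sub_all IH => b.
by move/leq_trans; apply; rewrite leq_addl.
Qed.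

Lemma psprod_ofpoly N s : (0 < N)%N -> all (fun a => a <= N)%N s ->
  psp N s * vac R k N =
  ofpoly k (sqrtN R N ^+ (2 * count_mem 0%N s + sumn s) *: 'X_[mcount N s]).
Proof.
move=> N0; elim: s => [|a s IH] /=.
  move=> _; rewrite psprod_nil mul1r expr0 scale1r (_ : mcount N [::] = 0%MM).
    by rewrite mpolyX0 ofpolyE subst1 mul1r /vac groundE.
  by apply/mnmP => i; rewrite !mnmE.
move=> /andP[aN sN]; rewrite psprod_cons -mulrA IH // !ofpolyE mulrA; congr (_ * _).
case: a aN => [|a] aN.
  rewrite (_ : mcount N (0%N :: s) = mcount N s); last by apply/mnmP => i; rewrite !mnmE.
  have -> : (2 * (true + count_mem 0%N s) + (0 + sumn s) = 2 + (2 * count_mem 0%N s + sumn s))%N.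
    by rewrite -[nat_of_bool true]/1%N; lia.
  rewrite [in RHS]exprD sqr_sqrtN -scalerA [RHS]substZ.
  by rewrite fock_P0 scaler_nat mulr_natl.
rewrite (_ : mcount N (a.+1 :: s) = (U_(Ordinal aN) + mcount N s)%MM); last first.
  by apply/mnmP => i; rewrite mnmDE mnm1E !mnmE /= -val_eqE /= eqSS eq_sym.
rewrite add0n mpolyXD addnCA [in RHS]exprD -scalerA.
rewrite [_ *: ('X_[U_(_)] * _)]scalerAr scalerAl substM; congr (_ * _).
rewrite substZ subst_var /npsum scalerA divff ?scale1r //.
by rewrite expf_neq0 // sqrtN_neq0.
Qed.

Lemma ofpoly_sum (N : nat) (I : Type) (r : seq I) (G : I -> {mpoly C[N]}) :
  ofpoly k (\sum_(i <- r) G i) = \sum_(i <- r) ofpoly k (G i).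
Proof. by rewrite ofpolyE subst_sum mulr_suml; apply: eq_bigr => i _; rewrite ofpolyE. Qed.

(** After normalization a term with [z] zeros has size [sqrt N ^ (2 z + e)], and [z] is at most
    [B - 1]. The constant is uniform because the coefficients of [v] do not involve [N]. *)
Lemma coef_bound B e s v : fspanned (zsum B (e + (sumn s)%:Z)) v ->
  exists2 M : C, 0 <= M & exists N1 : nat, forall N, (0 < N)%N -> (N1 <= N)%N ->
  forall h : {mpoly C[N]}, ofpoly k h = sqrtN R N ^- sumn s *: v N ->
  forall d, `|h@_d| <= M * sqrtN R N ^ ((2 * B)%N%:Z - 2 + e).
Proof.
move=> [l Ql E]; exists (\sum_(x <- l) `|x.1|); first exact: sumr_ge0.
(* Beyond this threshold every index occurring in [l] is at most [N], so each product is a single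
   monomial and Newton's identities are not called for. *)
exists (sumn (flatten [seq x.2 | x <- l])) => N N0 N1 h hE d.
have lN : all (fun x => all (fun a => a <= N)%N x.2) l.
  apply/allP => x xl; apply/allP => a ax; apply: leq_trans N1.
  apply: (allP (all_leq_sumn _)); apply/flattenP; exists x.2 => //; exact: map_f.
have x0 := sqrtN_neq0 R N0.
have -> : h = \sum_(x <- l)
    (x.1 * sqrtN R N ^ ((2 * count_mem 0%N x.2)%N%:Z + e)) *: 'X_[mcount N x.2].
  apply: (ofpoly_inj (k := k) N0); rewrite hE E ofpoly_sum scaler_sumr.
  apply: eq_big_seq => x xl.
  have /andP[_ /eqP sx] := allP Ql x xl.
  rewrite psprod_ofpoly // ?(allP lN x xl) // !ofpolyZ !scalerA; congr (_ *: _).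
  rewrite -mulrA mulrCA; congr (_ * _); rewrite exprnN exprnP -expfzDr //; congr (_ ^ _).
  by rewrite PoszD sx; ring.
rewrite raddf_sum; apply: le_trans (ler_norm_sum _ _ _) _.
rewrite mulr_suml !big_seq; apply: ler_sum => x xl /=.
have /andP[zx _] := allP Ql x xl.
rewrite mcoeffZ mcoeffX normrM normrM -mulrA ler_wpM2l //.
rewrite [X in X * _]ger0_norm ?exprz_ge0 ?(le_trans ler01) ?sqrtN_ge1 //.
apply: (@le_trans _ _ (sqrtN R N ^ ((2 * count_mem 0%N x.2)%N%:Z + e) * 1)).
  rewrite ler_wpM2l ?exprz_ge0 ?(le_trans ler01) ?sqrtN_ge1 //.
  by case: (_ == _); rewrite ?normr1 ?normr0.
rewrite mulr1; apply: ler_sqrtN_exp => //; rewrite lerD2r.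
have {}zx : (count_mem 0%N x.2 < B)%N := zx.
by move: (count_mem _ _) zx => z zx; lia.
Qed.

(** States of bounded energy come from a finite list that does not depend on [N], so finitely many
    constants and thresholds combine into one. *)
Lemma finite_seqs E : exists L : seq (seq nat), forall s,
  all (leq 1) s -> (sumn s <= E)%N -> s \in L.
Proof.
elim: E => [|E [L HL]].
  by exists [:: [::]] => [[|a s]] //= /andP[a0 _]; lia.
exists ([::] :: [seq a :: s | a <- iota 0 E.+2, s <- L]) => [[|a s]] // /andP[a0 s0] le.
have {}le : (a + sumn s <= E.+1)%N := le.
have {}a0 : (0 < a)%N := a0.
rewrite inE; apply/allpairsP; exists (a, s).
have aE : a \in iota 0 E.+2 by rewrite mem_iota; lia.
by split=> //; apply: HL => //=; lia.
Qed.

Lemma mcount_surj N (c : 'X_{1..N}) : exists s,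
  [/\ all (leq 1) s, all (fun a => a <= N)%N s, sumn s = mnmwgt c & mcount N s = c].
Proof.
exists (flatten [seq nseq (c i) i.+1 | i <- enum 'I_N]); split.
- apply/allP => a /flattenP[u /mapP[i _ ->]].
  by rewrite mem_nseq => /andP[_ /eqP->].
- apply/allP => a /flattenP[u /mapP[i _ ->]].
  by rewrite mem_nseq => /andP[_ /eqP->].
- rewrite sumn_flatten -map_comp sumnE big_map big_enum /=.
  by apply: eq_bigr => i _; rewrite sumn_nseq mulnC.
apply/mnmP => i; rewrite mnmE count_flatten -map_comp sumnE big_map big_enum /=.
rewrite (bigD1 i) //= count_nseq /= eqxx mul1n big1 ?addn0 // => j ji.
by rewrite count_nseq /= eqSS (inj_eq val_inj) (negPf ji).
Qed.

Lemma eqO_spanned E (q : int) B e (T T' : opfamily R) :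
  q = (2 * B)%N%:Z - 2 + e ->
  (forall s, all (leq 1) s -> exists v N1,
     fspanned (zsum B (e + (sumn s)%:Z)) v /\
     forall N, (0 < N)%N -> (N1 <= N)%N -> all (fun a => a <= N)%N s ->
       ofpoly k (T N 'X_[mcount N s] - T' N 'X_[mcount N s]) = sqrtN R N ^- sumn s *: v N) ->
  eqO E q T T'.
Proof.
move=> -> h; have [L HL] := finite_seqs E.
have [M [N0 MB]] : exists M N0, forall N, (N0 <= N)%N -> forall s, s \in L ->
    all (leq 1) s -> all (fun a => a <= N)%N s -> forall d,
   `|(T N 'X_[mcount N s] - T' N 'X_[mcount N s])@_d| <= M * sqrtN R N ^ ((2 * B)%N%:Z - 2 + e).
  (* Nonnegative constants can be added along the list of states. *)
  suff [M M0 [N0 MB]] : exists2 M : C, 0 <= M & exists N0, forall N, (0 < N)%N -> (N0 <= N)%N ->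
    forall s, s \in L -> all (leq 1) s -> all (fun a => a <= N)%N s -> forall d,
   `|(T N 'X_[mcount N s] - T' N 'X_[mcount N s])@_d| <= M * sqrtN R N ^ ((2 * B)%N%:Z - 2 + e).
    exists M, N0.+1 => N ltN; apply: MB; last exact: ltnW.
    exact: leq_ltn_trans (leq0n _) ltN.
  elim: L {HL} => [|s L [M M0 [N0 IH]]]; first by exists 0 => //; exists 0%N.
  have [s1|s1] := boolP (all (leq 1) s); last first.
    exists M => //; exists N0 => N Np le u; rewrite inE => /orP[/eqP -> us|uL].
      by rewrite us in s1.
    exact: IH.
  have [v [N1 [/coef_bound[M' M'0 [N2 hb]] hv]]] := h s s1.
  exists (M + M'); first exact: addr_ge0.
  exists (N0 + N1 + N2)%N => N Np le u; rewrite inE => uL u1 uN d.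
  have xge0 : 0 <= sqrtN R N ^ ((2 * B)%N%:Z - 2 + e).
    by rewrite exprz_ge0 // (le_trans ler01) ?sqrtN_ge1.
  rewrite mulrDl; case/orP: uL => [/eqP us|uL].
    rewrite us in uN *; apply: (@le_trans _ _ (M' * sqrtN R N ^ ((2 * B)%N%:Z - 2 + e))).
      by apply: hb => //; [lia|apply: hv => //; lia].
    by rewrite lerDr mulr_ge0.
  apply: le_trans (IH N Np _ u uL u1 uN d) _; first lia.
  by rewrite lerDl mulr_ge0.
exists M, N0 => N le c d cE.
have [s [s1 sN ss <-]] := mcount_surj c.
by apply: MB => //; apply: HL => //; rewrite ss.
Qed.

End Estimates.

Lemma mulr_rearr (A : comNzRingType) (x y z t : A) : x * y * z * t = x * (z * (y * t)).
Proof. by ring. Qed.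

(** * The five asymptotic expansions *)

Section Expansion.
Variables (R : realType) (k : nat) (t : nat -> nat -> opfamily R).
Arguments t : clear implicits.
Hypothesis t_rep : forall m n N : nat, (1 <= N)%N -> represents k (tFock R N m n) (t m n N).
Local Notation C := R[i].
Local Notation psp := (psprod (A := fun N => fock R N : comAlgType R[i]) (powersum R)).
Local Notation P := (powersum R).
Local Notation vac := (vac R k).

Lemma mul_natX_scale N (a b e : nat) (x : fock R N) :
  (a ^ b)%:R * (N%:R ^+ e * x) = (a%:R ^+ b * sqrtN R N ^+ (2 * e)) *: x.
Proof.
by rewrite exprM sqr_sqrtN -!natrX -natrM !mulr_natl -mulrnA -[LHS]scaler_nat mulnC.
Qed.

Lemma mul_natX_scale3 N (a b e c f : nat) (x : fock R N) :
  (a ^ b * c * f)%:R * N%:R ^+ e * x =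
  (a%:R ^+ b * sqrtN R N ^+ (2 * e) * (c%:R * f%:R)) *: x.
Proof.
rewrite -mulnA natrM mulr_rearr mul_natX_scale [(c * f)%:R * x]mulr_natl.
by rewrite -[x *+ _]scaler_nat scalerA natrM.
Qed.

Lemma scale_CA N (a b : C) (x : fock R N) : a *: (b *: x) = b *: (a *: x).
Proof. by rewrite !scalerA mulrC. Qed.

Lemma ofpoly_mcount N s : (0 < N)%N -> all (leq 1) s -> all (fun a => a <= N)%N s ->
  ofpoly k 'X_[mcount N s] = sqrtN R N ^- sumn s *: (psp N s * vac N).
Proof.
move=> N0 s1 sN; rewrite psprod_ofpoly // ofpolyZ scalerA.
rewrite (_ : count_mem 0%N s = 0%N).
  by rewrite add0n mulVf ?scale1r // expf_neq0 // sqrtN_neq0.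
by apply/eqP; rewrite -leqn0 leqNgt -has_count; apply/hasPn => a /(allP s1); rewrite lt0n.
Qed.

Lemma ofpoly_t m n N s : (0 < N)%N -> all (leq 1) s -> all (fun a => a <= N)%N s ->
  ofpoly k (t m n N 'X_[mcount N s]) = sqrtN R N ^- sumn s *: fockt m n (psp N s * vac N).
Proof.
move=> N0 s1 sN; rewrite t_rep // ofpoly_mcount // /fockt.
exact: (lin_Z (@fock_lin_t R m n)).
Qed.

Lemma ofpoly_tt m n m' n' N s : (0 < N)%N -> all (leq 1) s -> all (fun a => a <= N)%N s ->
  ofpoly k (t m n N (t m' n' N 'X_[mcount N s])) =
  sqrtN R N ^- sumn s *: fockt m n (fockt m' n' (psp N s * vac N)).
Proof.
move=> N0 s1 sN; rewrite t_rep // ofpoly_t // /fockt.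
exact: (lin_Z (@fock_lin_t R m n)).
Qed.

Lemma ofpoly_mulp N d f : (0 < d <= N)%N ->
  ofpoly k (mulp d f) = sqrtN R N ^- d *: (P N d * ofpoly k f).
Proof.
case: d => // d /= dN; rewrite /mulp (big_pred1 (Ordinal dN)); last first.
  by move=> i; rewrite /= eqSS -val_eqE.
by rewrite !ofpolyE substM subst_var -scalerAl -scalerAl mulrA.
Qed.

Lemma derp_mcount N d s : (0 < d <= N)%N ->
  derp d ('X_[mcount N s] : {mpoly C[N]}) = (count_mem d s)%:R *: 'X_[mcount N (rem d s)].
Proof.
case: d => // d /= dN; rewrite /derp (big_pred1 (Ordinal dN)); last first.
  by move=> i; rewrite /= eqSS -val_eqE.
rewrite mderivX mnmE /=; congr (_ *: 'X_[_]); apply/mnmP => i.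
rewrite mnmBE mnm1E !mnmE count_rem /= -val_eqE /= [(d == i)]eq_sym.
have [ins|] := boolP (d.+1 \in s); first by rewrite eq_sym.
case: eqP => [-> /count_memPn ->|]; rewrite ?subn0 //.
Qed.

Lemma expansion_up m n E : (m < n)%N -> eqO E (m%:Z + n%:Z - 2) (t m n)
  (fun N f => (sqrtN R N ^+ (m + n)%N * k.+1%:R ^+ m) *: mulp (n - m)%N f).
Proof.
move=> ltmn; apply: (@eqO_spanned R k _ _ m (n%:Z - m%:Z)); first by lia.
(* The threshold [n] ensures [n - m <= N]; otherwise [mulp] would be zero. *)
move=> s s1; eexists; exists n; split; first exact: (@fock_up R k m n s ltmn s1).
move=> N N0 nN sN; rewrite ofpolyB ofpoly_t // ofpolyZ ofpoly_mulp; last lia.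
rewrite ofpoly_mcount // scalerBr; congr (_ - _).
rewrite fock_P0 -!mulrA mul_natX_scale -scalerAr !scalerA; congr (_ *: _).
have x0 := sqrtN_neq0 R N0.
have -> : (m + n = 2 * m + (n - m))%N by lia.
rewrite exprD; have := expf_neq0 (n - m) x0; have := expf_neq0 (sumn s) x0.
move: (_ ^+ sumn s) (_ ^+ (n - m)) (_ ^+ (2 * m)) (_ ^+ m) => a b c e a0 b0.
by field; rewrite a0 b0.
Qed.

Lemma expansion_diag n E : eqO E (2 * n)%N%:Z (t n n)
  (fun N f => (n.+1%:R^-1 * k.+1%:R ^+ n * sqrtN R N ^+ (2 * n + 2)%N) *: f).
Proof.
apply: (@eqO_spanned R k _ _ n.+1 0); first by lia.
move=> s s1; have h := spannedZ n.+1%:R^-1 (@fock_diag R k n s s1).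
eexists; exists 0%N; split; first by rewrite add0r; exact: h.
move=> N N0 nN sN; rewrite ofpolyB ofpoly_t // ofpolyZ ofpoly_mcount //.
rewrite fock_P0 -!mulrA scalerBr mul_natX_scale scale_natrVK // !scalerA scalerBr !scalerA.
congr (_ - _); congr (_ *: _).
rewrite (_ : 2 * n + 2 = 2 * n.+1)%N; last lia.
by rewrite [LHS]mulrC.
Qed.

Lemma expansion_down m n E : (m < n)%N -> eqO E (m%:Z + n%:Z - 2) (t n m)
  (fun N f => (sqrtN R N ^+ (n + m)%N * k.+1%:R ^+ (n - 1)%N * (n - m)%N%:R) *: derp (n - m)%N f).
Proof.
move=> ltmn; apply: (@eqO_spanned R k _ _ n (m%:Z - n%:Z)); first by lia.
move=> s s1; eexists; exists n; split; first exact: (@fock_down R k m n s ltmn s1).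
move=> N N0 nN sN; rewrite ofpolyB ofpoly_t // ofpolyZ derp_mcount; last lia.
have [ins|] := boolP ((n - m)%N \in s); last first.
  by move/count_memPn => ->; rewrite muln0 !scale0r ofpolyE subst0 !mul0r scaler0 !subr0.
have perm := perm_to_rem ins.
have es : sumn s = (n - m + sumn (rem (n - m)%N s))%N by rewrite (perm_sumn perm).
have r1 : all (leq 1) (rem (n - m)%N s) by apply/allP => a /mem_rem; apply: (allP s1).
have rN : all (fun a => a <= N)%N (rem (n - m)%N s).
  by apply/allP => a /mem_rem; apply: (allP sN).
rewrite ofpolyZ ofpoly_mcount // fock_P0 mul_natX_scale3 !scalerA scalerBr !scalerA.
congr (_ - _); congr (_ *: _); rewrite es subn1.
have -> : (n + m = 2 * n - (n - m))%N by lia.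
have x0 := sqrtN_neq0 R N0.
have -> : sqrtN R N ^+ (2 * n - (n - m)) = sqrtN R N ^+ (2 * n) / sqrtN R N ^+ (n - m).
  by rewrite expfB_cond ?(negPf x0) //; lia.
rewrite exprD; have := expf_neq0 (n - m) x0; have := expf_neq0 (sumn (rem (n - m)%N s)) x0.
move: (_ ^+ sumn _) (_ ^+ (n - m)) (_ ^+ (2 * n)) (_ ^+ n.-1) => a b c e a0 b0.
by field; rewrite a0 b0.
Qed.

Lemma expansion_t21 m n E :
  eqO E (if m.+1 == n then m%:Z + n%:Z + 1 else m%:Z + n%:Z - 1)
    (opcomm (t 2%N 1%N) (t m n))
    (fun N f => (2 * n%:R - m%:R : R[i]) *: t m.+1 n N f).
Proof.
apply: (@eqO_spanned R k _ _ (if m.+1 == n then m.+2 else m.+1) (n%:Z - m.+1%:Z)).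
  by case: eqP => [<-|_]; lia.
move=> s s1; eexists; exists 0%N; split; first exact: (@fock_t21 R k m n s s1).
move=> N N0 nN sN; rewrite /opcomm !ofpolyB ofpolyZ !ofpoly_tt // ofpoly_t //.
rewrite scale_CA -!scalerBr scalerBl mulrBl -natrM !scaler_nat.
by rewrite -natrM !mulr_natl.
Qed.

Lemma expansion_t12 m n E :
  eqO E (if m == n.+1 then m%:Z + n%:Z + 1 else m%:Z + n%:Z - 1)
    (opcomm (t 1%N 2%N) (t m n))
    (fun N f => (n%:R - 2 * m%:R : R[i]) *: t m n.+1 N f).
Proof.
apply: (@eqO_spanned R k _ _ (if m == n.+1 then m.+1 else m) (n.+1%:Z - m%:Z)).
  by case: eqP => [->|_]; lia.
move=> s s1; eexists; exists 0%N; split; first exact: (@fock_t12 R k m n s s1).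
move=> N N0 nN sN; rewrite /opcomm !ofpolyB ofpolyZ !ofpoly_tt // ofpoly_t //.
rewrite scale_CA -!scalerBr scalerBl mulrBl -natrM !scaler_nat.
by rewrite -natrM !mulr_natl.
Qed.

End Expansion.

Theorem theorem4p1 (R : realType) (k : nat) (hk : (1 <= k)%N) :
  (forall N m n : nat, (1 <= N)%N ->
     exists2 T : {mpoly R[i][N]} -> {mpoly R[i][N]},
       represents k (tFock R N m n) T & diffop T) /\
  (forall t : nat -> nat -> opfamily R,
     (forall m n N : nat, (1 <= N)%N ->
        represents k (tFock R N m n) (t m n N)) ->
     forall m n E : nat, (m + n < E)%N ->
     [/\ (m < n)%N ->
           eqO E (m%:Z + n%:Z - 2) (t m n)
             (fun N f => (sqrtN R N ^+ (m + n)%N * k.+1%:R ^+ m) *: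
                           mulp (n - m)%N f),
         m = n ->
           eqO E (2 * n)%N%:Z (t n n)
             (fun N f => (n.+1%:R^-1 * k.+1%:R ^+ n *
                            sqrtN R N ^+ (2 * n + 2)%N) *: f),
         (m < n)%N ->
           eqO E (m%:Z + n%:Z - 2) (t n m)
             (fun N f => (sqrtN R N ^+ (n + m)%N * k.+1%:R ^+ (n - 1)%N *
                            (n - m)%N%:R) *: derp (n - m)%N f),
         eqO E (if m.+1 == n then m%:Z + n%:Z + 1 else m%:Z + n%:Z - 1)
           (opcomm (t 2%N 1%N) (t m n))
           (fun N f => (2 * n%:R - m%:R : R[i]) *: t m.+1 n N f)
       & eqO E (if m == n.+1 then m%:Z + n%:Z + 1 else m%:Z + n%:Z - 1)
           (opcomm (t 1%N 2%N) (t m n))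
           (fun N f => (n%:R - 2 * m%:R : R[i]) *: t m n.+1 N f)]).
Proof.
split=> [N m n N0|t t_rep m n E _].
  by have [T TE /dop_diffop dT] := realizes_tFock R k N0 m n; exists T.
split=> [ltmn|_|ltmn||].
- exact: (expansion_up t_rep).
- exact: (expansion_diag t_rep).
- exact: (expansion_down t_rep).
- exact: (expansion_t21 t_rep).
- exact: (expansion_t12 t_rep).
Qed.
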